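(* Let $K$ be an arbitrary field and let $\mathcal L_{\leq 3}=\{L_K(E)\mid E \text{ is a nonempty graph satisfying Condition (Sing) with } |E^0|\leq 3\}$. (1) There exist exactly $57$ mutually non-isomorphic (as rings) Leavitt path algebras in $\mathcal L_{\leq 3}$, i.e. $\mathcal L_{\le 3}$ consists of exactly $57$ ring-isomorphism classes, and a set of graphs whose Leavitt path algebras represent all the isomorphism classes in $\mathcal L_{\leq 3}$ is given by the following list (the list contains repetitions up to isomorphism of the Leavitt path algebras). Here a graph with vertex set $\{1\}$, $\{1,2\}$ or $\{1,2,3\}$ is given by its set of edges, where $ij$ denotes one edge from vertex $i$ to vertex $j$. Order one: $\emptyset$; $\{11\}$. Order two: $\emptyset$; $\{12\}$; $\{11\}$; $\{11,21\}$; $\{11,12\}$; $\{11,22\}$; $\{11,21,22\}$; $\{11,12,21,22\}$. Order three: (3.1) $\{12,32\}$; $\{21,23,31\}$; $\{11,12,32\}$; $\{21,22,31,32\}$; $\{11,12,21,22\}$; $\{21,22,23,31,32\}$; $\{21,22,31,32,33\}$; $\{11,12,21,22,23\}$; $\{21,22,23,31,32,33\}$. (3.2) $\{23\}$; $\{21,23\}$; $\{22,32\}$; $\{22,23\}$; $\{11,32\}$; $\{11,21,23\}$; $\{21,22,23\}$; $\{22,23,33\}$; $\{11,22,23\}$; $\{11,21,22,23\}$; $\{11,12,32,33\}$. (3.3) $\emptyset$; $\{33\}$; $\{22,33\}$. (3.4) $\{21,23,31,32\}$; $\{21,22,23,31\}$. (3.5) $\{12,13,21,22,32,33\}$; $\{12,13,22,23,32,33\}$;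 $\{11,12,13,21,22,23,32,33\}$. (3.6) $\{12,22,32\}$; $\{12,13,22,32\}$; $\{11,12,22,32\}$; $\{12,13,22,32,33\}$; $\{11,12,21,22,33\}$; $\{12,13,22,31,32,33\}$; $\{11,12,13,22,32,33\}$; $\{11,12,21,22,23,33\}$; $\{11,12,13,22,23,32,33\}$; $\{11,12,13,22,31,32,33\}$; $\{11,12,21,22,23,32,33\}$. (3.7) $\{11,22,32\}$; $\{11,21,23,33\}$; $\{11,22,32,33\}$; $\{11,12,22,32,33\}$; $\{11,21,22,23,33\}$. (3.8) $\{11,22,33\}$. (3.9) $\{12,13,22,23,31,32,33\}$; $\{11,12,13,21,22,23,31,32,33\}$. (3.10) $\{12,13,22,31,32\}$; $\{12,22,31,32,33\}$. (3.11) $\{12,13,21,23,31,32\}$. (3.12) $\{12,13,21,22,23,31,32,33\}$. (3.13) $\{12,13,21,22,23,31,32\}$. (2) A complete system of invariants for $\mathcal L_{\leq 3}$ consists of $({\bf K}_0,\ \mathrm{Soc},\ L/\mathrm{Soc},\ [1],\ \mathrm{ILN},\ \mathrm{HS},\ L/I,\ \mathrm{MT3{+}L})$: two Leavitt path algebras $L_K(E)$ and $L_K(F)$ in $\mathcal L_{\leq 3}$ are isomorphic as rings if and only if the data of these invariants for $E$ and $F$ coincide.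
   Context: A (directed) graph $E=(E^0,E^1,r,s)$ consists of a set $E^0$ of vertices, a set $E^1$ of edges and maps $r,s:E^1\to E^0$ (range, source). Condition (Sing): $E$ has no parallel edges, i.e. for every ordered pair $(v,w)$ of vertices (including $v=w$) there is at most one edge from $v$ to $w$. The Leavitt path algebra $L_K(E)$ of a row-finite graph $E$ (each vertex emits finitely many edges) over a field $K$ is the $K$-algebra generated by $E^0\cup E^1\cup\{e^*\mid e\in E^1\}$ with relations: $vw=\delta_{v,w}v$ for $v,w\in E^0$; $s(e)e=er(e)=e$ and $r(e)e^*=e^*s(e)=e^*$ for $e\in E^1$; $e^*f=\delta_{e,f}r(e)$ for $e,f\in E^1$; $v=\sum_{e\in s^{-1}(v)}ee^*$ for every $v\in E^0$ that is not a sink (a sink is a vertex emitting no edges). It is unital if $E^0$ is finite, with $1=\sum_{v\in E^0}v$. It is $\mathbb Z$-graded, with degree $n$ component spanned by the $pq^*$, $p,q$ paths with $l(p)-l(q)=n$. A path is a vertex (length $0$) or a finite sequence of edges $e_1\cdots e_n$ with $r(e_i)=s(e_{i+1})$. A closed path $e_1\cdots e_n$ ($n\geq 1$) with $s(e_1)=r(e_n)$ and $s(e_i)\ne s(e_j)$ for $i\neq j$ is a cycle; an exit for it is an edge $e$ with $s(e)=s(e_i)$ and $e\ne e_i$ for some $i$. Write $v\ge w$ if there is a path from $v$ to $w$. A subset $H\subseteq E^0$ is hereditary if $v\in H$, $v\ge w$ imply $w\in H$; saturated if $s^{-1}(v)\neq\emptyset$ finite and $r(s^{-1}(v))\subseteq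 H$ imply $v\in H$. $\mathcal H_E$ is the set of hereditary saturated subsets. Invariants: - ${\bf K}_0$ is ${\bf K}_0(L_K(E))$ (up to group isomorphism), and $[1]$ is the class $[1_{L_K(E)}]\in {\bf K}_0(L_K(E))$; that these coincide for $E$ and $F$ means that there is a group isomorphism ${\bf K}_0(L_K(E))\to{\bf K}_0(L_K(F))$ carrying $[1_{L_K(E)}]$ to $[1_{L_K(F)}]$. - $\mathrm{Soc}$ is the socle of $L_K(E)$ (sum of all minimal left ideals, $0$ if there are none), and $L/\mathrm{Soc}$ is $L_K(E)/\mathrm{Soc}(L_K(E))$, both up to ring isomorphism. - $\mathrm{ILN}$ is the number of isolated loops of $E$, i.e. of vertices $u$ carrying exactly one loop and such that no other edge starts or ends at $u$. - $\mathrm{HS}=|\mathcal H_E|-2$. - $L/I$ (considered only when $\mathrm{HS}=1$) is the quotient of $L_K(E)$ by its only nontrivial (i.e. different from $0$ and $L_K(E)$) graded ideal $I$, up to ring isomorphism. - $\mathrm{MT3{+}L}$ is the truth value of: $E$ satisfies both Condition (MT3) (for all $v,w\in E^0$ there is $u\in E^0$ with $v\ge u$ and $w\ge u$) and Condition (L) (every cycle in $E$ has an exit). *)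

(* Defs.v *)
From HB Require Import structures.
From mathcomp Require Import all_boot all_order all_algebra.
From mathcomp Require Import ring_quotient.
From mathcomp.multinomials Require Import monalg.
From mathcomp.classical Require Import boolp classical_sets functions.

Set Implicit Arguments.
Unset Strict Implicit.
Unset Printing Implicit Defensive.

Import GRing.Theory.
Local Open Scope ring_scope.
Local Open Scope quotient_scope.

Section Ideals.
Variable R : pzRingType.

Definition left_ideal (I : set R) : Prop :=
  [/\ I 0, forall x y, I x -> I y -> I (x + y) & forall a x, I x -> I (a * x)].

Definition two_sided_ideal (I : set R) : Prop :=
  left_ideal I /\ forall a x, I x -> I (x * a).

Record ideal := Ideal { ideal_set :> R -> Prop; idealP : two_sided_ideal ideal_set }.

Definition minimal_left_ideal (M : set R) : Prop :=
  [/\ left_ideal M, exists2 x, M x & x != 0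
    & forall N : set R, left_ideal N -> (forall x, N x -> M x) ->
        (exists2 x, N x & x != 0) -> forall x, M x -> N x].

Definition socle_set : set R := fun x =>
  exists2 s : seq R,
    forall y, y \in s -> exists2 M, minimal_left_ideal M & M y
    & x = \sum_(y <- s) y.

Lemma minimal_left_ideal_mulr M a : minimal_left_ideal M ->
  (forall x, M x -> x * a = 0) \/
  minimal_left_ideal (fun y => exists2 x, M x & y = x * a).
Proof.
move=> [[M0 MD MM] _ Mmin].
have [Ma0|nMa0] := pselect (forall x, M x -> x * a = 0); [by left|right].
split.
- split; first by exists 0; rewrite ?mul0r.
  + move=> _ _ [x Mx ->] [y My ->]; exists (x + y); [exact: MD|by rewrite mulrDl].
  + by move=> b _ [x Mx ->]; exists (b * x); [exact: MM|rewrite mulrA].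
- apply: contrapT => nex; apply: nMa0 => x Mx.
  apply/eqP; apply: contrapT => /negP xa0; apply: nex.
  by exists (x * a) => //; exists x.
move=> N [N0 ND NM] NMa [y Ny y0] _ [z Mz ->].
suff /(_ z Mz)[] : forall x, M x -> M x /\ N (x * a) by [].
apply: (Mmin (fun x => M x /\ N (x * a))).
- split; first by rewrite mul0r.
  + by move=> u v [Mu Nu] [Mv Nv]; split; [exact: MD|rewrite mulrDl; exact: ND].
  + by move=> b u [Mu Nu]; split; [exact: MM|rewrite -mulrA; exact: NM].
- by move=> x [].
- have [x Mx yE] := NMa _ Ny; exists x; first by rewrite -yE.
  by apply: contra y0 => /eqP x0; rewrite yE x0 mul0r.
Qed.

Lemma socle_two_sided : two_sided_ideal socle_set.
Proof.
split; last first.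
  move=> a _ [s sP ->]; exists [seq y * a | y <- s & y * a != 0].
    move=> z /mapP[y]; rewrite mem_filter => /andP[ya0 ys] ->.
    have [M Mmin My] := sP _ ys.
    have [Ma0|Mamin] := minimal_left_ideal_mulr a Mmin.
      by rewrite Ma0 ?eqxx in ya0.
    by eexists; [exact: Mamin|exists y].
  rewrite big_map big_filter mulr_suml [RHS]big_mkcond /=.
  by apply: eq_bigr => y _; case: eqP.
split.
- by exists [::]; rewrite ?big_nil.
- move=> _ _ [s sP ->] [t tP ->]; exists (s ++ t); last by rewrite big_cat.
  by move=> y; rewrite mem_cat => /orP[/sP|/tP].
- move=> a _ [s sP ->]; exists [seq a * y | y <- s].
    move=> _ /mapP[y ys ->]; have [M Mmin My] := sP _ ys; exists M => //.
    by case: Mmin => [[_ _ MM] _ _]; exact: MM.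
  by rewrite big_map mulr_sumr.
Qed.

Definition socle : ideal := Ideal socle_two_sided.

Definition gen_ideal_set (X : set R) : set R := fun x =>
  forall I : ideal, (forall y, X y -> I y) -> I x.

Lemma gen_ideal_two_sided X : two_sided_ideal (gen_ideal_set X).
Proof.
split; first split.
- by move=> I _; case: (idealP I) => [[]].
- move=> x y Ix Iy I XI; case: (idealP I) => [[_ ID _] _].
  by apply: ID; [exact: Ix|exact: Iy].
- by move=> a x Ix I XI; case: (idealP I) => [[_ _ IM] _]; apply: IM; exact: Ix.
- by move=> a x Ix I XI; case: (idealP I) => [_ IM]; apply: IM; exact: Ix.
Qed.

Definition gen_ideal (X : set R) : ideal := Ideal (gen_ideal_two_sided X).

Definition ideal_pred (I : ideal) : {pred R} := fun x => `[< I x >].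

Lemma ideal_zmod_closed I : zmod_closed (ideal_pred I).
Proof.
case: (idealP I) => [[I0 ID IM] _]; split; first by apply/asboolP.
move=> x y /asboolP Ix /asboolP Iy; apply/asboolP; apply: ID => //.
by rewrite -mulN1r; apply: IM.
Qed.

HB.instance Definition _ I :=
  GRing.isZmodClosed.Build R (ideal_pred I) (ideal_zmod_closed I).

Definition quot_ring (I : ideal) := Quotient.quot (ideal_pred I).

HB.instance Definition _ I := GRing.Zmodule.on (quot_ring I).
HB.instance Definition _ I := EqQuotient.on (quot_ring I).

Section QuotRing.
Variable I : ideal.
Local Notation Q := (quot_ring I).

Definition quot_one : Q := lift_cst Q 1.
Definition quot_mul := lift_op2 Q *%R.
Canonical quot_one_morph := PiConst quot_one.

Lemma pi_quot_mul : {morph \pi_Q : x y / x * y >-> quot_mul x y}.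
Proof.
move=> x y; unlock quot_mul; apply/eqP.
rewrite -[_ == _]Quotient.idealrBE; apply/asboolP.
have reprP z : I (z - repr (\pi_Q z)).
  suff : z - repr (\pi_Q z) \in ideal_pred I by move/asboolP.
  by rewrite Quotient.idealrBE reprK.
case: (idealP I) => [[_ ID IM] IMr].
rewrite -[x * y](subrK (x * repr (\pi_Q y))) -mulrBr -addrA -mulrBl.
by apply: ID; [exact: IM|exact: IMr].
Qed.
Canonical pi_quot_mul_morph := PiMorph2 pi_quot_mul.

Lemma quot_mulA : associative quot_mul.
Proof. by move=> x y z; rewrite -[x]reprK -[y]reprK -[z]reprK !piE mulrA. Qed.

Lemma quot_mul1q : left_id quot_one quot_mul.
Proof. by move=> x; rewrite -[x]reprK !piE mul1r. Qed.

Lemma quot_mulq1 : right_id quot_one quot_mul.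
Proof. by move=> x; rewrite -[x]reprK !piE mulr1. Qed.

Lemma quot_mulDl : left_distributive quot_mul +%R.
Proof. by move=> x y z; rewrite -[x]reprK -[y]reprK -[z]reprK !piE mulrDl. Qed.

Lemma quot_mulDr : right_distributive quot_mul +%R.
Proof. by move=> x y z; rewrite -[x]reprK -[y]reprK -[z]reprK !piE mulrDr. Qed.

HB.instance Definition _ := GRing.Zmodule_isPzRing.Build Q
  quot_mulA quot_mul1q quot_mulq1 quot_mulDl quot_mulDr.

Definition quot_proj : R -> Q := \pi_Q.

Lemma quot_proj_zmod_morphism : zmod_morphism quot_proj.
Proof. by move=> x y; rewrite /quot_proj !piE. Qed.

Lemma quot_proj_monoid_morphism : monoid_morphism quot_proj.
Proof. by split=> [|x y]; rewrite /quot_proj !piE. Qed.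

HB.instance Definition _ :=
  GRing.isZmodMorphism.Build R Q quot_proj quot_proj_zmod_morphism.
HB.instance Definition _ :=
  GRing.isMonoidMorphism.Build R Q quot_proj quot_proj_monoid_morphism.

Lemma quot_proj_surj x : exists y, quot_proj y = x.
Proof. by exists (repr x); rewrite /quot_proj reprK. Qed.

Lemma quot_proj_eq x y : quot_proj x = quot_proj y <-> I (x - y).
Proof.
split=> [/eqP|Ixy]; last apply/eqP; rewrite -Quotient.idealrBE.
  by move/asboolP.
exact/asboolP.
Qed.

End QuotRing.
End Ideals.

Definition ring_isomorphic (R S : pzRingType) : Prop :=
  exists f : {rmorphism R -> S}, bijective f.

(* Isomorphism of the ideals I and J as rings without unit. *)
Definition ideal_ring_isomorphic (R S : pzRingType) (I : ideal R) (J : ideal S) :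
    Prop :=
  exists2 f : R -> S, set_bij I J f
    & forall x y, I x -> I y -> f (x + y) = f x + f y /\ f (x * y) = f x * f y.

(* Isomorphism classes of modules live in a universe above that of the modules,
   so they cannot be given the structures of the algebraic hierarchy (they
   require a choice structure, hence a small carrier).  The quotients below are
   therefore plain types of equivalence classes. *)
Section Classes.
Variables (T : Type) (E : T -> T -> Prop).

Definition classes : Type := {C : T -> Prop | exists x, C = E x}.

Definition class_of (x : T) : classes := exist _ (E x) (ex_intro _ x erefl).

Definition class_repr (c : classes) : T := projT1 (cid (svalP c)).

Lemma classes_inj (c d : classes) : sval c = sval d -> c = d.
Proof.
by case: c d => [C hC] [D hD] /= CD; subst D; congr exist; exact: Prop_irrelevance.
Qed.

Lemma class_reprK c : class_of (class_repr c) = c.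
Proof.
by apply: classes_inj; rewrite /class_repr; case: cid => x /= ->.
Qed.

Hypothesis Erefl : forall x, E x x.
Hypothesis Esym : forall x y, E x y -> E y x.
Hypothesis Etrans : forall x y z, E x y -> E y z -> E x z.

Lemma class_ofP x y : class_of x = class_of y <-> E x y.
Proof.
split=> [/(congr1 sval) /= ->|Exy]; first exact: Erefl.
apply: classes_inj => /=; apply: funext => z; apply: propext.
by split=> [|Eyz]; [exact/Etrans/Esym|exact: Etrans Eyz].
Qed.

End Classes.

Section K0.
Variable R : pzRingType.

Definition finitely_generated (P : lmodType R) : Prop :=
  exists (n : nat) (g : 'I_n -> P),
    forall x, exists c : 'I_n -> R, x = \sum_(i < n) c i *: g i.

Definition projective (P : lmodType R) : Prop :=
  forall (M N : lmodType R) (f : {linear M -> N}) (g : {linear P -> N}),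
    (forall y, exists x, f x = y) ->
    exists h : {linear P -> M}, forall x, f (h x) = g x.

Record fgproj := FGProj {
  fgproj_module :> lmodType R;
  fgproj_fg : finitely_generated fgproj_module;
  fgproj_proj : projective fgproj_module }.

Definition module_isomorphic (P Q : lmodType R) : Prop :=
  exists f : {linear P -> Q}, bijective f.

Lemma linear_exists (P Q : lmodType R) (f : P -> Q) :
  linear f -> exists g : {linear P -> Q}, g =1 f.
Proof.
move=> lf; pose m := GRing.isLinear.Build _ _ _ _ f lf.
by exists (HB.pack_for {linear P -> Q} f m).
Qed.

Lemma dsum_fg (P Q : fgproj) : finitely_generated (P * Q)%type.
Proof.
have [n [g gP]] := fgproj_fg P; have [m [h hP]] := fgproj_fg Q.
pose k (i : 'I_(n + m)) : P * Q :=
  match fintype.split i with inl j => (g j, 0) | inr j => (0, h j) end.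
exists (n + m)%N, k => -[x y]; have [c ->] := gP x; have [d ->] := hP y.
exists (fun i : 'I_(n + m) => match fintype.split i with inl j => c j | inr j => d j end).
have splitl j : fintype.split (lshift m j) = inl j := unsplitK (inl j).
have splitr j : fintype.split (rshift n j) = inr j := unsplitK (inr j).
rewrite big_split_ord /=.
rewrite (eq_bigr (fun i => c i *: (g i, 0) : P * Q)); last first.
  by move=> i _; rewrite /k splitl.
rewrite [X in _ + X](eq_bigr (fun i => d i *: (0, h i) : P * Q)); last first.
  by move=> i _; rewrite /k splitr.
rewrite [RHS]surjective_pairing; congr pair; rewrite raddfD !raddf_sum /=.
  by rewrite [X in _ + X]big1 ?addr0 // => i _; exact: scaler0.
by rewrite [X in X + _]big1 ?add0r // => i _; exact: scaler0.
Qed.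

Lemma dsum_proj (P Q : fgproj) : projective (P * Q)%type.
Proof.
move=> M N f g fsurj.
have [g1 g1E] : exists g1 : {linear P -> N}, g1 =1 fun x => g (x, 0).
  apply: linear_exists => a x y /=; rewrite -linearP; congr (g _).
  by rewrite [RHS]surjective_pairing /= scaler0 addr0.
have [g2 g2E] : exists g2 : {linear Q -> N}, g2 =1 fun x => g (0, x).
  apply: linear_exists => a x y /=; rewrite -linearP; congr (g _).
  by rewrite [RHS]surjective_pairing /= scaler0 addr0.
have [h1 h1E] := fgproj_proj g1 fsurj; have [h2 h2E] := fgproj_proj g2 fsurj.
have [h hE] : exists h : {linear (P * Q)%type -> M},
    h =1 fun x => h1 x.1 + h2 x.2.
  apply: linear_exists => a x y /=.
  by rewrite !linearP scalerDr addrACA.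
exists h => -[x y]; rewrite hE /= linearD h1E h2E g1E g2E -linearD; congr (g _).
by rewrite [LHS]surjective_pairing /= addr0 add0r.
Qed.

Definition dsum (P Q : fgproj) : fgproj := FGProj (@dsum_fg P Q) (@dsum_proj P Q).

Lemma regular_fg : finitely_generated R^o.
Proof.
exists 1%N, (fun=> 1) => x; exists (fun=> x).
by rewrite big_ord1 [RHS]mulr1.
Qed.

Lemma regular_proj : projective R^o.
Proof.
move=> M N f g fsurj; have [m mE] := fsurj (g 1).
have [h hE] : exists h : {linear R^o -> M}, h =1 fun x : R^o => (x : R) *: m.
  by apply: linear_exists => a x y; rewrite scalerDl scalerA.
exists h => x; rewrite hE linearZ /= mE -linearZ /=; congr (g _).
exact: mulr1.
Qed.

Definition regular_fgproj : fgproj := FGProj regular_fg regular_proj.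

Lemma zero_fg : finitely_generated 'rV[R]_0.
Proof.
exists 0%N, (fun=> 0) => x; exists (fun=> 0); rewrite big_ord0.
by apply/rowP => -[].
Qed.

Lemma zero_proj : projective 'rV[R]_0.
Proof.
move=> M N f g _; have [h hE] : exists h : {linear 'rV[R]_0 -> M}, h =1 fun=> 0.
  by apply: linear_exists => a x y; rewrite scaler0 addr0.
exists h => x; rewrite hE linear0 -(linear0 g); congr (g _).
by apply/rowP => -[].
Qed.

Definition zero_fgproj : fgproj := FGProj zero_fg zero_proj.

(* V(R): isomorphism classes of finitely generated projective left modules. *)
Definition V_monoid : Type := classes (fun P Q : fgproj => module_isomorphic P Q).

Definition V_class (P : fgproj) : V_monoid := class_of _ P.

Definition V_add (a b : V_monoid) : V_monoid :=
  V_class (dsum (class_repr a) (class_repr b)).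

(* K_0(R): the group completion of V(R), as formal differences a - b. *)
Definition K0_eq (x y : V_monoid * V_monoid) : Prop :=
  exists t, V_add (V_add x.1 y.2) t = V_add (V_add y.1 x.2) t.

Definition K0 : Type := classes K0_eq.

Definition K0_diff (a b : V_monoid) : K0 := class_of _ (a, b).

Definition K0_add (x y : K0) : K0 :=
  K0_diff (V_add (class_repr x).1 (class_repr y).1)
          (V_add (class_repr x).2 (class_repr y).2).

Definition K0_class (P : fgproj) : K0 := K0_diff (V_class P) (V_class zero_fgproj).

Definition K0_one : K0 := K0_class regular_fgproj.

Lemma linear_bij (P Q : lmodType R) (f : P -> Q) :
  linear f -> bijective f -> module_isomorphic P Q.
Proof. by move=> /linear_exists[g gE] fb; exists g; apply: eq_bij fb _ _. Qed.

Lemma module_iso_refl (P : lmodType R) : module_isomorphic P P.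
Proof. by apply: (@linear_bij _ _ id) => //; exists id. Qed.

Lemma module_iso_sym (P Q : lmodType R) :
  module_isomorphic P Q -> module_isomorphic Q P.
Proof.
move=> [f [g fK gK]]; apply: (@linear_bij _ _ g); last by exists f.
by move=> a x y; apply: (can_inj fK); rewrite linearP !gK.
Qed.

Lemma module_iso_trans (P Q S : lmodType R) :
  module_isomorphic P Q -> module_isomorphic Q S -> module_isomorphic P S.
Proof.
move=> [f fb] [g gb]; apply: (@linear_bij _ _ (g \o f)); last exact: bij_comp.
by move=> a x y /=; rewrite !linearP.
Qed.

Lemma dsum_iso (P P' Q Q' : fgproj) :
  module_isomorphic P P' -> module_isomorphic Q Q' ->
  module_isomorphic (dsum P Q) (dsum P' Q').
Proof.
move=> [f [f' fK fK']] [g [g' gK gK']].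
apply: (@linear_bij _ _ (fun x : dsum P Q => (f x.1, g x.2) : dsum P' Q')).
  by move=> a x y /=; rewrite !linearP.
by exists (fun x => (f' x.1, g' x.2)) => -[x y] /=; rewrite ?fK ?gK ?fK' ?gK'.
Qed.

Lemma V_classP (P Q : fgproj) : V_class P = V_class Q <-> module_isomorphic P Q.
Proof.
apply: class_ofP => [?|? ?|? ? ?].
- exact: module_iso_refl.
- exact: module_iso_sym.
- exact: module_iso_trans.
Qed.

Lemma V_ind (p : V_monoid -> Prop) : (forall P, p (V_class P)) -> forall a, p a.
Proof. by move=> pP a; rewrite -(class_reprK a); apply: pP. Qed.

Lemma V_classD P Q : V_class (dsum P Q) = V_add (V_class P) (V_class Q).
Proof.
by apply/V_classP/dsum_iso; apply/V_classP; rewrite {2}/V_class class_reprK.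
Qed.

Lemma V_addC : commutative V_add.
Proof.
elim/V_ind=> P; elim/V_ind=> Q; rewrite -!V_classD; apply/V_classP.
apply: (@linear_bij _ _ (fun x : dsum P Q => (x.2, x.1) : dsum Q P)) => //.
by exists (fun x => (x.2, x.1)) => -[].
Qed.

Lemma V_addA : associative V_add.
Proof.
elim/V_ind=> P; elim/V_ind=> Q; elim/V_ind=> S; rewrite -!V_classD.
apply/V_classP; apply: (@linear_bij _ _
  (fun x : dsum P (dsum Q S) => ((x.1, x.2.1), x.2.2) : dsum (dsum P Q) S)) => //.
by exists (fun x => (x.1.1, (x.1.2, x.2))) => [[? []]|[[]]].
Qed.

Lemma V_add0 : left_id (V_class zero_fgproj) V_add.
Proof.
elim/V_ind=> P; rewrite -V_classD; apply/V_classP.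
apply: (@linear_bij _ _ (fun x : dsum zero_fgproj P => x.2)) => //.
exists (fun x : P => (0, x) : dsum zero_fgproj P) => // -[x y] /=.
by congr pair; apply/rowP => -[].
Qed.

HB.instance Definition _ := Monoid.isComLaw.Build V_monoid (V_class zero_fgproj)
  V_add V_addA V_addC V_add0.

Lemma K0_diffP a b c d :
  K0_diff a b = K0_diff c d <->
  exists t, V_add (V_add a d) t = V_add (V_add c b) t.
Proof.
apply: class_ofP => [[x y]|[x y] [z w]|[x y] [z w] [u v]]; first by exists x.
  by case=> t /= e; exists t.
case=> s /= es [t /= et]; exists (V_add (V_add z w) (V_add s t)) => /=.
rewrite [LHS](AC (2*(2*2)) ((1*4*5)*(3*2*6))) /= es et.
by rewrite [LHS](AC (3*3) ((4*2)*((1*5)*(3*6)))).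
Qed.

Lemma K0_ind (p : K0 -> Prop) : (forall a b, p (K0_diff a b)) -> forall x, p x.
Proof. by move=> pd x; rewrite -(class_reprK x); case: (class_repr x) => a b; exact: pd. Qed.

Lemma K0_diffD a b c d :
  K0_add (K0_diff a b) (K0_diff c d) = K0_diff (V_add a c) (V_add b d).
Proof.
have /K0_diffP[s es] : K0_diff (class_repr (K0_diff a b)).1
    (class_repr (K0_diff a b)).2 = K0_diff a b.
  by rewrite -[RHS]class_reprK /K0_diff -surjective_pairing.
have /K0_diffP[t et] : K0_diff (class_repr (K0_diff c d)).1
    (class_repr (K0_diff c d)).2 = K0_diff c d.
  by rewrite -[RHS]class_reprK /K0_diff -surjective_pairing.
apply/K0_diffP; exists (V_add s t).
rewrite [LHS](AC ((2*2)*2) ((1*3*5)*(2*4*6))) /= es et.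
by rewrite [LHS](AC (3*3) (((1*4)*(2*5))*(3*6))).
Qed.

Lemma K0_addA : associative K0_add.
Proof.
elim/K0_ind=> a b; elim/K0_ind=> c d; elim/K0_ind=> e f.
by rewrite !K0_diffD !V_addA.
Qed.

Lemma K0_addC : commutative K0_add.
Proof.
elim/K0_ind=> a b; elim/K0_ind=> c d.
by rewrite !K0_diffD; congr K0_diff; exact: V_addC.
Qed.

Lemma K0_add0 : left_id (K0_class zero_fgproj) K0_add.
Proof. by elim/K0_ind=> a b; rewrite K0_diffD !V_add0. Qed.

Lemma K0_addN a b :
  K0_add (K0_diff a b) (K0_diff b a) = K0_class zero_fgproj.
Proof.
rewrite K0_diffD; apply/K0_diffP; exists (V_class zero_fgproj).
by congr V_add; rewrite V_addC; congr V_add; exact: V_addC.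
Qed.

Lemma K0_classD P Q : K0_class (dsum P Q) = K0_add (K0_class P) (K0_class Q).
Proof. by rewrite /K0_class V_classD K0_diffD V_add0. Qed.

End K0.

(* There is a group isomorphism K_0(R) -> K_0(S) carrying [R] to [S]. *)
Definition pointed_K0_isomorphic (R S : pzRingType) : Prop :=
  exists f : K0 R -> K0 S,
    [/\ bijective f, {morph f : x y / K0_add x y} & f (K0_one R) = K0_one S].

(* Row-finite graphs with finitely many vertices, i.e. finite graphs. *)
Record graph := Graph {
  vertex : finType;
  edge : finType;
  src : edge -> vertex;
  rng : edge -> vertex }.

Section GraphNotions.
Variable E : graph.
Implicit Types (u v w : vertex E) (e f : edge E) (es : seq (edge E)).

Definition condition_Sing : Prop :=
  forall e f, src e = src f -> rng e = rng f -> e = f.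

Definition sink v : Prop := forall e, src e <> v.

Definition follows : rel (edge E) := fun e f => rng e == src f.

(* A path is given by its source and its list of edges. *)
Definition is_path (p : vertex E * seq (edge E)) : bool :=
  if p.2 is e :: es then (src e == p.1) && path follows e es else true.

Definition is_cycle es : bool :=
  [&& es != [::], cycle follows es & uniq [seq src e | e <- es]].

Definition has_exit es : Prop :=
  exists e f, [/\ f \in es, src e = src f & e <> f].

Definition condition_L : Prop := forall es, is_cycle es -> has_exit es.

(* The transitive closure is reflexive: the paths of length 0 are the vertices. *)
Definition reaches v w : bool :=
  connect (fun v w => [exists e, (src e == v) && (rng e == w)]) v w.

Definition condition_MT3 : Prop :=
  forall v w, exists u, reaches v u /\ reaches w u.

Definition hereditary (H : {set vertex E}) : bool :=
  [forall v in H, forall w, reaches v w ==> (w \in H)].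

Definition saturated (H : {set vertex E}) : bool :=
  [forall v, [exists e, src e == v] &&
             [forall e, (src e == v) ==> (rng e \in H)] ==> (v \in H)].

Definition HS : nat := #|[set H | hereditary H && saturated H]| - 2.

Definition isolated_loop u : bool :=
  (#|[set e | (src e == u) && (rng e == u)]| == 1%N) &&
  [forall e, ((src e == u) || (rng e == u)) ==>
             ((src e == u) && (rng e == u))].

Definition ILN : nat := #|[set u | isolated_loop u]|.

End GraphNotions.

Section LeavittPathAlgebra.
Variables (K : fieldType) (E : graph).

(* The free unital K-algebra on the symbols v (vertices), e and e^* (edges). *)
Definition path_symbol : choiceType := (vertex E + (edge E + edge E))%type.
Definition free_algebra := {malg K[{fmonom path_symbol}]}.

Definition vtx (v : vertex E) : free_algebra := << fmu (inl v : path_symbol) >>.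
Definition edg (e : edge E) : free_algebra :=
  << fmu (inr (inl e) : path_symbol) >>.
Definition ghost (e : edge E) : free_algebra :=
  << fmu (inr (inr e) : path_symbol) >>.

(* The Leavitt path algebra is presented as an algebra without unit, in which the
   sum of the (finitely many) vertices turns out to be a unit; as the free algebra
   used here has a unit of its own, RelUnit identifies the latter with that sum. *)
Variant lpa_relation : free_algebra -> free_algebra -> Prop :=
| RelUnit : lpa_relation (\sum_(v : vertex E) vtx v) 1
| RelVertex v w : lpa_relation (vtx v * vtx w) (vtx v *+ (v == w))
| RelSourceReal e : lpa_relation (vtx (src e) * edg e) (edg e)
| RelRealRange e : lpa_relation (edg e * vtx (rng e)) (edg e)
| RelRangeGhost e : lpa_relation (vtx (rng e) * ghost e) (ghost e)
| RelGhostSource e : lpa_relation (ghost e * vtx (src e)) (ghost e)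
| RelCK1 e f : lpa_relation (ghost e * edg f) (vtx (rng e) *+ (e == f))
| RelCK2 v : ~ sink v ->
    lpa_relation (vtx v) (\sum_(e | src e == v) edg e * ghost e).

Definition lpa_ideal : ideal free_algebra :=
  gen_ideal (fun x => exists a b, lpa_relation a b /\ x = a - b).

Definition lpa : pzRingType := quot_ring lpa_ideal.

Definition edge_path (p : vertex E * seq (edge E)) : free_algebra :=
  if p.2 is [::] then vtx p.1 else \prod_(e <- p.2) edg e.

Definition ghost_path (p : vertex E * seq (edge E)) : free_algebra :=
  if p.2 is [::] then vtx p.1 else \prod_(e <- rev p.2) ghost e.

Definition homogeneous (n : int) (x : lpa) : Prop :=
  exists s : seq (K * (vertex E * seq (edge E)) * (vertex E * seq (edge E))),
    (forall c p q, (c, p, q) \in s ->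
       [/\ is_path p, is_path q & (size p.2)%:Z - (size q.2)%:Z = n]) /\
    x = \sum_(t <- s) quot_proj lpa_ideal
          (t.1.1 *: (edge_path t.1.2 * ghost_path t.2)).

Definition graded (I : ideal lpa) : Prop :=
  forall x, I x -> exists s : seq lpa,
    (forall y, y \in s -> I y /\ exists n, homogeneous n y) /\
    x = \sum_(y <- s) y.

Definition nontrivial_graded (I : ideal lpa) : Prop :=
  [/\ graded I, exists2 x, I x & x != 0 & exists x, ~ I x].

Definition only_nontrivial_graded (I : ideal lpa) : Prop :=
  nontrivial_graded I /\
  forall J, nontrivial_graded J -> forall x, J x <-> I x.

End LeavittPathAlgebra.

Definition LI_isomorphic (K : fieldType) (E F : graph) : Prop :=
  exists (I : ideal (lpa K E)) (J : ideal (lpa K F)),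
    [/\ only_nontrivial_graded I, only_nontrivial_graded J
      & ring_isomorphic (quot_ring I) (quot_ring J)].

Definition same_invariants (K : fieldType) (E F : graph) : Prop :=
  let L := lpa K E in let M := lpa K F in
  pointed_K0_isomorphic L M /\
  ideal_ring_isomorphic (socle L) (socle M) /\
  ring_isomorphic (quot_ring (socle L)) (quot_ring (socle M)) /\
  ILN E = ILN F /\
  HS E = HS F /\
  (HS E = 1%N -> LI_isomorphic K E F) /\
  ((condition_MT3 E /\ condition_L E) <-> (condition_MT3 F /\ condition_L F)).

Definition in_L3 (E : graph) : Prop :=
  condition_Sing E /\ (0 < #|vertex E| <= 3)%N.

(* The graph with vertices 1, ..., n, vertex i being the ordinal of value i - 1;
   for i, j <= 9, the number with decimal digits i and j stands for an edge from
   i to j. *)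
Definition digit_edge n (s : seq nat) : pred ('I_n * 'I_n) :=
  fun ij => (10 * ij.1.+1 + ij.2.+1 \in s)%N.

Definition digit_graph n (s : seq nat) : graph :=
  @Graph 'I_n {ij : 'I_n * 'I_n | digit_edge s ij}
    (fun e => (val e).1) (fun e => (val e).2).

Definition L3_list : seq (nat * seq nat) :=
  [:: (1, [::]); (1, [:: 11]);
      (2, [::]); (2, [:: 12]); (2, [:: 11]); (2, [:: 11; 21]);
      (2, [:: 11; 12]); (2, [:: 11; 22]); (2, [:: 11; 21; 22]);
      (2, [:: 11; 12; 21; 22]);
      (3, [:: 12; 32]); (3, [:: 21; 23; 31]); (3, [:: 11; 12; 32]);
      (3, [:: 21; 22; 31; 32]); (3, [:: 11; 12; 21; 22]);
      (3, [:: 21; 22; 23; 31; 32]); (3, [:: 21; 22; 31; 32; 33]);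
      (3, [:: 11; 12; 21; 22; 23]); (3, [:: 21; 22; 23; 31; 32; 33]);
      (3, [:: 23]); (3, [:: 21; 23]); (3, [:: 22; 32]); (3, [:: 22; 23]);
      (3, [:: 11; 32]); (3, [:: 11; 21; 23]); (3, [:: 21; 22; 23]);
      (3, [:: 22; 23; 33]); (3, [:: 11; 22; 23]); (3, [:: 11; 21; 22; 23]);
      (3, [:: 11; 12; 32; 33]);
      (3, [::]); (3, [:: 33]); (3, [:: 22; 33]);
      (3, [:: 21; 23; 31; 32]); (3, [:: 21; 22; 23; 31]);
      (3, [:: 12; 13; 21; 22; 32; 33]); (3, [:: 12; 13; 22; 23; 32; 33]);
      (3, [:: 11; 12; 13; 21; 22; 23; 32; 33]);
      (3, [:: 12; 22; 32]); (3, [:: 12; 13; 22; 32]); (3, [:: 11; 12; 22; 32]);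
      (3, [:: 12; 13; 22; 32; 33]); (3, [:: 11; 12; 21; 22; 33]);
      (3, [:: 12; 13; 22; 31; 32; 33]); (3, [:: 11; 12; 13; 22; 32; 33]);
      (3, [:: 11; 12; 21; 22; 23; 33]); (3, [:: 11; 12; 13; 22; 23; 32; 33]);
      (3, [:: 11; 12; 13; 22; 31; 32; 33]);
      (3, [:: 11; 12; 21; 22; 23; 32; 33]);
      (3, [:: 11; 22; 32]); (3, [:: 11; 21; 23; 33]); (3, [:: 11; 22; 32; 33]);
      (3, [:: 11; 12; 22; 32; 33]); (3, [:: 11; 21; 22; 23; 33]);
      (3, [:: 11; 22; 33]);
      (3, [:: 12; 13; 22; 23; 31; 32; 33]);
      (3, [:: 11; 12; 13; 21; 22; 23; 31; 32; 33]);
      (3, [:: 12; 13; 22; 31; 32]); (3, [:: 12; 22; 31; 32; 33]);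
      (3, [:: 12; 13; 21; 23; 31; 32]);
      (3, [:: 12; 13; 21; 22; 23; 31; 32; 33]);
      (3, [:: 12; 13; 21; 22; 23; 31; 32])]%N.

(* Main.v *)
(** Let [V(L)] be the monoid of finitely generated projective modules over
    [L = L_K(E)].  Expanding vertices by (CK2) turns every element of [L] into a
    combination of ghost paths, and ghost paths are linearly independent; a finite
    system of vectors can therefore be reduced, by a Euclidean algorithm on leading
    ghost words, to a system with a prefix-free set of leading words, which is
    independent.  It follows that every finitely generated projective module is a
    direct sum of modules [L v] and that, when [phi v] is the sum of the [phi (r e)]
    over the edges [e] leaving [v], the sum of [phi] over such a decomposition does
    not depend on the latter.  Hence the morphisms from [V(L)] to a commutative monoid
    [A] that send the class of [L] to [c] are counted by finitely many labellings
    [phi] of the vertices by [A]; for a group [A] the count depends on the pointed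
    K_0 only.

    The socle is the ideal generated by the sinks, graded ideals are generated by
    vertices, and the quotients by such ideals are Leavitt path algebras of quotient
    graphs.  The counts for the additive groups Z/3 and Z/4 and for the
    multiplicative monoid Z/4, for [L] and for [L/Soc], together with the vanishing
    and the commutativity of [Soc], take 57 values on the 116 graphs.  On the other
    hand, shift moves and out-splittings give isomorphisms that leave only 57
    classes. *)

From HB Require Import structures.
From mathcomp Require Import all_boot all_order all_algebra.
From mathcomp Require Import ring_quotient finmap.
From mathcomp.multinomials Require Import monalg.
From mathcomp.classical Require Import boolp classical_sets functions.
Require Import Defs.

Set Implicit Arguments.
Unset Strict Implicit.
Unset Printing Implicit Defensive.

Import GRing.Theory.
Local Open Scope ring_scope.
Local Open Scope quotient_scope.

(** * Presentations *)

(** A ring isomorphism need be neither linear over [K] nor graded, so algebras can only be told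
    apart by what the bare ring sees. Computing V(L) is avoided: counting its morphisms into a
    finite monoid is a finite task on a Boolean matrix, the same for every field. Groups see K_0
    only; the multiplicative monoid also sees part of what is lost when V(L) is made cancellative.
    The two directions of the equivalence need different invariants, because [same_invariants]
    contains K_0 of L but not V(L), whereas L/Soc and L/I are given as rings: in the converse
    direction the multiplicative counts are available for these quotients alone. The numbers ILN and
    HS, the truth value MT3+L and the class of L/I are not shown to be ring invariants by a direct
    argument. Isomorphic algebras have the same label in the table, and these data are constant on
    each label. That the moduli 3 and 4 suffice is an outcome of evaluating the table. *)

Section RingLifts.

Lemma rmorph_exists (R S : pzRingType) (f : R -> S) :
  zmod_morphism f -> monoid_morphism f -> exists g : {rmorphism R -> S}, g =1 f.
Proof.
move=> fB fM.
pose m1 := GRing.isZmodMorphism.Build _ _ f fB.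
pose m2 := GRing.isMonoidMorphism.Build _ _ f fM.
by exists (HB.pack_for {rmorphism R -> S} f m1 m2).
Qed.

Lemma quot_lift (R S : pzRingType) (I : ideal R) (f : {rmorphism R -> S}) :
  (forall x, I x -> f x = 0) ->
  exists g : {rmorphism quot_ring I -> S}, forall x, g (quot_proj I x) = f x.
Proof.
move=> f0; pose h (x : quot_ring I) := f (projT1 (cid (quot_proj_surj x))).
have hE x : h (quot_proj I x) = f x.
  rewrite /h; case: cid => y /= /quot_proj_eq Iyx.
  by apply/eqP; rewrite -subr_eq0 -rmorphB f0.
have [|| g gE] := @rmorph_exists _ _ h.
- move=> x y; have [a <-] := quot_proj_surj x; have [b <-] := quot_proj_surj y.
  by rewrite -rmorphB !hE rmorphB.
- split=> [|x y]; first by rewrite -(rmorph1 (quot_proj I)) hE rmorph1.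
  have [a <-] := quot_proj_surj x; have [b <-] := quot_proj_surj y.
  by rewrite -rmorphM !hE rmorphM.
by exists g => x; rewrite gE.
Qed.

Lemma gen_ideal_sub (R : pzRingType) (X : set R) (I : ideal R) :
  (forall y, X y -> I y) -> forall x, gen_ideal X x -> I x.
Proof. by move=> XI x; apply. Qed.

Lemma mem_gen_ideal (R : pzRingType) (X : set R) x : X x -> gen_ideal X x.
Proof. by move=> Xx I; apply. Qed.

Section IdealTheory.
Variables (R : pzRingType) (I : ideal R).

Lemma ideal0 : I 0. Proof. by case: (idealP I) => [[]]. Qed.
Lemma idealD x y : I x -> I y -> I (x + y).
Proof. by case: (idealP I) => [[_ h _] _]; exact: h. Qed.
Lemma idealMl a x : I x -> I (a * x).
Proof. by case: (idealP I) => [[_ _ h] _]; exact: h. Qed.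
Lemma idealMr a x : I x -> I (x * a).
Proof. by case: (idealP I) => [_ h]; exact: h. Qed.
Lemma ideal_sum (T : Type) (r : seq T) (P : pred T) F :
  (forall i, P i -> I (F i)) -> I (\sum_(i <- r | P i) F i).
Proof. by move=> IF; elim/big_ind: _ => //; [exact: ideal0|exact: idealD]. Qed.

Lemma quot_proj_eq0 x : quot_proj I x = 0 <-> I x.
Proof. by rewrite -(rmorph0 (quot_proj I)) quot_proj_eq subr0. Qed.

End IdealTheory.

(** [gen_ideal] is an intersection, from which no form of its elements can be read; the finite sums
    of products a x b with x in [X] are an ideal containing [X], hence contain it. *)
Lemma gen_idealE (R : pzRingType) (X : set R) x : gen_ideal X x ->
  exists2 s : seq (R * R * R), (forall t, t \in s -> X t.1.2) &
    x = \sum_(t <- s) t.1.1 * t.1.2 * t.2.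
Proof.
pose J : set R := fun x => exists2 s : seq (R * R * R),
  (forall t, t \in s -> X t.1.2) & x = \sum_(t <- s) t.1.1 * t.1.2 * t.2.
have JI : two_sided_ideal J.
  split; first split.
  - by exists [::]; rewrite ?big_nil.
  - move=> _ _ [s sX ->] [t tX ->]; exists (s ++ t); last by rewrite big_cat.
    by move=> u; rewrite mem_cat => /orP[/sX|/tX].
  - move=> a _ [s sX ->]; exists [seq (a * t.1.1, t.1.2, t.2) | t <- s].
      by move=> _ /mapP[u us ->] /=; exact: sX.
    by rewrite big_map mulr_sumr; apply: eq_bigr => t _ /=; rewrite !mulrA.
  - move=> a _ [s sX ->]; exists [seq (t.1.1, t.1.2, t.2 * a) | t <- s].
      by move=> _ /mapP[u us ->] /=; exact: sX.
    by rewrite big_map mulr_suml; apply: eq_bigr => t _ /=; rewrite !mulrA.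
apply: (@gen_ideal_sub _ _ (Ideal JI)) => y Xy.
exists [:: (1, y, 1)]; first by move=> t; rewrite inE => /eqP ->.
by rewrite big_seq1 mul1r mulr1.
Qed.

End RingLifts.

Section FreeAlgebra.
Variables (K : fieldType) (T : choiceType) (S : pzRingType).
Variables (kap : {rmorphism K -> S}) (phi : T -> S).
Hypothesis kapC : forall c y, kap c * y = y * kap c.
Local Notation A := {malg K[{fmonom T}]}.

Let h (m : {fmonom T}) : S := \prod_(i <- (m : seq T)) phi i.
Let ev (g : A) : S := \sum_(k <- msupp g) kap g@_k * h k.

Let evEw (d : {fset {fmonom T}}) (g : A) : (msupp g `<=` d)%fset ->
  ev g = \sum_(k <- d) kap g@_k * h k.
Proof.
move=> le; rewrite /ev (big_fset_incl _ le) => //= x xd /mcoeff_outdom ->.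
by rewrite raddf0 mul0r.
Qed.

Let evU c m : ev << c *g m >> = kap c * h m.
Proof. by rewrite (evEw msuppU_le) big_seq_fset1 mcoeffUU. Qed.

Let evB : zmod_morphism ev.
Proof.
move=> g1 g2; pose d := (msupp g1 `|` msupp g2)%fset.
rewrite (@evEw d (g1 - g2)) ?msuppB_le // (@evEw d g1) ?fsubsetUl //.
rewrite (@evEw d g2) ?fsubsetUr // -sumrB; apply: eq_bigr => k _.
by rewrite mcoeffB rmorphB mulrBl.
Qed.

Let hM m n : h (mmul m n) = h m * h n.
Proof. by rewrite /h -big_cat; congr (\prod_(i <- _) _); rewrite fmM. Qed.

(** [S] is a mere ring: scalars reach it through [kap], whose image has to be central for [ev] to be
    multiplicative. Quotient rings and endomorphism rings are thus treated alike as targets. *)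
Lemma free_lift : exists g : {rmorphism A -> S},
  (forall i, g << fmu i >> = phi i) /\ (forall c x, g (c *: x) = kap c * g x).
Proof.
have ev0 : ev 0 = 0 by have := evB 0 0; rewrite !subrr.
have evD x y : ev (x + y) = ev x + ev y.
  by rewrite -{1}[y]opprK -[- y]sub0r !evB ev0 sub0r opprK.
have evsum (I : Type) (r : seq I) F : ev (\sum_(i <- r) F i) = \sum_(i <- r) ev (F i).
  by elim: r => [|i r IH]; rewrite ?big_nil // !big_cons evD IH.
have ev1 : ev 1 = 1.
  by rewrite [LHS]evU rmorph1 mul1r /h fm1 big_nil.
have evM x y : ev (x * y) = ev x * ev y.
  rewrite malgME evsum mulr_suml; apply: eq_bigr => i _.
  rewrite evsum mulr_sumr; apply: eq_bigr => j _.
  by rewrite evU rmorphM hM -!mulrA; congr (_ * _); rewrite !mulrA kapC.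
have [//|//|g gE] := @rmorph_exists _ _ ev; exists g; split.
  by move=> i; rewrite gE [LHS]evU rmorph1 mul1r /h fmuE big_seq1.
move=> c x; rewrite !gE -mul_malgC evM; congr (_ * _).
by rewrite [LHS]evU /h fm1 big_nil mulr1.
Qed.

End FreeAlgebra.

Section MonoidAlgebra.
Variables (K : fieldType) (M : monomType).

Lemma malgU_scale (c : K) (m : M) : << c *g m >> = c *: << m >> :> {malg K[M]}.
Proof. by apply/malgP => k; rewrite mcoeffZ !mcoeffU mulrnAr mulr1. Qed.

Lemma malgC_central (c : K) (x : {malg K[M]}) : c%:MP * x = x * c%:MP.
Proof.
rewrite mul_malgC {1}[x]monalgE [in RHS](monalgE x) mulr_suml scaler_sumr.
apply: eq_bigr => i _; apply/malgP => k.
by rewrite mcoeffZ malgM_def fgmulUU !mcoeffU mulm1 mulrnAr mulrC.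
Qed.

End MonoidAlgebra.

Section Generators.
Variables (K : fieldType) (E : graph).
Implicit Types (v w : vertex E) (e f : edge E).
Local Notation L := (lpa K E).
Local Notation proj := (quot_proj (lpa_ideal K E)).

(* The generators are locked to keep unification from unfolding the quotient. *)
Definition lv : vertex E -> L := locked (fun v => proj (vtx K v)).
Definition le : edge E -> L := locked (fun e => proj (edg K e)).
Definition lg : edge E -> L := locked (fun e => proj (ghost K e)).
Definition lc : K -> L := locked (proj \o @malgC _ K).

Lemma lvE v : lv v = proj (vtx K v). Proof. by rewrite /lv -lock. Qed.
Lemma leE e : le e = proj (edg K e). Proof. by rewrite /le -lock. Qed.
Lemma lgE e : lg e = proj (ghost K e). Proof. by rewrite /lg -lock. Qed.
Lemma lcE c : lc c = proj c%:MP. Proof. by rewrite /lc -lock. Qed.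

Let lc0 : {rmorphism K -> L} := proj \o @malgC _ K.
Let lc0E c : lc c = lc0 c. Proof. exact: lcE. Qed.
Fact lc_zmod : zmod_morphism lc.
Proof. by move=> c d; rewrite !lc0E (rmorphB lc0). Qed.
Fact lc_monoid : monoid_morphism lc.
Proof.
by split=> [|c d]; [rewrite lc0E (rmorph1 lc0)|rewrite !lc0E (rmorphM lc0)].
Qed.
HB.instance Definition _ := GRing.isZmodMorphism.Build K L lc lc_zmod.
HB.instance Definition _ := GRing.isMonoidMorphism.Build K L lc lc_monoid.

Let rel x y : lpa_relation x y -> proj x = proj y.
Proof. by move=> xy; apply/quot_proj_eq/mem_gen_ideal; exists x, y. Qed.

Lemma lv_sum : \sum_v lv v = 1.
Proof.
have := rel (RelUnit K E); rewrite rmorph_sum rmorph1 => <-.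
by apply: eq_bigr => v _; exact: lvE.
Qed.

Lemma lv_mul v w : lv v * lv w = lv v *+ (v == w).
Proof. by have := rel (RelVertex K v w); rewrite rmorphM rmorphMn !lvE. Qed.

Lemma lvv v : lv v * lv v = lv v.
Proof. by rewrite lv_mul eqxx. Qed.

Lemma lv_neq v w : v != w -> lv v * lv w = 0.
Proof. by rewrite lv_mul => /negPf ->. Qed.

Lemma lv_le e : lv (src e) * le e = le e.
Proof. by have := rel (RelSourceReal K e); rewrite rmorphM !(lvE, leE, lgE). Qed.

Lemma le_lv e : le e * lv (rng e) = le e.
Proof. by have := rel (RelRealRange K e); rewrite rmorphM !(lvE, leE, lgE). Qed.

Lemma lv_lg e : lv (rng e) * lg e = lg e.
Proof. by have := rel (RelRangeGhost K e); rewrite rmorphM !(lvE, leE, lgE). Qed.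

Lemma lg_lv e : lg e * lv (src e) = lg e.
Proof. by have := rel (RelGhostSource K e); rewrite rmorphM !(lvE, leE, lgE). Qed.

Lemma lg_le e f : lg e * le f = lv (rng e) *+ (e == f).
Proof. by have := rel (RelCK1 K e f); rewrite rmorphM rmorphMn lvE leE lgE. Qed.

Lemma lge e : lg e * le e = lv (rng e).
Proof. by rewrite lg_le eqxx. Qed.

Lemma lv_CK2 v : ~ sink v -> lv v = \sum_(e | src e == v) le e * lg e.
Proof.
move=> sv; rewrite lvE (rel (RelCK2 K sv)) rmorph_sum.
by apply: eq_bigr => e _; rewrite rmorphM leE lgE.
Qed.

Lemma lv_leN v e : v != src e -> lv v * le e = 0.
Proof. by move=> ve; rewrite -lv_le mulrA lv_neq ?mul0r. Qed.

Lemma lv_lgN v e : v != rng e -> lv v * lg e = 0.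
Proof. by move=> ve; rewrite -lv_lg mulrA lv_neq ?mul0r. Qed.

Lemma le_lvN v e : v != rng e -> le e * lv v = 0.
Proof. by move=> ve; rewrite -le_lv -mulrA lv_neq ?mulr0 // eq_sym. Qed.

Lemma lg_lvN v e : v != src e -> lg e * lv v = 0.
Proof. by move=> ve; rewrite -lg_lv -mulrA lv_neq ?mulr0 // eq_sym. Qed.

Lemma lcC c (x : L) : lc c * x = x * lc c.
Proof.
have [y <-] := quot_proj_surj x.
by rewrite lcE -(rmorphM proj) malgC_central (rmorphM proj).
Qed.

(** Words in the generators, applied to 1, span the algebra. A word is peeled from its left end, so
    closure under left multiplication by single generators suffices. *)
Lemma lpa_ind (P : L -> Prop) :
  P 1 -> (forall x y, P x -> P y -> P (x + y)) ->
  (forall c x, P x -> P (lc c * x)) -> (forall v x, P x -> P (lv v * x)) ->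
  (forall e x, P x -> P (le e * x)) -> (forall e x, P x -> P (lg e * x)) ->
  forall x, P x.
Proof.
move=> P1 PD Pc Pv Pe Pg x; have [y <-] := quot_proj_surj x.
have P0 : P 0 by rewrite -[0](mul0r 1) -(rmorph0 lc); exact: Pc.
rewrite (monalgE y) (rmorph_sum proj) /=; elim/big_ind: _ => // m _.
rewrite malgU_scale -mul_malgC rmorphM.
have {}Pc c z : P z -> P (proj c%:MP * z) by rewrite -lcE; exact: Pc.
apply: Pc.
case: m => s; elim: s => [|i s IH].
  suff e : FMonom [::] = (mone : {fmonom path_symbol E}) by rewrite e -[X in P X]/(proj 1) rmorph1.
  by apply/eqP; rewrite fmP fm1.
have e : << FMonom (i :: s) >> = << fmu i >> * << FMonom s >> :> free_algebra K E.
  rewrite malgM_def fgmulUU mulr1; congr << _ >>.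
  by apply/eqP; rewrite fmP fmM fmuE.
rewrite e {e}.
rewrite rmorphM.
have {}Pv v z : P z -> P (proj (vtx K v) * z) by rewrite -lvE; exact: Pv.
have {}Pe e z : P z -> P (proj (edg K e) * z) by rewrite -leE; exact: Pe.
have {}Pg e z : P z -> P (proj (ghost K e) * z) by rewrite -lgE; exact: Pg.
by case: i => [v|[e|e]]; [exact: Pv|exact: Pe|exact: Pg].
Qed.

End Generators.

Section Universal.
Variables (K : fieldType) (E : graph) (S : pzRingType).
Implicit Types (v w : vertex E) (e f : edge E).

Record lpa_family (fv : vertex E -> S) (fe fg : edge E -> S) : Prop := LpaFamily {
  fam_unit : \sum_v fv v = 1;
  fam_vertex v w : fv v * fv w = fv v *+ (v == w);
  fam_src e : fv (src e) * fe e = fe e;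
  fam_rng e : fe e * fv (rng e) = fe e;
  fam_grng e : fv (rng e) * fg e = fg e;
  fam_gsrc e : fg e * fv (src e) = fg e;
  fam_CK1 e f : fg e * fe f = fv (rng e) *+ (e == f);
  fam_CK2 v : ~ sink v -> fv v = \sum_(e | src e == v) fe e * fg e }.

Lemma lpa_lift (kap : {rmorphism K -> S}) fv fe fg :
  (forall c y, kap c * y = y * kap c) -> lpa_family fv fe fg ->
  exists g : {rmorphism lpa K E -> S},
    [/\ forall v, g (lv K v) = fv v, forall e, g (le K e) = fe e,
        forall e, g (lg K e) = fg e & forall c, g (lc E c) = kap c].
Proof.
move=> kapC fam.
pose phi (i : path_symbol E) := match i with
  | inl v => fv v | inr (inl e) => fe e | inr (inr e) => fg e end.
have [g [gphi gZ]] := free_lift phi kapC.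
have gv v : g (vtx K v) = fv v by exact: gphi.
have ge e : g (edg K e) = fe e by exact: gphi.
have gg e : g (ghost K e) = fg e by exact: gphi.
have [|g' g'E] := @quot_lift _ _ (lpa_ideal K E) g.
  pose Z : set (free_algebra K E) := fun x => g x = 0.
  have ZI : two_sided_ideal Z.
    split; first split; first exact: rmorph0.
    - by move=> x y Zx Zy; rewrite /Z rmorphD Zx Zy addr0.
    - by move=> a x Zx; rewrite /Z rmorphM Zx mulr0.
    - by move=> a x Zx; rewrite /Z rmorphM Zx mul0r.
  apply: (@gen_ideal_sub _ _ (Ideal ZI)) => _ [x [y [xy ->]]].
  rewrite /= /Z rmorphB; apply/eqP; rewrite subr_eq0; apply/eqP.
  case: xy => [|v w|e|e|e|e|e f|v sv].
  - by rewrite rmorph_sum rmorph1 -(fam_unit fam); apply: eq_bigr.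
  - by rewrite rmorphM rmorphMn !gv (fam_vertex fam).
  - by rewrite rmorphM gv ge (fam_src fam).
  - by rewrite rmorphM gv ge (fam_rng fam).
  - by rewrite rmorphM gv gg (fam_grng fam).
  - by rewrite rmorphM gv gg (fam_gsrc fam).
  - by rewrite rmorphM rmorphMn ge gg gv (fam_CK1 fam).
  - rewrite gv (fam_CK2 fam sv) rmorph_sum; apply: eq_bigr => e _.
    by rewrite rmorphM ge gg.
exists g'; split=> [v|e|e|c]; rewrite ?(lvE, leE, lgE, lcE) g'E //.
by rewrite -[X in g X]mulr1 mul_malgC gZ rmorph1 mulr1.
Qed.

Lemma lpa_hom_ext (g h : {rmorphism lpa K E -> S}) :
  (forall c, g (lc E c) = h (lc E c)) -> (forall v, g (lv K v) = h (lv K v)) ->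
  (forall e, g (le K e) = h (le K e)) -> (forall e, g (lg K e) = h (lg K e)) ->
  g =1 h.
Proof.
move=> gc gv ge gg; elim/lpa_ind=> [|x y IHx IHy|c x IH|v x IH|e x IH|e x IH].
- by rewrite !rmorph1.
- by rewrite !rmorphD IHx IHy.
- by rewrite !rmorphM gc IH.
- by rewrite !rmorphM gv IH.
- by rewrite !rmorphM ge IH.
- by rewrite !rmorphM gg IH.
Qed.

End Universal.

Lemma lpa_iso_of_homs (K : fieldType) (E F : graph)
    (g : {rmorphism lpa K E -> lpa K F}) (h : {rmorphism lpa K F -> lpa K E}) :
  (forall c, g (lc E c) = lc F c) -> (forall c, h (lc F c) = lc E c) ->
  (forall v, h (g (lv K v)) = lv K v) -> (forall e, h (g (le K e)) = le K e) ->
  (forall e, h (g (lg K e)) = lg K e) ->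
  (forall v, g (h (lv K v)) = lv K v) -> (forall e, g (h (le K e)) = le K e) ->
  (forall e, g (h (lg K e)) = lg K e) ->
  ring_isomorphic (lpa K E) (lpa K F).
Proof.
move=> gc hc hgv hge hgg ghv ghe ghg; exists g; exists h.
- have := @lpa_hom_ext K E _ (h \o g) idfun; apply => //= c.
  by rewrite gc hc.
- have := @lpa_hom_ext K F _ (g \o h) idfun; apply => //= c.
  by rewrite hc gc.
Qed.

(** * Ghost paths *)

Section Endomorphisms.
Variables (K : fieldType) (T : Type).
Local Notation V := (T -> K).

Definition fun_linear (F : V -> V) : Prop := forall a f g,
  F (fun x => a * f x + g x) = fun x => a * F f x + F g x.

(** All functions are allowed, whatever their support: Dirac functions and constant functions both
    serve as test functions below. *)
Record endo := Endo { endo_fun :> V -> V; endo_lin : fun_linear endo_fun }.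

HB.instance Definition _ := gen_eqMixin endo.
HB.instance Definition _ := gen_choiceMixin endo.

Lemma endo_ext (F G : endo) : (forall f x, F f x = G f x) -> F = G.
Proof.
case: F G => [F hF] [G hG] /= FG.
have {}FG : F = G by apply: funext => f; apply: funext.
by subst G; congr Endo; exact: Prop_irrelevance.
Qed.

Fact endo_add_subproof (F G : endo) : fun_linear (fun f x => F f x + G f x).
Proof.
by move=> a f g; apply: funext => x; rewrite !endo_lin mulrDr addrACA.
Qed.
Fact endo_opp_subproof (F : endo) : fun_linear (fun f x => - F f x).
Proof. by move=> a f g; apply: funext => x; rewrite endo_lin opprD mulrN. Qed.
Fact endo_zero_subproof : fun_linear (fun f x => 0).
Proof. by move=> a f g; apply: funext => x; rewrite mulr0 addr0. Qed.
Fact endo_one_subproof : fun_linear (fun f => f).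
Proof. by []. Qed.
Fact endo_mul_subproof (F G : endo) : fun_linear (fun f => F (G f)).
Proof. by move=> a f g; rewrite !endo_lin. Qed.

Definition endo_add F G := Endo (endo_add_subproof F G).
Definition endo_opp F := Endo (endo_opp_subproof F).
Definition endo_zero := Endo endo_zero_subproof.
Definition endo_one := Endo endo_one_subproof.
Definition endo_mul F G := Endo (endo_mul_subproof F G).

Fact endo_addA : associative endo_add.
Proof. by move=> F G H; apply: endo_ext => f x /=; rewrite addrA. Qed.
Fact endo_addC : commutative endo_add.
Proof. by move=> F G; apply: endo_ext => f x /=; rewrite addrC. Qed.
Fact endo_add0 : left_id endo_zero endo_add.
Proof. by move=> F; apply: endo_ext => f x /=; rewrite add0r. Qed.
Fact endo_addN : left_inverse endo_zero endo_opp endo_add.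
Proof. by move=> F; apply: endo_ext => f x /=; rewrite addNr. Qed.

HB.instance Definition _ :=
  GRing.isZmodule.Build endo endo_addA endo_addC endo_add0 endo_addN.

Fact endo_mulA : associative endo_mul.
Proof. by move=> F G H; apply: endo_ext. Qed.
Fact endo_mul1 : left_id endo_one endo_mul.
Proof. by move=> F; apply: endo_ext. Qed.
Fact endo_mulr1 : right_id endo_one endo_mul.
Proof. by move=> F; apply: endo_ext. Qed.
Fact endo_mulDl : left_distributive endo_mul +%R.
Proof. by move=> F G H; apply: endo_ext. Qed.
Fact endo_mulDr : right_distributive endo_mul +%R.
Proof.
move=> F G H; apply: endo_ext => f x /=.
rewrite (_ : (fun y => _) = fun y => 1 * G f y + H f y).
  by rewrite endo_lin mul1r.
by apply: funext => y; rewrite mul1r.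
Qed.

HB.instance Definition _ := GRing.Zmodule_isPzRing.Build endo
  endo_mulA endo_mul1 endo_mulr1 endo_mulDl endo_mulDr.

Lemma endo_sumE (I : Type) (r : seq I) (P : pred I) (F : I -> endo) f x :
  (\sum_(i <- r | P i) F i) f x = \sum_(i <- r | P i) F i f x.
Proof. by elim/big_rec2: _ => // i y z _ <-. Qed.

Lemma endoZ (F : endo) a f x : F (fun y => a * f y) x = a * F f x.
Proof.
have F0 : F (fun=> 0) = fun=> 0.
  have h := endo_lin F (-1) (fun=> 0) (fun=> 0).
  have e : (fun x : T => -1 * 0 + 0) = (fun=> 0) :> V.
    by apply: funext => z; rewrite mulr0 addr0.
  by rewrite e in h; rewrite h; apply: funext => y; rewrite mulN1r addNr.
have e : (fun y => a * f y) = (fun y => a * f y + 0).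
  by apply: funext => y; rewrite addr0.
by rewrite e (endo_lin F a f (fun=> 0)) F0 addr0.
Qed.

End Endomorphisms.

Section Representation.
Variables (K : fieldType) (E : graph) (t : int).
Implicit Types (v w : vertex E) (e f : edge E).

(* A branching system: X_v is a copy of nat for every vertex v, and the k-th of
   the d edges leaving v maps X_(rng e) onto the numbers of X_v congruent to k
   modulo d.  An edge moreover shifts the degree (the integer component) by t. *)
Definition point : Type := (vertex E * nat * int)%type.
Local Notation fspace := (point -> K).

Definition outs v : seq (edge E) := enum [pred e | src e == v].
Definition outdeg v : nat := size (outs v).
Definition rank e : nat := index e (outs (src e)).

Lemma mem_outs e v : (e \in outs v) = (src e == v).
Proof. by rewrite mem_enum. Qed.

Lemma ltn_rank e : (rank e < outdeg (src e))%N.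
Proof. by rewrite index_mem mem_outs. Qed.

Lemma rank_inj e f : src e = src f -> rank e = rank f -> e = f.
Proof.
move=> ef; rewrite /rank ef => /(congr1 (nth e (outs (src f)))).
by rewrite !nth_index // mem_outs ?ef.
Qed.

Lemma modn_rank e m : ((m * outdeg (src e) + rank e) %% outdeg (src e) = rank e)%N.
Proof. by rewrite modnMDl modn_small ?ltn_rank. Qed.

Lemma divn_rank e m : ((m * outdeg (src e) + rank e) %/ outdeg (src e) = m)%N.
Proof.
have := ltn_rank e; move: (rank e) (outdeg _) => k d kd.
by rewrite divnMDl ?divn_small ?addn0 // (leq_ltn_trans _ kd).
Qed.

Let fv v (f : fspace) : fspace := fun x => if x.1.1 == v then f x else 0.
Let fe e (f : fspace) : fspace := fun x =>
  if (x.1.1 == src e) && (x.1.2 %% outdeg (src e) == rank e)%N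
  then f (rng e, (x.1.2 %/ outdeg (src e))%N, x.2 - t) else 0.
Let fg e (f : fspace) : fspace := fun x =>
  if x.1.1 == rng e
  then f (src e, (x.1.2 * outdeg (src e) + rank e)%N, x.2 + t) else 0.
Let fk (c : K) (f : fspace) : fspace := fun x => c * f x.

Let fvP v : fun_linear (fv v).
Proof. by move=> a f g; apply: funext => x; rewrite /fv; case: ifP; rewrite ?mulr0 ?addr0. Qed.
Let feP e : fun_linear (fe e).
Proof. by move=> a f g; apply: funext => x; rewrite /fe; case: ifP; rewrite ?mulr0 ?addr0. Qed.
Let fgP e : fun_linear (fg e).
Proof. by move=> a f g; apply: funext => x; rewrite /fg; case: ifP; rewrite ?mulr0 ?addr0. Qed.
Let fkP c : fun_linear (fk c).
Proof. by move=> a f g; apply: funext => x; rewrite /fk mulrDr mulrCA. Qed.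

(** Edges act by composition with the maps of the branching system. The shift [t] stays a parameter:
    with t = 1 paths of different lengths move the integer component differently, with t = 0 a cycle
    without exit acts as its base vertex. *)
Lemma lpa_rep : exists rho : {rmorphism lpa K E -> endo K point},
  [/\ forall v g x, rho (lv K v) g x = if x.1.1 == v then g x else 0,
      forall e g x, rho (le K e) g x =
        if (x.1.1 == src e) && (x.1.2 %% outdeg (src e) == rank e)%N
        then g (rng e, (x.1.2 %/ outdeg (src e))%N, x.2 - t) else 0,
      forall e g x, rho (lg K e) g x =
        if x.1.1 == rng e
        then g (src e, (x.1.2 * outdeg (src e) + rank e)%N, x.2 + t) else 0
    & forall c g x, rho (lc E c) g x = c * g x].
Proof.
have [kap kapE] : exists kap : {rmorphism K -> endo K point},
    kap =1 fun c => Endo (fkP c).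
  apply: rmorph_exists => [c d|]; last split.
  - apply: endo_ext => f x /=.
    by rewrite /fk mulrBl.
  - by apply: endo_ext => f x; rewrite /= /fk mul1r.
  - by move=> c d; apply: endo_ext => f x; rewrite /= /fk mulrA.
have [||rho [rv re rg rc]] := @lpa_lift K E _ kap (fun v => Endo (fvP v))
    (fun e => Endo (feP e)) (fun e => Endo (fgP e)).
- move=> c y; apply: endo_ext => f x.
  by rewrite kapE /= /fk endoZ.
- split.
  - apply: endo_ext => f x; rewrite endo_sumE /=.
    rewrite (bigD1 x.1.1) //= /fv eqxx big1 ?addr0 // => v /negPf xv.
    by rewrite eq_sym xv.
  - move=> v w; apply: endo_ext => f x; rewrite /= /fv.
    case: (eqVneq v w) => [<-|vw]; rewrite ?mulr1n /=; first by case: eqP.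
    by case: eqP => // ->; rewrite (negPf vw).
  - move=> e; apply: endo_ext => f x; rewrite /= /fv /fe.
    by case: eqP.
  - move=> e; apply: endo_ext => f x; rewrite /= /fv /fe /=.
    by rewrite eqxx.
  - move=> e; apply: endo_ext => f x; rewrite /= /fv /fg /=.
    by case: eqP.
  - move=> e; apply: endo_ext => f x; rewrite /= /fv /fg /=.
    by rewrite eqxx.
  - move=> e f; apply: endo_ext => g [[v m] n] /=.
    rewrite /fg /fe /=; case: (eqVneq e f) => [<-|ef]; rewrite ?mulr1n /= /fv /=.
      by rewrite eqxx modn_rank eqxx divn_rank addrK; case: eqP => [->|].
    case: eqP => // _; case: (eqVneq (src e) (src f)) => //= sef.
    rewrite -sef modn_rank; case: eqP => // kef; case/eqP: ef.
    exact: rank_inj.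
  - move=> v sv; apply: endo_ext => f [[u m] n].
    rewrite endo_sumE /= /fv /=.
    case: (eqVneq u v) => [->|uv]; last first.
      by rewrite big1 // => e /eqP se; rewrite /fe /= se (negPf uv).
    have d0 : (0 < outdeg v)%N.
      rewrite lt0n; apply/eqP => d0; apply: sv => e ev.
      by have := ltn_rank e; rewrite ev d0.
    (* The residue of m modulo the out-degree is the rank of exactly one edge at v; this is what
       makes (CK2) hold. *)
    have [e0 [ev ke]] : exists e, src e = v /\ rank e = (m %% outdeg v)%N.
      case: (pickP [pred e | src e == v]) => [e0 _|no]; last first.
        by move: d0; rewrite /outdeg /outs (eq_enum no) enum0.
      have km : (m %% outdeg v < size (outs v))%N by rewrite ltn_mod.
      pose e := nth e0 (outs v) (m %% outdeg v)%N.
      have /eqP ev : src e == v by rewrite -mem_outs mem_nth.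
      exists e; split => //; rewrite /rank ev /e index_uniq ?enum_uniq //.
    rewrite (bigD1 e0) ?ev //= big1 ?addr0 => [|e /andP[/eqP se ee0]].
      by rewrite /fe /fg /= ev ke !eqxx /= subrK -divn_eq.
    rewrite /fe /= se eqxx /=; case: eqP => //; rewrite -ke => kee.
    by case/eqP: ee0; apply: rank_inj; rewrite ?se ?kee.
exists rho; split=> *; rewrite ?rv ?re ?rg ?rc //.
by rewrite kapE.
Qed.

End Representation.

Section GhostWords.
Variables (K : fieldType) (E : graph).
Implicit Types (v w : vertex E) (e : edge E) (r q : seq (edge E)).
Local Notation L := (lpa K E).
Local Notation lv := (lv K).
Local Notation le := (le K).
Local Notation lg := (lg K).
Local Notation lc := (lc E).

(* The word [:: e_n; ...; e_1] stands for the ghost path e_n^* ... e_1^*, that is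
   for the path e_1 ... e_n read backwards; it goes from w to v when this path
   does. *)
Fixpoint gok w r v : bool :=
  if r is e :: r' then (rng e == v) && gok w r' (src e) else w == v.

Definition gw w r : L := foldr (fun e x => lg e * x) (lv w) r.

Definition gend w r : vertex E := if r is e :: _ then rng e else w.

Lemma gok_end w r v : gok w r v -> v = gend w r.
Proof. by case: r => [|e r] /=; [move/eqP|case/andP=> /eqP]. Qed.

Lemma gok_cat w r q v u : gok w q u -> gok w (r ++ q) v = gok u r v.
Proof.
elim: r v => [|e r IH] v wqu /=; last by rewrite IH.
apply/idP/eqP => [/gok_end -> | <- //]; exact: (gok_end wqu).
Qed.

Lemma gw_lv w r : gw w r * lv w = gw w r.
Proof. by elim: r => [|e r IH] /=; rewrite ?lvv // -mulrA IH. Qed.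

Lemma lv_gw w r v : gok w r v -> lv v * gw w r = gw w r.
Proof.
case: r => [/eqP <-|e r /andP[/eqP <- _]] /=; first exact: lvv.
by rewrite mulrA lv_lg.
Qed.

Lemma lv_gwN w r v u : gok w r v -> u != v -> lv u * gw w r = 0.
Proof. by move=> /lv_gw <- uv; rewrite mulrA lv_neq // mul0r. Qed.

Lemma gw_bad w r : ~~ gok w r (gend w r) -> gw w r = 0.
Proof.
elim: r => [|e r IH] /=; first by rewrite eqxx.
rewrite eqxx /= => bad; have [ok|nok] := boolP (gok w r (gend w r)); last first.
  by rewrite IH // mulr0.
have [se|se] := eqVneq (src e) (gend w r); first by rewrite se ok in bad.
by rewrite -(lv_gw ok) mulrA lg_lvN ?mul0r // eq_sym.
Qed.

(** A ghost word evaluates a function at a displaced point: position [sig r m], degree increased by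
    the length of [r]. Words of equal length from [w] reach distinct positions, so the Dirac
    function at the point of [r0], acted upon and evaluated at the end of [r0] with position and
    degree 0, reads off the coefficient of [r0]. *)
Lemma gw_coef w r0 : gok w r0 (gend w r0) -> exists chi : L -> K,
  [/\ forall x y, chi (x + y) = chi x + chi y,
      forall c x, chi (lc c * x) = c * chi x
    & forall r, chi (gw w r) = (r == r0)%:R].
Proof.
move=> ok0; have [rho [rv _ rg rc]] := lpa_rep K E 1.
(* A mixed-radix number: each edge contributes its rank as a digit, in base the out-degree of its
   source. *)
pose sig := fix sig r m : nat :=
  if r is e :: r' then sig r' (m * outdeg (src e) + rank e)%N else m.
have gwE r f v m n : rho (gw w r) f (v, m, n) =
    if gok w r v then f (w, sig r m, n + (size r)%:Z) else 0.
  elim: r v m n => [|e r IH] v m n.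
    rewrite [LHS]rv /= addr0 eq_sym; case: eqP => // ->; done.
  rewrite [gw _ _]/= rmorphM [LHS]rg /= eq_sym; case: eqP => //= ev.
  by rewrite IH -addrA -intS.
have sig_inj : forall r q v u m n, gok w r v -> gok w q u ->
    size r = size q -> sig r m = sig q n -> [/\ r = q, v = u & m = n].
  elim=> [|e r IH] [|f q] //= v u m n; first by move=> /eqP <- /eqP <- _ ->.
  move=> /andP[/eqP <- okr] /andP[/eqP <- okq] [sz] sg.
  have [-> ef mn] := IH _ _ _ _ _ okr okq sz sg.
  have k : rank e = rank f by rewrite -(modn_rank e m) mn ef modn_rank.
  have e_f : e = f by exact: rank_inj.
  by split; rewrite ?e_f // -(divn_rank e m) mn ef divn_rank.
pose d (x : vertex E * nat * int) : K := (x == (w, sig r0 0%N, (size r0)%:Z))%:R.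
exists (fun x => rho x d (gend w r0, 0%N, 0)); split=> [x y|c x|r].
- by rewrite rmorphD.
- by rewrite rmorphM [LHS]rc.
rewrite gwE /d add0r; case: (eqVneq r r0) => [->|rr0]; first by rewrite ok0; case: eqP.
case: ifP => // okr; case: eqP => // -[sg [sz]].
by have [] := sig_inj _ _ _ _ _ _ okr ok0 sz sg; move/eqP: rr0.
Qed.

Lemma lv_neq0 v : lv v != 0.
Proof.
have [|chi [chiD chiZ chiE]] := @gw_coef v [::]; first exact: eqxx.
apply/eqP => v0; have := chiE [::]; rewrite /= v0 => c0.
have /eqP := chiZ 0 0; rewrite mulr0 mul0r c0.
by rewrite oner_eq0.
Qed.

Lemma le_neq0 e : le e != 0.
Proof.
by apply: contraNneq (lv_neq0 (rng e)) => e0; rewrite -lge e0 mulr0.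
Qed.

Section Ghostly.
(* When the flag g is set, only ghost paths of degree n are allowed. *)
Variable g : bool.

Definition ghost_leaf (n : int) v (x : L) : Prop :=
  forall w, exists (l : seq (seq (edge E))) (a : seq (edge E) -> K),
    [/\ uniq l, forall r, r \in l -> gok w r v && (g ==> ((size r)%:Z == - n))
      & x * lv w = \sum_(r <- l) lc (a r) * gw w r].

(* After N expansions by the relation (CK2), only ghost paths are left. *)
Fixpoint ghostly (N : nat) (n : int) v (x : L) : Prop :=
  if N is M.+1 then
    if `[< sink v >] then ghost_leaf n v (lv v * x)
    else forall e, src e = v -> ghostly M (n - 1) (rng e) (lg e * x)
  else ghost_leaf n v (lv v * x).

Lemma ghost_leaf0 n v : ghost_leaf n v 0.
Proof. by move=> w; exists [::], (fun=> 0); rewrite mul0r big_nil. Qed.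

Lemma big_undup_cat (F : seq (edge E) -> L) l1 l2 : uniq l1 ->
  \sum_(r <- undup (l1 ++ l2)) (if r \in l1 then F r else 0) = \sum_(r <- l1) F r.
Proof.
move=> u1; rewrite -big_mkcond -big_filter; apply: perm_big.
apply: uniq_perm => //; first by rewrite filter_uniq ?undup_uniq.
by move=> r; rewrite mem_filter mem_undup mem_cat; case: (r \in l1).
Qed.

Lemma ghost_leafD n v x y :
  ghost_leaf n v x -> ghost_leaf n v y -> ghost_leaf n v (x + y).
Proof.
move=> hx hy w; have [l1 [a1 [u1 ok1 e1]]] := hx w.
have [l2 [a2 [u2 ok2 e2]]] := hy w.
exists (undup (l1 ++ l2)), (fun r => (if r \in l1 then a1 r else 0) +
  (if r \in l2 then a2 r else 0)); split.
- exact: undup_uniq.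
- by move=> r; rewrite mem_undup mem_cat => /orP[/ok1|/ok2].
pose F1 r := lc (a1 r) * gw w r; pose F2 r := lc (a2 r) * gw w r.
have p21 : perm_eq (undup (l2 ++ l1)) (undup (l1 ++ l2)).
  apply: uniq_perm; rewrite ?undup_uniq // => r.
  by rewrite !mem_undup !mem_cat orbC.
rewrite mulrDl e1 e2 -/(F1 _) -/(F2 _).
rewrite -(big_undup_cat F1 l2 u1) -(big_undup_cat F2 l1 u2) (perm_big _ p21) -big_split.
apply: eq_bigr => r _; rewrite rmorphD mulrDl.
by congr (_ + _); case: ifP; rewrite // rmorph0 mul0r.
Qed.

Lemma ghost_leafZ n v c x : ghost_leaf n v x -> ghost_leaf n v (lc c * x).
Proof.
move=> hx w; have [l [a [u ok e]]] := hx w.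
exists l, (fun r => c * a r); split=> //.
rewrite -mulrA e mulr_sumr; apply: eq_bigr => r _.
by rewrite rmorphM mulrA.
Qed.

Lemma ghost_leaf_lg n v e x : src e = v -> ghost_leaf n v x ->
  ghost_leaf (n - 1) (rng e) (lg e * x).
Proof.
move=> sev hx w; have [l [a [u ok xE]]] := hx w.
exists [seq e :: r | r <- l], (fun r => a (behead r)); split.
- by rewrite map_inj_uniq // => r q [].
- move=> _ /mapP[r /ok /andP[okr /implyP sz] ->] /=; rewrite eqxx sev okr /=.
  by apply/implyP => /sz /eqP rn; rewrite opprB intS rn.
rewrite big_map -mulrA xE mulr_sumr; apply: eq_bigr => r _ /=.
by rewrite mulrA -lcC mulrA.
Qed.

Lemma ghostly_eq N n v x y : lv v * x = lv v * y -> ghostly N n v x -> ghostly N n v y.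
Proof.
elim: N n v x y => [|N IH] n v x y xy /=; first by rewrite xy.
case: asboolP => [sv|nsv]; first by rewrite xy.
move=> h e sev; apply: IH (h e sev); congr (_ * _).
by rewrite -lg_lv sev -!mulrA xy.
Qed.

Lemma ghostly0 N n v x : lv v * x = 0 -> ghostly N n v x.
Proof.
move=> x0; apply: (@ghostly_eq _ _ _ 0); first by rewrite mulr0 x0.
elim: N n v {x x0} => [|N IH] n v /=; first by rewrite mulr0; exact: ghost_leaf0.
case: asboolP => [sv|nsv e sev]; first by rewrite mulr0; exact: ghost_leaf0.
by rewrite mulr0; exact: IH.
Qed.

Lemma ghostlyD N n v x y :
  ghostly N n v x -> ghostly N n v y -> ghostly N n v (x + y).
Proof.
elim: N n v x y => [|N IH] n v x y /=; rewrite ?mulrDr; first exact: ghost_leafD.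
case: asboolP => [sv|nsv hx hy e sev]; first exact: ghost_leafD.
by rewrite mulrDr; apply: IH; [exact: hx|exact: hy].
Qed.

Lemma ghostlyZ N n v c x : ghostly N n v x -> ghostly N n v (lc c * x).
Proof.
elim: N n v x => [|N IH] n v x /=; rewrite mulrA -lcC -mulrA; first exact: ghost_leafZ.
case: asboolP => [sv|nsv hx e sev]; first exact: ghost_leafZ.
by rewrite mulrA -lcC -mulrA; apply: IH; exact: hx.
Qed.

(** Expanding a leaf once more prefixes a ghost edge to ghost words, which gives ghost words
    again. *)
Lemma ghostlyS N n v x : ghostly N n v x -> ghostly N.+1 n v x.
Proof.
elim: N n v x => [|N IH] n v x.
  rewrite [ghostly 1 _ _ _]/=; case: asboolP => // nsv hx e sev /=.
  by rewrite mulrA lv_lg -lg_lv sev -mulrA; exact: ghost_leaf_lg sev hx.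
move=> /= ; case: asboolP => // nsv hx e sev; apply: IH; exact: hx.
Qed.

Lemma ghostly_leq M N n v x : (M <= N)%N -> ghostly M n v x -> ghostly N n v x.
Proof.
move=> /subnK <-; elim: (N - M)%N => // d IH /IH; rewrite addSn; exact: ghostlyS.
Qed.

Definition ghostly_all N n x := forall v, ghostly N n v x.

Lemma ghostly_lv N n u x : ghostly_all N n x -> ghostly_all N n (lv u * x).
Proof.
move=> hx v; have [->|vu] := eqVneq v u; last first.
  by apply: ghostly0; rewrite mulrA lv_neq ?mul0r.
by apply: (@ghostly_eq _ _ _ x) => //; rewrite mulrA lvv.
Qed.

Lemma ghostly_lg N n e x : ghostly_all N n x -> ghostly_all N (n - 1) (lg e * x).
Proof.
move=> hx v; have [->|ve] := eqVneq v (rng e); last first.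
  by apply: ghostly0; rewrite mulrA lv_lgN ?mul0r.
have := hx (src e); case: N {hx} => [|N] /=.
  by move=> h; rewrite mulrA lv_lg -lg_lv -mulrA; exact: ghost_leaf_lg erefl h.
case: asboolP => [/(_ e)//|_ /(_ e erefl)].
exact: ghostlyS.
Qed.

(** A real edge costs one expansion: at the source of [e], (CK1) turns f^* e x into the part of x at
    the range of [e] when f = e, and into 0 otherwise. *)
Lemma ghostly_le N n e x : ghostly_all N n x -> ghostly_all N.+1 (n + 1) (le e * x).
Proof.
move=> hx v /=; case: asboolP => [sv|nsv f sfv].
  by rewrite mulrA lv_leN ?mul0r; [exact: ghost_leaf0|apply/eqP => /esym /sv].
rewrite addrK mulrA lg_le; case: eqP => [->|]; last first.
  by move=> _; rewrite mul0r; apply: ghostly0; rewrite mulr0.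
by rewrite mulr1n; apply: ghostly_lv.
Qed.

Lemma ghostly_gw w r n : g ==> ((size r)%:Z == - n) -> ghostly_all 0 n (gw w r).
Proof.
move=> rn v /=; have [ok|nok] := boolP (gok w r (gend w r)); last first.
  by rewrite gw_bad // mulr0; exact: ghost_leaf0.
have [->|vr] := eqVneq v (gend w r); last first.
  by rewrite (lv_gwN ok) //; exact: ghost_leaf0.
rewrite (lv_gw ok) => u; have [->|uw] := eqVneq u w.
  exists [:: r], (fun=> 1); split=> //; first by move=> q; rewrite inE => /eqP ->; rewrite ok.
  by rewrite big_seq1 rmorph1 mul1r gw_lv.
exists [::], (fun=> 0); split => //; rewrite big_nil -gw_lv -mulrA lv_neq ?mulr0 //.
by rewrite eq_sym.
Qed.

End Ghostly.

Lemma ghostly_ex x : exists N, ghostly_all false N 0 x.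
Proof.
have shift N n m v y : ghostly false N n v y -> ghostly false N m v y.
  elim: N n m v y => [|N IH] n m v y //=; case: asboolP => // _ h e sev.
  by apply: IH; exact: h.
have lift M N y : ghostly_all false M 0 y -> ghostly_all false (M + N) 0 y.
  by move=> h v; apply: ghostly_leq (h v); rewrite leq_addr.
elim/lpa_ind: x => [|x y [M hx] [N hy]|c x [N hx]|v x [N hx]|e x [N hx]|e x [N hx]].
- exists 0%N; rewrite -lv_sum => v; apply: (@ghostly_eq _ _ _ _ (lv v)).
    rewrite mulr_sumr (bigD1 v) //= big1 ?addr0 // => u uv.
    by rewrite lv_neq // eq_sym.
  by apply: (@ghostly_gw false v [::] 0).
- exists (M + N)%N => v; apply: ghostlyD; first exact: lift.
  by rewrite addnC; exact: lift.
- by exists N => v; apply: ghostlyZ.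
- by exists N; exact: ghostly_lv.
- by exists N.+1 => u; apply: shift; exact: (ghostly_le e hx).
- by exists N => u; apply: shift; exact: (ghostly_lg e hx).
Qed.

End GhostWords.

(** * Bases of projective modules *)

Section Bases.
Variables (K : fieldType) (E : graph) (Q : lmodType (lpa K E)).
Implicit Types (v w : vertex E) (e : edge E).
Local Notation L := (lpa K E).
Local Notation lv := (lv K).
Local Notation le := (le K).
Local Notation lg := (lg K).

Definition typed (I : finType) (s : I -> vertex E) (b : I -> Q) : Prop :=
  forall i, lv (s i) *: b i = b i.

Definition spans (I : finType) (b : I -> Q) (y : Q) : Prop :=
  exists c : I -> L, y = \sum_i c i *: b i.

Definition indep (I : finType) (s : I -> vertex E) (b : I -> Q) : Prop :=
  forall c : I -> L, \sum_i c i *: b i = 0 -> forall i, c i * lv (s i) = 0.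

(* A basis of type s is an isomorphism of Q with the direct sum of the L s_i. *)
Definition vbasis (I : finType) (s : I -> vertex E) (b : I -> Q) : Prop :=
  [/\ typed s b, forall y, spans b y & indep s b].

Lemma spans_mem (I : finType) (b : I -> Q) i : spans b (b i).
Proof.
exists (fun j => (j == i)%:R); rewrite (bigD1 i) //= eqxx scale1r big1 ?addr0 //.
by move=> j /negPf ->; rewrite scale0r.
Qed.

Lemma spansD (I : finType) (b : I -> Q) x y : spans b x -> spans b y -> spans b (x + y).
Proof.
move=> [c ->] [d ->]; exists (fun i => c i + d i); rewrite -big_split.
by apply: eq_bigr => i _; rewrite scalerDl.
Qed.

Lemma spans0 (I : finType) (b : I -> Q) : spans b 0.
Proof. by exists (fun=> 0); rewrite big1 // => i _; rewrite scale0r. Qed.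

Lemma spansZ (I : finType) (b : I -> Q) a x : spans b x -> spans b (a *: x).
Proof.
move=> [c ->]; exists (fun i => a * c i); rewrite scaler_sumr.
by apply: eq_bigr => i _; rewrite scalerA.
Qed.

Lemma spans_sum (I : finType) (b : I -> Q) (T : Type) (r : seq T) (P : pred T) F :
  (forall i, P i -> spans b (F i)) -> spans b (\sum_(i <- r | P i) F i).
Proof. by move=> h; elim/big_ind: _ => //; [exact: spans0|exact: spansD]. Qed.

Lemma spans_trans (I J : finType) (b : I -> Q) (d : J -> Q) x :
  (forall j, spans b (d j)) -> spans d x -> spans b x.
Proof. by move=> bd [c ->]; apply: spans_sum => j _; exact: spansZ. Qed.

Section Expansion.
Variables (I : finType) (s : I -> vertex E) (b : I -> Q).

(** All members are expanded at once: a vector at a vertex that emits edges gives way to its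
    products with the ghost edges there, as (CK2) permits; a vector at a sink is kept, tagged
    [inr]. *)
Definition exp_set : {pred (I * edge E) + I} := fun x =>
  match x with inl (i, e) => src e == s i | inr i => `[< sink (s i) >] end.
Definition exp_ind : finType := {x | x \in exp_set}.
Definition exp_type (x : exp_ind) : vertex E :=
  match val x with inl (_, e) => rng e | inr i => s i end.
Definition exp_vec (x : exp_ind) : Q :=
  match val x with inl (i, e) => lg e *: b i | inr i => b i end.

Lemma big_exp (R : Type) (idx : R) (op : Monoid.com_law idx)
    (F : (I * edge E) + I -> R) :
  \big[op/idx]_(x : exp_ind) F (val x) =
  \big[op/idx]_i (if `[< sink (s i) >] then F (inr i)
                  else \big[op/idx]_(e | src e == s i) F (inl (i, e))).
Proof.
rewrite -(@big_sub _ _ _ _ exp_set) big_sumType /=.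
rewrite [RHS](eq_bigr (fun i => op
  (\big[op/idx]_(e | src e == s i) F (inl (i, e)))
  (if `[< sink (s i) >] then F (inr i) else idx))).
  rewrite big_split -big_mkcond; congr (op _ _).
  by rewrite pair_big_dep /=; apply: eq_big => [[i e]|[i e] _].
move=> i _; case: asboolP => [si|_]; last by rewrite Monoid.mulm1.
by rewrite big_pred0 ?Monoid.mul1m // => e; apply/eqP; exact: si.
Qed.

Lemma exp_typed : typed s b -> typed exp_type exp_vec.
Proof.
move=> tb [[[i e]|i] /= xP]; rewrite /exp_type /exp_vec /=; last exact: tb.
by rewrite scalerA lv_lg.
Qed.

Lemma exp_spans : typed s b -> forall y, spans exp_vec y <-> spans b y.
Proof.
move=> tb y; split; apply: spans_trans.
  move=> [[[i e]|i] xP]; rewrite /exp_vec /=; last exact: spans_mem.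
  exact/spansZ/spans_mem.
move=> i; rewrite -tb; have [si|nsi] := pselect (sink (s i)).
  have xP : inr i \in exp_set by apply/asboolP.
  by apply: spansZ; exact: (spans_mem exp_vec (exist _ (inr i) xP : exp_ind)).
rewrite lv_CK2 // scaler_suml; apply: spans_sum => e se; rewrite -scalerA.
have xP : inl (i, e) \in exp_set by [].
by apply: spansZ; exact: (spans_mem exp_vec (exist _ (inl (i, e)) xP : exp_ind)).
Qed.

(** Collecting the terms with the same [i] turns a relation between expanded vectors into one
    between the [b i], whose coefficients are sums of c_e e^*; multiplying these on the right by e
    gives back c_e r(e) by (CK1). *)
Lemma exp_indep : typed s b -> indep s b -> indep exp_type exp_vec.
Proof.
move=> tb ib c c0.
pose c' (x : (I * edge E) + I) : L := if insub x is Some y then c (y : exp_ind) else 0.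
have cE x : c x = c' (val x) by rewrite /c' valK.
pose F (x : (I * edge E) + I) : Q :=
  match x with inl (i, e) => (c' x * lg e) *: b i | inr i => c' x *: b i end.
have : \sum_(x : exp_ind) F (val x) = 0.
  rewrite -[RHS]c0; apply: eq_bigr => x _; rewrite cE /exp_vec.
  by case: (val x) => [[i e]|i] /=; rewrite ?scalerA.
rewrite big_exp /= => S0.
pose d i : L := if `[< sink (s i) >] then c' (inr i)
  else \sum_(e | src e == s i) c' (inl (i, e)) * lg e.
have : \sum_i d i *: b i = 0.
  rewrite -[RHS]S0; apply: eq_bigr => i _; rewrite /d; case: ifP => // _.
  by rewrite scaler_suml.
move=> /ib d0 x; rewrite cE; case: x => [[[i e]|i] xP] /=; rewrite /exp_type /=.
- have /eqP se : src e == s i by [].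
  have := d0 i; rewrite /d; case: asboolP => [/(_ e)//|_ /(congr1 (fun z => z * le e))].
  rewrite mul0r -mulrA -se lv_le mulr_suml (bigD1 e) ?se //=.
  rewrite big1 ?addr0 => [|f /andP[_ fe]]; last by rewrite -mulrA lg_le (negPf fe) mulr0.
  by rewrite -mulrA lge.
- have si : `[< sink (s i) >] by [].
  by have := d0 i; rewrite /d si.
Qed.

Lemma exp_vbasis : vbasis s b -> vbasis exp_type exp_vec.
Proof.
move=> [tb gb ib]; split; [exact: exp_typed| |exact: exp_indep].
by move=> y; apply/exp_spans.
Qed.

End Expansion.

Section Elementary.
Variables (I : finType) (s : I -> vertex E) (b : I -> Q) (i k : I) (x : L).
Hypotheses (ik : i != k) (xl : lv (s k) * x = x) (xr : x * lv (s i) = x).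

Definition elem (j : I) : Q := if j == k then b k - x *: b i else b j.

Let shift (c : I -> L) (j : I) : L := if j == i then c i + c k * x else c j.

Let shiftE c : \sum_j c j *: b j = \sum_j shift c j *: elem j.
Proof.
rewrite (bigD1 i) //= (bigD1 k) 1?eq_sym //= [RHS](bigD1 i) //= [X in _ = _ + X](bigD1 k) 1?eq_sym //=.
rewrite /shift /elem eqxx (negPf ik) eq_sym (negPf ik) eqxx.
rewrite [X in _ = _ + (_ + X)](eq_bigr (fun j => c j *: b j)); last first.
  by move=> j /andP[/negPf -> /negPf ->].
rewrite scalerDl scalerBr scalerA !addrA; congr (_ + _).
by rewrite [X in _ = X - _]addrAC addrK.
Qed.

Lemma elem_spans y : spans elem y <-> spans b y.
Proof.
split; last by move=> [c ->]; exists (shift c).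
apply: spans_trans => j; rewrite /elem; case: eqP => _; last exact: spans_mem.
by rewrite -scaleNr; apply: spansD; [|apply: spansZ]; exact: spans_mem.
Qed.

Lemma elem_indep : indep s b -> indep s elem.
Proof.
move=> ib c c0.
pose d j : L := if j == i then c i - c k * x else c j.
have /ib d0 : \sum_j d j *: b j = 0.
  rewrite shiftE -[RHS]c0; apply: eq_bigr => j _; congr (_ *: _).
  rewrite /shift /d eqxx [k == i]eq_sym (negPf ik).
  by case: eqP => [->|//]; rewrite subrK.
have ck : c k * lv (s k) = 0 by have := d0 k; rewrite /d [k == i]eq_sym (negPf ik).
move=> j; have := d0 j; rewrite /d; case: eqP => [->|//].
by rewrite mulrBl -(mulrA _ x) xr -xl mulrA ck mul0r subr0.
Qed.

End Elementary.
End Bases.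

(** * Leading ghost words, encoded by polynomials *)

Section Formal.
Variables (K : fieldType) (E : graph) (Q : lmodType (lpa K E)).
Variables (J : finType) (rho : J -> vertex E) (delta : J -> Q).
Implicit Types (v w u : vertex E) (e : edge E) (r q p : seq (edge E)).
Implicit Types (f g : {poly K}) (i j : J).
Local Notation L := (lpa K E).
Local Notation lv := (lv K).
Local Notation le := (le K).
Local Notation lg := (lg K).
Local Notation lc := (lc E).
Local Notation gw := (gw K).

(* The combinations of the monomials gw (rho j) r *: delta j are represented by
   polynomials, through an injective numbering of the pairs (j, r) in base
   ghost_base that is increasing for the left action of ghost edges: the leading
   monomial is then given by the size of the polynomial. *)
Definition ghost_base : nat := (#|J| + #|edge E|).+1.
(** Digits lie above the roots, which are numbered from 1 to #|J|; the residue modulo [ghost_base]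
    therefore tells a root from a longer word. *)
Definition digit e : nat := (#|J| + enum_rank e).+1.
Fixpoint code j r : nat :=
  if r is e :: r' then (code j r' * ghost_base + digit e)%N else (enum_rank j).+1.

Lemma ltn_digit e : (digit e < ghost_base)%N.
Proof. by rewrite ltnS ltn_add2l. Qed.

Lemma digit_inj : injective digit.
Proof. by move=> e e' [/addnI/ord_inj/enum_rank_inj]. Qed.

Lemma shift_inj k k' e e' : (k * ghost_base + digit e = k' * ghost_base + digit e')%N ->
  k = k' /\ e = e'.
Proof.
move=> h; have m := congr1 (modn^~ ghost_base) h.
rewrite /= !modnMDl !modn_small ?ltn_digit // in m.
have d := congr1 (divn^~ ghost_base) h.
rewrite /= !divnMDl // !divn_small ?ltn_digit // !addn0 in d.
by split=> //; exact: digit_inj.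
Qed.

Lemma code_root j k e : ((enum_rank j).+1 = k * ghost_base + digit e)%N -> False.
Proof.
move=> h; have := congr1 (modn^~ ghost_base) h.
rewrite /= modnMDl !modn_small ?ltn_digit //; last first.
  by rewrite ltnS (leq_trans (ltn_ord _)) // leq_addr.
by move=> [/esym] h'; have := ltn_ord (enum_rank j); rewrite -h' ltnNge leq_addr.
Qed.

Lemma code_inj j r i q : code j r = code i q -> j = i /\ r = q.
Proof.
elim: r q => [|e r IH] [|e' q] /=.
- by move=> [/ord_inj/enum_rank_inj].
- by move/code_root.
- by move/esym/code_root.
- by move/shift_inj => [/IH[-> ->] ->].
Qed.

Definition mono j r : Q := gw (rho j) r *: delta j.

(** Numbers that code no pair decode to 0, which is compatible with prefixing a letter. *)
Definition dm (k : nat) : Q :=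
  if pselect (exists x : J * seq (edge E), code x.1 x.2 = k) is left h
  then mono (projT1 (cid h)).1 (projT1 (cid h)).2 else 0.

Lemma dm_code j r : dm (code j r) = mono j r.
Proof.
rewrite /dm; case: pselect => [h|[]]; last by exists (j, r).
by case: cid => -[i q] /= /code_inj[-> ->].
Qed.

Lemma dm_shift k e : dm (k * ghost_base + digit e)%N = lg e *: dm k.
Proof.
have [[[j r] /= <-]|no] := pselect (exists x : J * seq (edge E), code x.1 x.2 = k).
  rewrite -[(_ + _)%N]/(code j (e :: r)) !dm_code /mono /=.
  by rewrite scalerA.
rewrite {2}/dm; case: pselect => // _; rewrite scaler0 /dm.
case: pselect => // -[[j [|e' r]] /= h]; first by case: (code_root h).
by case: no; exists (j, r); case: (shift_inj h).
Qed.

Definition decode f : Q := \sum_(k < size f) lc f`_k *: dm k.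

Lemma decodeE n f : (size f <= n)%N -> decode f = \sum_(k < n) lc f`_k *: dm k.
Proof.
move=> fn; rewrite /decode (big_ord_widen n (fun k => lc f`_k *: dm k)) // big_mkcond /=.
apply: eq_bigr => k _; case: ltnP => // fk.
by rewrite nth_default // rmorph0 scale0r.
Qed.

Lemma decodeD f g : decode (f + g) = decode f + decode g.
Proof.
pose n := maxn (size f) (size g).
rewrite (@decodeE n (f + g)) ?size_polyD // (@decodeE n f) ?leq_maxl //.
rewrite (@decodeE n g) ?leq_maxr // -big_split; apply: eq_bigr => k _.
by rewrite coefD rmorphD scalerDl.
Qed.

Lemma decodeZ a f : decode (a *: f) = lc a *: decode f.
Proof.
rewrite (@decodeE (size f) (a *: f)) ?size_scale_leq // scaler_sumr.
by apply: eq_bigr => k _; rewrite coefZ rmorphM scalerA.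
Qed.

Lemma decode0 : decode 0 = 0.
Proof. by rewrite /decode size_poly0 big_ord0. Qed.

Lemma decode_sum (T : Type) (l : seq T) (F : T -> {poly K}) :
  decode (\sum_(x <- l) F x) = \sum_(x <- l) decode (F x).
Proof. by elim: l => [|x l IH]; rewrite ?big_nil ?decode0 // !big_cons decodeD IH. Qed.

Lemma decodeX k : decode 'X^k = dm k.
Proof.
rewrite /decode size_polyXn (bigD1 ord_max) //= coefXn eqxx rmorph1 scale1r.
rewrite big1 ?addr0 // => i /eqP ik; rewrite coefXn; case: eqP => [ik'|_].
  by case: ik; apply: ord_inj.
by rewrite rmorph0 scale0r.
Qed.

(** Substituting a power of X and multiplying by another one renumbers every exponent as prefixing
    [e] does; the operation is linear and carries leading terms to leading terms. *)
Definition act e f : {poly K} := (f \Po 'X^ghost_base) * 'X^(digit e).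

Lemma actE e f :
  act e f = \sum_(k < size f) f`_k *: 'X^(k * ghost_base + digit e).
Proof.
rewrite /act comp_polyE mulr_suml; apply: eq_bigr => k _.
by rewrite -scalerAl -exprM -exprD mulnC.
Qed.

Lemma decode_act e f : decode (act e f) = lg e *: decode f.
Proof.
rewrite actE decode_sum {2}/decode scaler_sumr; apply: eq_bigr => k _.
by rewrite decodeZ decodeX dm_shift !scalerA lcC.
Qed.

Lemma coef_act e f k : (act e f)`_k != 0 ->
  exists2 k', k = (k' * ghost_base + digit e)%N & f`_k' != 0.
Proof.
rewrite actE coef_sum => h.
have [i _ hi] : exists2 i : 'I_(size f), true & (f`_i *: 'X^(i * ghost_base + digit e))`_k != 0.
  apply/exists_inP; apply: contraNT h; rewrite negb_exists_in => /forall_inP h.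
  by rewrite big1 // => i _; have /negPn/eqP := h i isT.
exists i; move: hi; rewrite coefZ coefXn; last first.
  by rewrite mulf_eq0 negb_or => /andP[].
by case: (k =P _) => // _; rewrite mulr0 eqxx.
Qed.

Lemma size_act e f : f != 0 -> size (act e f) = ((size f).-1 * ghost_base + digit e).+1.
Proof.
move=> f0; have f0' : f \Po 'X^ghost_base != 0 by rewrite comp_poly_eq0 // size_polyXn.
rewrite size_mulXn //; have := size_comp_poly f 'X^ghost_base.
rewrite size_polyXn /= => <-; rewrite -addSn prednK ?size_poly_gt0 //.
exact: addnC.
Qed.

Definition valid v f : Prop :=
  forall k, f`_k != 0 -> exists j r, k = code j r /\ gok (rho j) r v.

Lemma valid0 v : valid v 0.
Proof. by move=> k; rewrite coef0 eqxx. Qed.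

Lemma validD v f g : valid v f -> valid v g -> valid v (f + g).
Proof.
move=> vf vg k; rewrite coefD; have [->|fk _] := eqVneq f`_k 0; last exact: vf.
by rewrite add0r; exact: vg.
Qed.

Lemma validZ v a f : valid v f -> valid v (a *: f).
Proof. by move=> vf k; rewrite coefZ mulf_eq0 negb_or => /andP[_]; exact: vf. Qed.

Lemma valid_sum v (T : Type) (l : seq T) (P : pred T) (F : T -> {poly K}) :
  (forall x, P x -> valid v (F x)) -> valid v (\sum_(x <- l | P x) F x).
Proof. by move=> h; elim/big_ind: _ => //; [exact: valid0|exact: validD]. Qed.

Lemma validX v j r : gok (rho j) r v -> valid v 'X^(code j r).
Proof.
by move=> ok k; rewrite coefXn; case: (k =P _) => [-> _|_]; [exists j, r|rewrite eqxx].
Qed.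

Lemma valid_act v e f : src e = v -> valid v f -> valid (rng e) (act e f).
Proof.
move=> sev vf k /coef_act[k' -> /vf[j [r [-> ok]]]]; exists j, (e :: r).
by rewrite /= eqxx sev ok.
Qed.

Lemma valid_lm v f : valid v f -> f != 0 ->
  exists j r, size f = (code j r).+1 /\ gok (rho j) r v.
Proof.
move=> vf f0; have /vf[j [r [jr ok]]] : f`_(size f).-1 != 0 by rewrite lead_coef_eq0.
by exists j, r; rewrite -jr prednK // size_poly_gt0.
Qed.

Lemma valid_typed v f : valid v f -> lv v *: decode f = decode f.
Proof.
move=> vf; rewrite scaler_sumr; apply: eq_bigr => k _.
have [->|fk] := eqVneq f`_k 0; first by rewrite rmorph0 !scale0r scaler0.
have [j [r [-> ok]]] := vf _ fk.
by rewrite dm_code scalerA -lcC -scalerA /mono [lv v *: _]scalerA lv_gw.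
Qed.

(** Independence of [delta] separates the roots, and [gw_coef] separates the words over one root;
    [valid] ensures that every exponent present is the code of such a word. *)
Lemma decode_inj v f : indep rho delta -> valid v f -> decode f = 0 -> f = 0.
Proof.
move=> idelta vf f0; apply/polyP => k; rewrite coef0; apply/eqP.
apply: contraT => /[dup] fk0 /vf[j [r [kE ok]]].
pose dec (k : nat) : option (J * seq (edge E)) :=
  if pselect (exists x : J * seq (edge E), code x.1 x.2 = k) is left h
  then Some (projT1 (cid h)) else None.
have decE i q : dec (code i q) = Some (i, q).
  rewrite /dec; case: pselect => [h|[]]; last by exists (i, q).
  by case: cid => -[i' q'] /= /code_inj[-> ->].
pose G i k : L := if dec k is Some (i', q) then if i' == i then gw (rho i) q else 0 else 0.
have dmE k' : dm k' = \sum_i G i k' *: delta i.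
  rewrite /dm /G /dec; case: pselect => [h|_]; last first.
    by rewrite big1 // => i _; rewrite scale0r.
  case: (projT1 _) => i q /=; rewrite (bigD1 i) //= eqxx big1 ?addr0 // => i' /negPf.
  by rewrite eq_sym => ->; rewrite scale0r.
have /idelta/(_ j) : \sum_i (\sum_(k < size f) lc f`_k * G i k) *: delta i = 0.
  rewrite -[RHS]f0 /decode; under [RHS]eq_bigr => k' _ do rewrite dmE scaler_sumr.
  rewrite exchange_big; apply: eq_bigr => i _; rewrite scaler_suml.
  by apply: eq_bigr => k' _; rewrite scalerA.
have [|chi [chiD chiZ chiE]] := @gw_coef K E (rho j) r.
  by rewrite -(gok_end ok).
have chi0 : chi 0 = 0 by have := chiZ 0 0; rewrite mulr0 mul0r.
have chi_sum n (F : 'I_n -> L) : chi (\sum_(i < n) F i) = \sum_(i < n) chi (F i).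
  by elim/big_ind2: _ => // x1 x2 y1 y2 <- <-.
rewrite mulr_suml => /(congr1 chi); rewrite chi0 chi_sum.
have kf : (k < size f)%N by rewrite ltnNge; apply: contra fk0 => /(nth_default 0) ->.
rewrite (bigD1 (Ordinal kf)) //= big1 => [|k' kk'].
  have Gk : G j k = gw (rho j) r by rewrite /G kE decE eqxx.
  rewrite addr0 -mulrA chiZ Gk gw_lv chiE eqxx mulr1.
  by move/eqP; rewrite (negPf fk0).
have [->|/vf[i [q [k'E _]]]] := eqVneq f`_k' 0; first by rewrite rmorph0 !mul0r chi0.
rewrite -mulrA chiZ k'E /G decE; case: (eqVneq i j) => [ij|_]; last first.
  by rewrite mul0r chi0 mulr0.
rewrite gw_lv chiE; case: (eqVneq q r) => [qr|_]; last by rewrite mulr0.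
case/eqP: kk'; apply: ord_inj => /=; by rewrite k'E kE ij qr.
Qed.

Definition actw r f : {poly K} := foldr act f r.

Lemma act_neq0 e f : f != 0 -> act e f != 0.
Proof. by move=> f0; rewrite -size_poly_gt0 size_act. Qed.

Lemma actw_neq0 r f : f != 0 -> actw r f != 0.
Proof. by move=> f0; elim: r => //= e r; exact: act_neq0. Qed.

Lemma size_actw r q j f : size f = (code j q).+1 ->
  size (actw r f) = (code j (r ++ q)).+1.
Proof.
move=> fE; have f0 : f != 0 by rewrite -size_poly_gt0 fE.
by elim: r => //= e r IH; rewrite size_act ?actw_neq0 // IH.
Qed.

Lemma valid_actw v u r f : gok v r u -> valid v f -> valid u (actw r f).
Proof.
move=> + vf; elim: r u => [|e r IH] u /=; first by move/eqP <-.
by move=> /andP[/eqP <- /IH]; exact: valid_act.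
Qed.

Lemma decode_actw v r f : valid v f -> decode (actw r f) = gw v r *: decode f.
Proof.
move=> vf; elim: r => [|e r IH] /=; first by rewrite valid_typed.
by rewrite decode_act IH scalerA.
Qed.

End Formal.

(** * Euclidean reduction to a prefix-free system *)

Section Reduction.
Variables (K : fieldType) (E : graph) (Q : lmodType (lpa K E)).
Variables (J : finType) (rho : J -> vertex E) (delta : J -> Q).
Hypothesis delta_indep : indep rho delta.
Implicit Types (v w u : vertex E) (e : edge E) (r q p : seq (edge E)).
Implicit Types (f g : {poly K}) (j : J).
Local Notation L := (lpa K E).
Local Notation lv := (lv K).
Local Notation le := (le K).
Local Notation lg := (lg K).
Local Notation lc := (lc E).
Local Notation gw := (gw K).
Local Notation decode := (decode rho delta).
Local Notation valid := (valid rho).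
Local Notation actw := (actw J).
Local Notation code := (@code E J).

Lemma gok_suffix w p q v : gok w (p ++ q) v -> gok w q (gend w q).
Proof.
elim: p v => [|e p IH] v /=; last by case/andP=> _; exact: IH.
by move=> /[dup] /gok_end <-.
Qed.

Lemma size_sub_lead f g : f != 0 -> size g = size f ->
  (size (f - (lead_coef f / lead_coef g) *: g)%R < size f)%N.
Proof.
move=> f0 gf; have sf : (0 < size f)%N by rewrite size_poly_gt0.
have g0 : g != 0 by rewrite -size_poly_gt0 gf.
rewrite -(prednK sf) ltnS; apply/leq_sizeP => k; rewrite leq_eqVlt => /orP[/eqP <-|fk].
  rewrite coefB coefZ -/(lead_coef f) -gf -/(lead_coef g).
  by rewrite divfK ?subrr // lead_coef_eq0.
have fk' : (size f <= k)%N by rewrite -(prednK sf).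
by rewrite coefB coefZ !nth_default ?gf // mulr0 subr0.
Qed.

Section Families.
Variables (I : finType) (s : I -> vertex E).

Definition valid_fam (f : I -> {poly K}) : Prop := forall i, valid (s i) (f i).

(* No leading monomial is an initial subword of another one. *)
Definition prefix_free (f : I -> {poly K}) : Prop :=
  forall i k r, i != k -> f i != 0 -> f k != 0 -> size (actw r (f i)) != size (f k).

Local Notation vec f := (fun i => decode (f i)).

(** Induction on the sum of the sizes. If a translate of [f i] has the leading monomial of [f k],
    subtracting a multiple of it from [f k] is an elementary operation that lowers the size of
    [f k]. Members that become 0 are kept, as [prefix_free] tolerates them. *)
Lemma prefix_reduction (f : I -> {poly K}) : valid_fam f ->
  exists f' : I -> {poly K}, [/\ valid_fam f', forall y, spans (vec f') y <-> spans (vec f) y,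
    indep s (vec f) -> indep s (vec f') & prefix_free f'].
Proof.
have [n] := ubnP (\sum_i size (f i))%N; elim: n f => // n IH f /ltnSE fn vf.
have [pf|npf] := pselect (prefix_free f); first by exists f.
have [i [k [r [ik fi fk]]]] : exists i k r,
    [/\ i != k, f i != 0, f k != 0 & size (actw r (f i)) = size (f k)].
  apply: contrapT => no; apply: npf => i k r ik fi fk; apply/eqP => e.
  by apply: no; exists i, k, r.
move=> szE.
have [j [q [fiE okq]]] := valid_lm (@vf i) fi.
have [j' [q' [fkE okq']]] := valid_lm (@vf k) fk.
(* Equality of the codes shows that the leading word of [f k] is [r] followed by that of [f i], so
   that [r] leads from [s i] to [s k]. *)
have ok : gok (s i) r (s k).
  move: szE; rewrite (size_actw r fiE) fkE => -[] /code_inj[jj' rq]; subst j' q'.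
  by rewrite (gok_cat _ _ okq) in okq'.
pose a := lead_coef (f k) / lead_coef (actw r (f i)).
pose f' (l : I) := if l == k then f k - a *: actw r (f i) else f l.
have va : valid (s k) (actw r (f i)) by exact: valid_actw ok (@vf i).
pose x : L := lc a * gw (s i) r.
have f'E : vec f' = elem (vec f) i k x.
  apply: funext => l; rewrite /f' /elem; case: eqP => // _.
  by rewrite decodeD -[- (a *: _)]scaleNr decodeZ (decode_actw delta r (@vf i)) rmorphN scaleNr scalerA.
have xl : lv (s k) * x = x by rewrite /x mulrA -lcC -mulrA (lv_gw _ ok).
have xr : x * lv (s i) = x by rewrite /x -mulrA gw_lv.
have [||g [vg sg ig pg]] := IH f'.
- apply: leq_trans fn; rewrite [X in (X < _)%N](bigD1 k) //= [X in (_ < X)%N](bigD1 k) //=.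
  have -> : (\sum_(l | l != k) size (f' l) = \sum_(l | l != k) size (f l))%N.
    by apply: eq_bigr => l /negPf lk; rewrite /f' lk.
  by rewrite ltn_add2r /f' eqxx; exact: size_sub_lead.
- move=> l; rewrite /f'; case: eqP => [->|_]; last exact: vf.
  by rewrite -scaleNr; apply: validD; [exact: vf|exact: validZ].
exists g; split=> // [y|ifm].
  by rewrite sg f'E; exact: elem_spans.
by apply: ig; rewrite f'E; apply: elem_indep.
Qed.

Variable f : I -> {poly K}.
Hypotheses (vf : valid_fam f) (pf : prefix_free f) (fn0 : forall i, f i != 0).

Lemma size_actw_inj i r k q :
  size (actw r (f i)) = size (actw q (f k)) -> i = k /\ r = q.
Proof.
have [j [p [fiE ok]]] := valid_lm (@vf i) (fn0 i).
have [j' [p' [fkE ok']]] := valid_lm (@vf k) (fn0 k).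
rewrite (size_actw r fiE) (size_actw q fkE) => -[] /code_inj[jj' e]; subst j'.
have main (i1 i2 : I) (p1 p2 r1 r2 : seq (edge E)) :
    size (f i1) = (code j p1).+1 -> size (f i2) = (code j p2).+1 ->
    r1 ++ p1 = r2 ++ p2 -> (size r1 <= size r2)%N -> i1 = i2 /\ r1 = r2.
  move=> f1 f2 e12 le12.
  have t12 : take (size r1) r2 = r1.
    have := congr1 (take (size r1)) e12.
    by rewrite take_size_cat // takel_cat.
  have [r3 r2E] : exists r3, r2 = r1 ++ r3.
    by exists (drop (size r1) r2); rewrite -{1}t12 cat_take_drop.
  move: e12; rewrite r2E -catA => /eqP; rewrite eqseq_cat // eqxx /= => /eqP p1E.
  have [i12|i12] := eqVneq i1 i2; last first.
    have i21 : i2 != i1 by rewrite eq_sym.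
    by have := @pf _ _ r3 i21 (fn0 _) (fn0 _); rewrite (size_actw r3 f2) f1 p1E eqxx.
  split=> //; move: f1; rewrite i12 f2 p1E => -[] /code_inj[_ /(congr1 size)].
  by rewrite size_cat -{1}[size p2]add0n => /addIn/esym/size0nil ->; rewrite cats0.
have [le|le] := leqP (size r) (size q); first exact: main fiE fkE e le.
by have [-> ->] := main _ _ _ _ _ _ fkE fiE (esym e) (ltnW le).
Qed.

(** Distinct translates have distinct leading monomials by [size_actw_inj], so the largest one
    cannot cancel. *)
Lemma size_comb (l : seq (I * seq (edge E))) (a : I * seq (edge E) -> K) :
  uniq l -> (forall x, x \in l -> a x != 0) -> l != [::] ->
  exists2 x, x \in l & size (\sum_(x <- l) a x *: actw x.2 (f x.1)) = size (actw x.2 (f x.1)).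
Proof.
elim: l => // x [|y l] IH /andP[xl ul] al _.
  exists x; first exact: mem_head.
  by rewrite big_seq1 size_scale // al // mem_head.
have [|//|z zl zE] := IH ul; first by move=> z zl; apply: al; rewrite inE zl orbT.
rewrite big_cons; set S := \sum_(_ <- _) _ in zE *.
have xz : size (actw x.2 (f x.1)) != size (actw z.2 (f z.1)).
  apply: contraNneq xl => /size_actw_inj[e1 e2].
  by rewrite (_ : x = z) //; case: (x) (z) e1 e2 => [? ?] [? ?] /= -> ->.
have ax : size (a x *: actw x.2 (f x.1)) = size (actw x.2 (f x.1)).
  by rewrite size_scale // al // mem_head.
have [lt|lt|e] := ltngtP (size (actw x.2 (f x.1))) (size (actw z.2 (f z.1))).
- by exists z; [rewrite inE zl orbT|rewrite addrC size_polyDl ?zE ?ax].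
- by exists x; [rewrite mem_head|rewrite size_polyDl ?zE ?ax].
- by rewrite e eqxx in xz.
Qed.

(** When the coefficients are combinations of ghost words, the whole combination is given by one
    polynomial, a combination of translates. Zero coefficients are filtered out so that [size_comb]
    applies. *)
Lemma leaf_comb n v (c : I -> L) : (forall i, ghost_leaf false n v (c i)) ->
  exists (l : seq (I * seq (edge E))) (a : I * seq (edge E) -> K),
    let g := \sum_(x <- l) a x *: actw x.2 (f x.1) in
    [/\ uniq l, forall x, x \in l -> a x != 0, valid v g,
        decode g = \sum_i c i *: decode (f i)
      & l = [::] -> forall i, c i * lv (s i) = 0].
Proof.
move=> hc.
have /choice[h hP] i : exists la : seq (seq (edge E)) * (seq (edge E) -> K),
    [/\ uniq la.1, forall r, r \in la.1 -> la.2 r != 0,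
        forall r, r \in la.1 -> gok (s i) r v
      & c i * lv (s i) = \sum_(r <- la.1) lc (la.2 r) * gw (s i) r].
  have [l [a [ul ok e]]] := hc i (s i).
  exists ([seq r <- l | a r != 0], a); split=> /=.
  - by rewrite filter_uniq.
  - by move=> r; rewrite mem_filter => /andP[].
  - by move=> r; rewrite mem_filter => /andP[_ /ok/andP[]].
  rewrite e big_filter [RHS]big_mkcond; apply: eq_bigr => r _.
  by case: eqP => //= ->; rewrite rmorph0 mul0r.
pose l := [seq (i, r) | i <- enum I, r <- (h i).1].
exists l, (fun x => (h x.1).2 x.2); rewrite /=; split.
- apply: allpairs_uniq_dep; first exact: enum_uniq.
    by move=> i _; case: (hP i).
  by move=> [i r] [k q] _ _ /= [-> ->].
- by move=> x /allpairsPdep[i [r [_ ri ->]]] /=; case: (hP i) => _ + _ _; apply.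
- rewrite big_seq_cond; apply: valid_sum => x /andP[+ _].
  move=> /allpairsPdep[i [r [_ ri ->]]] /=; apply: validZ.
  by apply: valid_actw (@vf i); case: (hP i) => _ _ + _; apply.
- rewrite decode_sum big_allpairs_dep /= big_enum /=; apply: eq_bigr => i _.
  rewrite -(valid_typed delta (@vf i)) scalerA.
  have [_ _ _ ->] := hP i; rewrite scaler_suml; apply: eq_bigr => r _.
  by rewrite decodeZ (decode_actw delta _ (@vf i)) scalerA.
move=> l0 i; have [_ _ _ ->] := hP i.
suff -> : (h i).1 = [::] by rewrite big_nil.
case hi : (h i).1 => [//|r l'].
have : (i, r) \in l by apply/allpairsPdep; exists i, r; rewrite mem_enum hi mem_head.
by rewrite l0.
Qed.

Lemma prefix_free_indep_leaf n v (c : I -> L) :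
  (forall i, ghost_leaf false n v (c i)) -> \sum_i c i *: decode (f i) = 0 ->
  forall i, c i * lv (s i) = 0.
Proof.
move=> hc c0; have [l [a /= [ul al vg gE]]] := leaf_comb hc; apply.
apply/eqP; apply: contraT => l0; have [x _] := size_comb ul al l0.
have -> := decode_inj delta_indep vg (etrans gE c0).
move=> /esym/eqP; rewrite size_poly0 size_poly_eq0.
by rewrite (negPf (actw_neq0 _ _ (fn0 _))).
Qed.

Lemma ghostly_max (T : finType) (c : T -> L) :
  exists N, forall i, ghostly_all false N 0 (c i).
Proof.
have /choice[N NP] i := ghostly_ex (c i).
exists (\max_i N i) => i v; apply: ghostly_leq (NP i v).
exact: leq_bigmax.
Qed.

(** The coefficients are cut by a vertex on the left and expanded: a ghost edge times the relation
    is a relation whose coefficients need fewer expansions, and (CK2) reassembles the original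
    coefficients. *)
Lemma prefix_free_indep : indep s (vec f).
Proof.
have main N : forall n v (c : I -> L), (forall i, ghostly false N n v (c i)) ->
    \sum_i c i *: decode (f i) = 0 -> forall i, lv v * c i * lv (s i) = 0.
  elim: N => [|N IH] n v c hc c0 i.
    apply: (@prefix_free_indep_leaf n v (fun i => lv v * c i) hc).
    by under eq_bigr => k _ do rewrite -scalerA; rewrite -scaler_sumr c0 scaler0.
  have [sv|nsv] := pselect (sink v).
    apply: (@prefix_free_indep_leaf n v (fun i => lv v * c i)) => [k|].
      by have := hc k; rewrite /=; case: asboolP.
    by under eq_bigr => k _ do rewrite -scalerA; rewrite -scaler_sumr c0 scaler0.
  rewrite (lv_CK2 K nsv) !mulr_suml big1 // => e /eqP sev.
  have := IH (n - 1) (rng e) (fun i => lg e * c i) _ _ i.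
  rewrite mulrA lv_lg => h; rewrite -!mulrA [lg e * _]mulrA h ?mulr0 //.
    by move=> k; have := hc k; rewrite /=; case: asboolP => // _; apply.
  by under eq_bigr => k _ do rewrite -scalerA; rewrite -scaler_sumr c0 scaler0.
move=> c c0 i; have [N hN] := ghostly_max c.
rewrite -[c i]mul1r -lv_sum !mulr_suml big1 // => v _.
exact: (main N 0 v c (fun k => hN k v) c0 i).
Qed.

(** Words are read backwards, so prolonging a path conses a letter. Every continuation of the path
    of [r] is to meet, within N further edges, a path that has the path of some leading word as an
    initial part. *)
Fixpoint covered N j r v : Prop :=
  (exists i p, size (actw p (f i)) = (code j r).+1) \/
  if N is M.+1 then ~ sink v /\ forall e, src e = v -> covered M j (e :: r) (rng e)
  else False.

(** Once the coefficients are combinations of ghost words, the monomial equals, as a polynomial, a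
    combination of translates; by [size_comb] one of these has it as leading monomial. *)
Lemma covered_ex N : forall n v j r (c : I -> L), gok (rho j) r v ->
  (forall i, ghostly false N n v (c i)) ->
  mono rho delta j r = \sum_i c i *: decode (f i) -> covered N j r v.
Proof.
have leaf n v j r (c : I -> L) : gok (rho j) r v ->
    (forall i, ghost_leaf false n v (lv v * c i)) ->
    mono rho delta j r = \sum_i c i *: decode (f i) ->
    exists i p, size (actw p (f i)) = (code j r).+1.
  move=> ok hc mE; have [l [a /= [ul al vg gE _]]] := leaf_comb hc.
  set g := \sum_(x <- l) _ in vg gE.
  have gX : g = 'X^(code j r).
    apply/eqP; rewrite -subr_eq0; apply/eqP.
    apply: (decode_inj delta_indep (v := v)).
      by rewrite -scaleN1r; apply: validD => //; apply: validZ; exact: validX.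
    rewrite -scaleN1r decodeD decodeZ decodeX dm_code gE.
    under eq_bigr => i _ do rewrite -scalerA.
    rewrite -scaler_sumr -mE /mono scalerA (lv_gw _ ok).
    by rewrite rmorphN rmorph1 scaleN1r subrr.
  have l0 : l != [::].
    apply/eqP => l0; move: gX; rewrite /g l0 big_nil => /eqP.
    by rewrite eq_sym -size_poly_eq0 size_polyXn.
  have [x _] := size_comb ul al l0; rewrite -/g gX size_polyXn => xE.
  by exists x.1, x.2.
elim: N => [|N IH] n v j r c ok hc mE /=; first by left; exact: leaf hc mE.
have [sv|nsv] := pselect (sink v).
  left; apply: (leaf n v j r c ok) => // i.
  by have := hc i; rewrite /=; case: asboolP.
right; split=> // e sev.
apply: (IH (n - 1) (rng e) j (e :: r) (fun i => lg e * c i)).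
- by rewrite /= eqxx sev.
- by move=> i; have := hc i; rewrite /=; case: asboolP => // _; apply.
rewrite /mono /= -scalerA -/(mono rho delta j r) mE scaler_sumr.
by apply: eq_bigr => i _; rewrite scalerA.
Qed.

Definition extends i j r : bool := `[< exists p, size (f i) = (code j (p ++ r)).+1 >].

Section Counting.
Variables (A : Type) (idx : A) (op : Monoid.com_law idx) (phi : vertex E -> A).
Hypothesis phiE : forall v, ~ sink v ->
  phi v = \big[op/idx]_(e | src e == v) phi (rng e).

Lemma exact_count i j r v : gok (rho j) r v -> size (f i) = (code j r).+1 ->
  \big[op/idx]_(k | extends k j r) phi (s k) = phi v.
Proof.
move=> ok fiE; rewrite (big_pred1 i) => [|k].
  have [j' [q [fE okq]]] := valid_lm (@vf i) (fn0 i).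
  move: fE; rewrite fiE => -[] /code_inj[jE rE]; subst j' q.
  by rewrite (gok_end okq) (gok_end ok).
apply/asboolP/eqP => [[p kE]|->]; last by exists [::].
have : size (actw ([::] : seq (edge E)) (f k)) = size (actw p (f i)).
  by rewrite (size_actw p fiE).
by case/size_actw_inj.
Qed.

(* The leading monomials form a complete prefix code, which is obtained from its
   root by successive expansions. *)
Lemma covered_count N j r v : gok (rho j) r v -> covered N j r v ->
  (forall i e p, size (actw (e :: p) (f i)) <> (code j r).+1) ->
  \big[op/idx]_(i | extends i j r) phi (s i) = phi v.
Proof.
elim: N r v => [|N IH] r v ok cov nop;
  have [[i fiE]|noexact] := pselect (exists i, size (f i) = (code j r).+1);
  try exact: exact_count ok fiE.
- case: cov => // -[i [[|e p] iE]]; last by case: (nop i e p).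
  by case: noexact; exists i.
have noleft : ~ exists i p, size (actw p (f i)) = (code j r).+1.
  case=> i [[|e p] iE]; last by case: (nop i e p).
  by apply: noexact; exists i.
case: cov => [//|[nsv cov]].
rewrite phiE // (eq_bigr (fun e => \big[op/idx]_(i | extends i j (e :: r)) phi (s i))); last first.
  move=> e /eqP sev; rewrite (IH (e :: r) (rng e)) //; first by rewrite /= eqxx sev.
    exact: cov.
  move=> i e' p; have [j' [q [fE okq]]] := valid_lm (@vf i) (fn0 i).
  rewrite (size_actw _ fE) => -[] /shift_inj[/code_inj[jj' pq] _]; subst j'.
  by apply: noleft; exists i, p; rewrite (size_actw _ fE) pq.
rewrite [RHS](exchange_big_dep xpredT) //= [LHS]big_mkcond; apply: eq_bigr => i _.
have [j' [q [fE okq]]] := valid_lm (@vf i) (fn0 i).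
rewrite [extends i j r]/extends; case: asboolP => [[p iE]|nex]; last first.
  rewrite big_pred0 // => e; apply/negbTE/negP => /andP[_ /asboolP[p iE]].
  by apply: nex; exists (rcons p e); rewrite cat_rcons.
case/lastP: p iE => [|p e] iE; first by case: noexact; exists i.
have [jE qE] : j' = j /\ q = p ++ e :: r.
  by move: fE; rewrite iE cat_rcons => -[] /code_inj[-> ->].
subst j' q; have okr : gok (rho j) (e :: r) (rng e) by exact: gok_suffix okq.
have sev : src e = v by move: okr => /andP[_ okr]; rewrite (gok_end okr) (gok_end ok).
rewrite (big_pred1 e) // => e'; apply/andP/eqP => [[_ /asboolP[p' iE']]|->].
  move: iE; rewrite iE' cat_rcons => -[] /code_inj[_].
  (* Counted from the end of the word, position [size r] holds the letter in front of [r]; comparing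
     it on both sides gives e' = e. *)
  move=> /(congr1 (fun l => nth e (rev l) (size r))).
  by rewrite !rev_cat !rev_cons !cat_rcons !nth_cat size_rev ltnn subnn.
by split; [rewrite sev|apply/asboolP; exists p; rewrite iE cat_rcons].
Qed.

(** Each leading word lies over exactly one root, which partitions the members; a root is covered
    because the system spans its monomial, and no shorter word can interfere. *)
Lemma cover_count : (forall y, spans (vec f) y) ->
  \big[op/idx]_i phi (s i) = \big[op/idx]_j phi (rho j).
Proof.
move=> span; rewrite [RHS](eq_bigr (fun j => \big[op/idx]_(i | extends i j [::]) phi (s i))).
  rewrite (exchange_big_dep xpredT) //=; apply: eq_bigr => i _.
  have [j [q [fE okq]]] := valid_lm (@vf i) (fn0 i).
  rewrite (big_pred1 j) // => j'; apply/asboolP/eqP => [[p]|->].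
    by rewrite fE => -[] /code_inj[].
  by exists q; rewrite cats0.
move=> j _; have [c cE] := span (mono rho delta j [::]).
have [N hN] := ghostly_max c.
have ok : gok (rho j) [::] (rho j) by exact: eqxx.
rewrite (@covered_count N j [::] (rho j)) //.
  exact: (covered_ex ok (fun i => hN i (rho j)) cE).
move=> i e p; have [j' [q [fE okq]]] := valid_lm (@vf i) (fn0 i).
by rewrite (size_actw _ fE) => -[] /esym/code_root.
Qed.

End Counting.
End Families.
End Reduction.

Section BasisTheorems.
Variables (K : fieldType) (E : graph) (Q : lmodType (lpa K E)).
Implicit Types (v w : vertex E) (e : edge E).
Local Notation L := (lpa K E).
Local Notation lv := (lv K).
Local Notation lg := (lg K).
Local Notation lc := (lc E).

Definition compatible (A : Type) (idx : A) (op : Monoid.com_law idx)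
    (phi : vertex E -> A) : Prop :=
  forall v, ~ sink v -> phi v = \big[op/idx]_(e | src e == v) phi (rng e).

Section Ambient.
Variables (J : finType) (rho : J -> vertex E) (delta : J -> Q).
Hypothesis delta_basis : vbasis rho delta.

Lemma leaf_formal v (c : J -> L) n : (forall j, ghost_leaf false n v (lv v * c j)) ->
  exists2 f, valid rho v f & lv v *: (\sum_j c j *: delta j) = decode rho delta f.
Proof.
case: delta_basis => tdelta _ _ hc.
have /choice[f fP] j : exists f, valid rho v f /\
    (lv v * c j) *: delta j = decode rho delta f.
  have [l [a [ul ok e]]] := hc j (rho j).
  exists (\sum_(r <- l) a r *: 'X^(code j r)); split.
    rewrite big_seq_cond; apply: valid_sum => r /andP[/ok/andP[okr _] _].
    by apply/validZ/validX.
  rewrite -tdelta scalerA e decode_sum scaler_suml; apply: eq_bigr => r _.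
  by rewrite decodeZ decodeX dm_code /mono scalerA.
exists (\sum_j f j); first by apply: valid_sum => j _; case: (fP j).
rewrite decode_sum scaler_sumr; apply: eq_bigr => j _.
by case: (fP j) => _ <-; rewrite scalerA.
Qed.

(** N expansions turn the coefficients over [delta] into combinations of ghost words, so that the
    vectors become polynomials; span, independence and the sums of compatible labels survive each
    expansion. *)
Lemma expand_formal N : forall (I : finType) (s : I -> vertex E) (b : I -> Q),
  typed s b ->
  (forall i, exists2 c : J -> L, b i = \sum_j c j *: delta j &
     exists n, forall j, ghostly false N n (s i) (c j)) ->
  exists (I' : finType) (s' : I' -> vertex E) (f : I' -> {poly K}),
    [/\ valid_fam rho s' f,
        forall y, spans (fun i => decode rho delta (f i)) y <-> spans b y,
        indep s b -> indep s' (fun i => decode rho delta (f i))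
      & forall (A : Type) (idx : A) (op : Monoid.com_law idx) phi,
          compatible op phi ->
          \big[op/idx]_i phi (s' i) = \big[op/idx]_i phi (s i)].
Proof.
elim: N => [|N IH] I s b tb hb.
  have /choice[f fP] i : exists f, valid rho (s i) f /\ b i = decode rho delta f.
    have [c bE [n hc]] := hb i; have [f vf fE] := leaf_formal hc.
    by exists f; rewrite -tb bE.
  have bE : (fun i => decode rho delta (f i)) = b.
    by apply: funext => i; case: (fP i).
  by exists I, s, f; rewrite bE; split=> // i; case: (fP i).
have [||I' [s' [f [vf sf i_f ef]]]] := IH _ (@exp_type E I s) (@exp_vec K E Q I s b).
- exact: exp_typed.
- move=> [[[i e]|i] xP].
  + have [c bE [n hc]] := hb i; have /eqP se : src e == s i by [].
    exists (fun j => lg e * c j).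
      rewrite /exp_vec /= bE scaler_sumr; apply: eq_bigr => j _.
      by rewrite scalerA.
    exists (n - 1) => j; have := hc j; rewrite /exp_type /=.
    by case: asboolP => [/(_ e)//|_]; apply.
  + have [c bE [n hc]] := hb i; exists c => //; exists n => j; rewrite /exp_type /=.
    have si : `[< sink (s i) >] by [].
    have := hc j; rewrite /= si => h.
    by apply: (@ghostly_leq _ _ _ 0).
exists I', s', f; split=> //.
- by move=> y; rewrite sf; exact: exp_spans.
- by move=> ib; apply: i_f; exact: exp_indep.
move=> A idx op phi cphi; rewrite (ef _ _ op phi cphi).
pose F (x : (I * edge E) + I) := match x with inl (_, e) => phi (rng e) | inr i => phi (s i) end.
rewrite (eq_bigr (fun x => F (val x))); last by move=> [[[i e]|i] xP].
rewrite big_exp; apply: eq_bigr => i _ /=.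
by case: asboolP => // nsi; rewrite cphi.
Qed.

Lemma expand_formal_ex (I : finType) (s : I -> vertex E) (b : I -> Q) : typed s b ->
  exists (I' : finType) (s' : I' -> vertex E) (f : I' -> {poly K}),
    [/\ valid_fam rho s' f,
        forall y, spans (fun i => decode rho delta (f i)) y <-> spans b y,
        indep s b -> indep s' (fun i => decode rho delta (f i))
      & forall (A : Type) (idx : A) (op : Monoid.com_law idx) phi,
          compatible op phi ->
          \big[op/idx]_i phi (s' i) = \big[op/idx]_i phi (s i)].
Proof.
move=> tb; case: delta_basis => _ gdelta _.
have /choice[c cE] i := gdelta (b i).
have [N hN] := ghostly_max (fun ij : I * J => c ij.1 ij.2).
apply: (expand_formal (N := N) tb) => i; exists (c i) => //.
by exists 0 => j; exact: (hN (i, j) (s i)).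
Qed.

Lemma indep_neq0 (I : finType) (s : I -> vertex E) (b : I -> Q) i :
  indep s b -> b i != 0.
Proof.
move=> ib; apply: contraNneq (lv_neq0 K (s i)) => bi.
have := ib (fun k => if k == i then lv (s i) else 0) _ i.
rewrite eqxx lvv => -> //; rewrite (bigD1 i) //= eqxx bi scaler0 add0r.
by rewrite big1 // => k /negPf ->; rewrite scale0r.
Qed.

(** This replaces invariance of the rank, which may fail for these algebras. Expansion and reduction
    over [delta] turn [b] into a prefix-free system with the same sum, which [cover_count] evaluates
    at the roots. *)
Theorem vbasis_count (I : finType) (s : I -> vertex E) (b : I -> Q)
    (A : Type) (idx : A) (op : Monoid.com_law idx) phi :
  vbasis s b -> compatible op phi ->
  \big[op/idx]_i phi (s i) = \big[op/idx]_j phi (rho j).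
Proof.
move=> [tb gb ib] cphi; case: (delta_basis) => _ _ idelta.
have [I' [s' [f [vf sf i_f ef]]]] := expand_formal_ex tb.
have [f' [vf' sf' i_f' pf']] := prefix_reduction delta vf.
have {i_f'} i_f' := i_f' (i_f ib).
have f'0 i : f' i != 0.
  by apply: contraTneq (indep_neq0 i i_f') => ->; rewrite decode0 eqxx.
rewrite -(ef _ _ op phi cphi); apply: (cover_count idelta vf' pf' f'0 cphi) => y.
by apply/sf'/sf.
Qed.

(** The members reduced to 0 are dropped and the others are independent, so a finitely generated
    submodule of a module with a basis has a basis. This serves for projective modules and again for
    minimal left ideals. *)
Theorem span_vbasis (T : finType) (x : T -> Q) :
  exists (I : finType) (s : I -> vertex E) (b : I -> Q),
    [/\ typed s b, indep s b & forall y, spans b y <-> spans x y].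
Proof.
case: (delta_basis) => _ _ idelta.
pose s0 (i : T * vertex E) := i.2; pose b0 (i : T * vertex E) := lv i.2 *: x i.1.
have tb0 : typed s0 b0 by move=> i; rewrite /b0 scalerA lvv.
have sb0 y : spans b0 y <-> spans x y.
  split; apply: spans_trans; first by move=> i; exact/spansZ/spans_mem.
  move=> t; rewrite -[x t]scale1r -(lv_sum K) scaler_suml; apply: spans_sum => v _.
  exact: (spans_mem b0 (t, v)).
have [I1 [s1 [f1 [vf1 sf1 _ _]]]] := expand_formal_ex tb0.
have [f2 [vf2 sf2 _ pf2]] := prefix_reduction delta vf1.
pose I := {i : I1 | f2 i != 0}; pose f (i : I) := f2 (val i).
pose s (i : I) := s1 (val i).
have vf : valid_fam rho s f by move=> i; exact: vf2.
have pf : prefix_free E J f.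
  by move=> i k r ik fi fk; apply: pf2 => //; rewrite (inj_eq val_inj).
have f0 i : f i != 0 by exact: (valP i).
exists I, s, (fun i => decode rho delta (f i)); split.
- by move=> i; exact: (valid_typed delta (vf i)).
- exact: (prefix_free_indep idelta vf pf f0).
move=> y; rewrite -sb0 -sf1 -sf2; split; apply: spans_trans.
  by move=> i; exact: (spans_mem (fun i => decode rho delta (f2 i)) (val i)).
move=> i; have [fi|fi] := eqVneq (f2 i) 0.
  by rewrite fi decode0; exact: spans0.
exact: (spans_mem (fun i => decode rho delta (f i)) (exist _ i fi : I)).
Qed.

End Ambient.
End BasisTheorems.

(** * Finitely generated projective modules *)

Section Modules.
Variables (K : fieldType) (E : graph).
Implicit Types (v w : vertex E) (e : edge E).
Local Notation L := (lpa K E).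
Local Notation lv := (lv K).
Local Notation lg := (lg K).

Lemma basis_reindex (Q : lmodType L) (I I' : finType) (h : I' -> I)
    (s : I -> vertex E) (b : I -> Q) :
  bijective h -> vbasis s b -> vbasis (s \o h) (b \o h).
Proof.
move=> [h' hK h'K] [tb gb ib]; split=> [i|y|c c0 i]; first exact: tb.
  have [c ->] := gb y; exists (c \o h).
  by rewrite (reindex h) //; exists h' => x _; [exact: hK|exact: h'K].
have := ib (c \o h') _ (h i); rewrite /= hK; apply; rewrite -[RHS]c0.
rewrite (reindex h) /=; last by exists h' => x _; [exact: hK|exact: h'K].
by apply: eq_bigr => k _; rewrite hK.
Qed.

Lemma basis_iso (P Q : lmodType L) (I : finType) (s : I -> vertex E)
    (b : I -> P) (d : I -> Q) :
  vbasis s b -> vbasis s d -> module_isomorphic P Q.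
Proof.
have tr (M N : lmodType L) (x : I -> M) (y : I -> N) (c c' : I -> L) :
    indep s x -> typed s y ->
    \sum_i c i *: x i = \sum_i c' i *: x i -> \sum_i c i *: y i = \sum_i c' i *: y i.
  move=> ix ty cc'; apply/eqP; rewrite -subr_eq0 -sumrB; apply/eqP.
  apply: big1 => i _; rewrite -scalerBl -ty scalerA.
  rewrite (ix (fun i => c i - c' i)) ?scale0r //.
  under eq_bigr => k _ do rewrite scalerBl.
  by rewrite sumrB cc' subrr.
move=> [tb gb ib] [td gd id].
have /choice[c cE] := gb; have /choice[c' c'E] := gd.
pose f x : Q := \sum_i c x i *: d i; pose f' y : P := \sum_i c' y i *: b i.
apply: (@linear_bij _ _ _ f).
  move=> a x y; rewrite /f scaler_sumr -big_split /=.
  under [RHS]eq_bigr => i _ do rewrite scalerA -scalerDl.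
  apply: (tr _ _ b d) => //; rewrite -cE.
  under [RHS]eq_bigr => i _ do rewrite scalerDl -scalerA.
  by rewrite big_split /= -scaler_sumr -!cE.
exists f' => x; rewrite [RHS](cE, c'E).
  by apply: (tr _ _ d b) => //; rewrite -c'E.
by apply: (tr _ _ b d) => //; rewrite -cE.
Qed.

Lemma vertices_basis : @vbasis K E L^o (vertex E) id (fun v => lv v).
Proof.
split=> [v|y|c c0 v]; first by rewrite -[LHS]/(lv v * lv v) lvv.
  exists (fun=> y); rewrite -scaler_sumr lv_sum.
  by rewrite -[RHS]/(y * 1) mulr1.
have := congr1 (fun x : L^o => (x : L) * lv v) c0.
rewrite mul0r mulr_suml (bigD1 v) //= big1 ?addr0 => [|w wv].
  by rewrite -[X in X * _]/(c v * lv v) -mulrA lvv.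
by rewrite -[X in X * _]/(c w * lv w) -mulrA lv_neq ?mulr0.
Qed.

Lemma row_basis n : @vbasis K E 'rV[L]_n ('I_n * vertex E)%type snd
  (fun x => \row_j (if j == x.1 then lv x.2 else 0)).
Proof.
split=> [[i v]|y|c c0 [i v]].
- by apply/rowP => j; rewrite !mxE /=; case: eqP => _; rewrite ?mulr0 ?lvv.
- exists (fun x => y ord0 x.1); apply/rowP => j; rewrite summxE.
  rewrite -(pair_bigA _ (fun i v => (y ord0 i *: (\row_j (if j == i then lv v else 0))) ord0 j)) /=.
  rewrite (bigD1 j) //= [X in _ + X]big1 ?addr0 => [|i ij]; last first.
    by apply: big1 => v _; rewrite !mxE eq_sym (negPf ij) mulr0.
  by under eq_bigr => v _ do rewrite !mxE eqxx; rewrite -mulr_sumr lv_sum mulr1.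
- have := congr1 (fun x : 'rV[L]_n => x ord0 i * lv v) c0.
  rewrite summxE mxE mul0r mulr_suml (bigD1 (i, v)) //= big1 ?addr0 => [|[i' v'] ne].
    by rewrite !mxE eqxx -mulrA lvv.
  rewrite !mxE /=; case: eqP => [ii'|_]; last by rewrite mulr0 mul0r.
  rewrite -mulrA lv_neq ?mulr0 //; apply: contra ne => /eqP ->.
  by rewrite ii'.
Qed.

(** A section [h] of a free cover [pi] embeds [P] in a free module, where [span_vbasis] applies to
    its image; [pi] carries the basis back. *)
Lemma fgproj_basis (P : fgproj L) :
  exists (I : finType) (s : I -> vertex E) (b : I -> P), vbasis s b.
Proof.
have [n [g gP]] := fgproj_fg P.
have [pi piE] : exists pi : {linear 'rV[L]_n -> P},
    pi =1 fun x => \sum_(i < n) x ord0 i *: g i.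
  apply: linear_exists => a x y; rewrite scaler_sumr -big_split /=.
  by apply: eq_bigr => i _; rewrite !mxE scalerDl scalerA.
have [idP idE] : exists h : {linear P -> P}, h =1 id by apply: linear_exists.
have [|h hE] := @fgproj_proj _ P _ _ pi idP.
  move=> y; have [c ->] := gP y; exists (\row_i c i); rewrite piE.
  by apply: eq_bigr => i _; rewrite mxE.
have {}hE x : pi (h x) = x by rewrite hE idE.
have [I [s [b [tb ib sb]]]] := span_vbasis (row_basis n) (fun i => h (g i)).
(* [b i] lies in the image of [h], on which [h \o pi] is the identity. *)
have bE i : h (pi (b i)) = b i.
  have [c ->] : spans (fun i => h (g i)) (b i) by apply/sb/spans_mem.
  rewrite !linear_sum; apply: eq_bigr => j _.
  by rewrite !linearZ hE.
exists I, s, (fun i => pi (b i)); split=> [i|y|c c0].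
- by rewrite -linearZ tb.
- have [d dE] : spans b (h y).
    apply/sb; have [c ->] := gP y; exists c; rewrite linear_sum.
    by apply: eq_bigr => i _; rewrite linearZ.
  exists d; rewrite -[LHS]hE dE linear_sum.
  by apply: eq_bigr => i _; rewrite linearZ.
- apply: ib; rewrite -[RHS](linear0 h) -c0 linear_sum.
  by apply: eq_bigr => i _; rewrite linearZ bE.
Qed.

Lemma dsum_basis (P Q : fgproj L) (I J : finType) (s : I -> vertex E)
    (t : J -> vertex E) (b : I -> P) (d : J -> Q) :
  vbasis s b -> vbasis t d ->
  @vbasis K E (dsum P Q) (I + J)%type
    (fun x => match x with inl i => s i | inr j => t j end)
    (fun x => match x with inl i => (b i, 0) | inr j => (0, d j) end).
Proof.
move=> [tb gb ib] [td gd id].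
have sumE (c : I + J -> L) :
    \sum_x c x *: (match x with inl i => (b i, 0) | inr j => (0, d j) end : dsum P Q) =
    (\sum_i c (inl i) *: b i, \sum_j c (inr j) *: d j).
  rewrite big_sumType /= [LHS]surjective_pairing; congr pair.
    rewrite raddfD !raddf_sum /= [X in _ + X]big1 ?addr0 // => j _.
    exact: scaler0.
  rewrite raddfD !raddf_sum /= [X in X + _]big1 ?add0r // => j _.
  exact: scaler0.
split.
- move=> [i|j]; rewrite [LHS]surjective_pairing /= scaler0; congr pair.
    exact: tb.
  exact: td.
- move=> [y z]; have [c cE] := gb y; have [c' c'E] := gd z.
  exists (fun x => match x with inl i => c i | inr j => c' j end).
  by rewrite sumE -cE -c'E.
- move=> c; rewrite sumE => -[c0 c0'] [i|j]; first exact: ib c0 i.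
  exact: id c0' j.
Qed.

Lemma zero_basis : @vbasis K E (zero_fgproj L) void (fun x => match x with end)
  (fun x => match x with end).
Proof.
split=> [[]|y|c _ []]; exists (fun=> 0); rewrite big1; last by case.
by apply/rowP => -[].
Qed.

Section VertexModule.
Variable w : vertex E.

Definition vmod_pred : {pred L^o} := fun x : L => x * lv w == x.

Fact vmod_submod : submod_closed vmod_pred.
Proof.
split=> [|a x y]; first by rewrite unfold_in mul0r.
rewrite !unfold_in => /eqP xw /eqP yw.
by rewrite -[a *: x]/(a * (x : L)) mulrDl -mulrA xw yw.
Qed.
HB.instance Definition _ := GRing.isSubmodClosed.Build L L^o vmod_pred vmod_submod.

Record vmod := Vmod { vmod_val : L^o; _ : vmod_val \in vmod_pred }.
HB.instance Definition _ := [isSub for vmod_val].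
HB.instance Definition _ := [Choice of vmod by <:].
HB.instance Definition _ := [SubChoice_isSubLmodule of vmod by <:].

Fact vmod_gen_subproof : lv w \in vmod_pred.
Proof. by rewrite unfold_in lvv. Qed.
Definition vmod_gen : vmod := Vmod vmod_gen_subproof.

Lemma vmodE (x : vmod) : x = (val x : L) *: vmod_gen.
Proof. by apply: val_inj; case: x => x /= /eqP xw; rewrite -[RHS]/(x * lv w). Qed.

Lemma vmod_fg : finitely_generated vmod.
Proof. by exists 1%N, (fun=> vmod_gen) => x; exists (fun=> val x); rewrite big_ord1 -vmodE. Qed.

Lemma vmod_proj : projective vmod.
Proof.
move=> M N f g fsurj; have [m mE] := fsurj (g vmod_gen).
have [h hE] : exists h : {linear vmod -> M}, h =1 fun x => (val x : L) *: m.
  by apply: linear_exists => a x y; rewrite -[val _]/(a * val x + val y) scalerDl scalerA.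
by exists h => x; rewrite hE linearZ /= mE -linearZ /= -vmodE.
Qed.

Definition vproj : fgproj L := FGProj vmod_fg vmod_proj.

Lemma vproj_basis : @vbasis K E vproj unit (fun=> w) (fun=> vmod_gen).
Proof.
split=> [_|y|c c0 []].
- by apply: val_inj; rewrite -[LHS]/(lv w * lv w) lvv.
- by exists (fun=> val y); rewrite (big_pred1 tt) => [|[]//]; exact: vmodE.
- by move: c0; rewrite (big_pred1 tt) => [/(congr1 val)|[]].
Qed.

End VertexModule.

(** Additivity of a morphism is given for binary sums [dsum] only; this iterated sum carries it over
    to arbitrary bases. *)
Fixpoint vsum n : ('I_n -> vertex E) -> fgproj L :=
  if n is m.+1 then fun s => dsum (vproj (s ord0)) (vsum (s \o lift ord0))
  else fun=> zero_fgproj L.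

Lemma vsum_basis n (s : 'I_n -> vertex E) :
  exists b : 'I_n -> vsum s, vbasis s b.
Proof.
elim: n s => [|n IH] s.
  exists (fun=> 0); split=> [[]//|y|c _ []//].
  by exists (fun=> 0); rewrite big_ord0; apply/rowP => -[].
have [b bb] := IH (s \o lift ord0).
have := dsum_basis (vproj_basis (s ord0)) bb.
pose h (i : 'I_n.+1) : unit + 'I_n := if unlift ord0 i is Some j then inr j else inl tt.
have hb : bijective h.
  exists (fun x => match x with inl _ => ord0 | inr j => lift ord0 j end).
    by move=> i; rewrite /h; case: unliftP.
  by move=> [[]|j]; rewrite /h ?unlift_none ?liftK.
move=> /(basis_reindex hb)/= [tb gb ib].
eexists; split; [move=> i; have := tb i|exact: gb|move=> c c0 i; have := ib c c0 i].
  by rewrite /= /h; case: unliftP => [j ->|->].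
by rewrite /= /h; case: unliftP => [j ->|->].
Qed.

End Modules.

(** * Morphisms from V(R) *)

Section MonoidHoms.
Variables (A : Type) (idx : A) (op : Monoid.com_law idx).

(* Monoid morphisms from V(R) to A. *)
Record vhom (R : pzRingType) (Phi : fgproj R -> A) : Prop := VHom {
  vhom_iso (P Q : fgproj R) : module_isomorphic P Q -> Phi P = Phi Q;
  vhom_dsum P Q : Phi (dsum P Q) = op (Phi P) (Phi Q);
  vhom_zero : Phi (zero_fgproj R) = idx }.

(* An injection of the monoid morphisms on V(S) into those on V(R) that preserves
   the value at the class of the ring. *)
Definition vhom_transfer (R S : pzRingType)
    (theta : (fgproj S -> A) -> fgproj R -> A) : Prop :=
  [/\ forall Phi, vhom Phi -> vhom (theta Phi),
      forall Phi, vhom Phi -> theta Phi (regular_fgproj R) = Phi (regular_fgproj S)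
    & forall Phi Psi, vhom Phi -> vhom Psi -> theta Phi =1 theta Psi -> Phi =1 Psi].

Definition vsol (E : graph) (c : A) (phi : vertex E -> A) : Prop :=
  compatible op phi /\ \big[op/idx]_v phi v = c.

Section Lpa.
Variables (K : fieldType) (E : graph).
Implicit Types (phi : vertex E -> A).
Local Notation L := (lpa K E).

(** The value is taken on a chosen basis; [vbasis_count] makes it independent of the choice when
    [phi] is compatible. *)
Definition vval phi (P : fgproj L) : A :=
  let h := cid (fgproj_basis P) in
  \big[op/idx]_(i : projT1 h) phi (projT1 (cid (projT2 h)) i).

Lemma vvalE phi (P : fgproj L) (I : finType) (s : I -> vertex E) (b : I -> P) :
  compatible op phi -> vbasis s b -> vval phi P = \big[op/idx]_i phi (s i).
Proof.
move=> cphi bb; rewrite /vval; case: cid => J /= h; case: cid => t /= [d dd].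
refine (vbasis_count bb dd cphi).
Qed.

Lemma basis_transport (P Q : lmodType L) (f : {linear P -> Q}) (I : finType)
    (s : I -> vertex E) (b : I -> P) :
  bijective f -> vbasis s b -> vbasis s (f \o b).
Proof.
move=> [g fK gK] [tb gb ib]; split=> [i|y|c c0].
- by rewrite /= -linearZ tb.
- have [c cE] := gb (g y); exists c; rewrite -[LHS]gK cE linear_sum.
  by apply: eq_bigr => i _; rewrite linearZ.
- apply: ib; apply: (can_inj fK); rewrite linear0 -[RHS]c0 linear_sum.
  by apply: eq_bigr => i _; rewrite linearZ.
Qed.

Lemma vval_vhom phi : compatible op phi -> vhom (vval phi).
Proof.
move=> cphi; split=> [P Q [f fb]|P Q|].
- have [I [s [b bb]]] := fgproj_basis P.
  by rewrite (vvalE cphi bb) (vvalE cphi (basis_transport fb bb)).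
- have [I [s [b bb]]] := fgproj_basis P; have [J [t [d dd]]] := fgproj_basis Q.
  rewrite (vvalE cphi (dsum_basis bb dd)) (vvalE cphi bb) (vvalE cphi dd).
  by rewrite big_sumType.
- by rewrite (vvalE cphi (zero_basis K E)) big1 // => -[].
Qed.

Lemma vval_regular phi : compatible op phi ->
  vval phi (regular_fgproj L) = \big[op/idx]_v phi v.
Proof.
move=> cphi.
exact: (@vvalE phi (regular_fgproj L) _ id (fun v => lv K v) cphi (vertices_basis K E)).
Qed.

Lemma vval_vproj phi v : compatible op phi -> vval phi (vproj K v) = phi v.
Proof. by move=> cphi; rewrite (vvalE cphi (vproj_basis K v)) (big_pred1 tt) => // -[]. Qed.

Lemma vhom_vsum (Phi : fgproj L -> A) n (t : 'I_n -> vertex E) : vhom Phi ->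
  Phi (vsum K t) = \big[op/idx]_i Phi (vproj K (t i)).
Proof.
move=> hPhi; elim: n t => [|n IH] t.
  by rewrite big_ord0 /=; exact: vhom_zero hPhi.
by rewrite big_ord_recl /= (vhom_dsum hPhi) IH.
Qed.

Lemma vhom_basis (Phi : fgproj L -> A) (P : fgproj L) (I : finType)
    (s : I -> vertex E) (b : I -> P) : vhom Phi -> vbasis s b ->
  Phi P = \big[op/idx]_i Phi (vproj K (s i)).
Proof.
move=> hPhi bb; have ev : bijective (@enum_val I xpredT) by exact: enum_val_bij.
have [d dd] := vsum_basis K (s \o @enum_val I xpredT).
rewrite (vhom_iso hPhi (basis_iso (basis_reindex ev bb) dd)).
rewrite (vhom_vsum _ hPhi) [RHS](reindex (@enum_val I xpredT)) //.
by case: ev => g gK Kg; exists g => x _; [exact: gK|exact: Kg].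
Qed.

(** [L v] has a basis with one element and, when v is not a sink, also the expansion of that basis,
    whose types are the ranges of the edges at v. *)
Lemma vhom_compatible (Phi : fgproj L -> A) : vhom Phi ->
  compatible op (fun v => Phi (vproj K v)).
Proof.
move=> hPhi v nsv.
rewrite (vhom_basis hPhi (exp_vbasis (vproj_basis K v))).
pose F (x : (unit * edge E) + unit) :=
  match x with inl (_, e) => Phi (vproj K (rng e)) | inr i => Phi (vproj K v) end.
rewrite (eq_bigr (fun x => F (val x))); last by move=> [[[i e]|i] xP].
by rewrite big_exp (big_pred1 tt) => [|[]//]; case: asboolP.
Qed.

Lemma vhom_vval (Phi : fgproj L -> A) : vhom Phi ->
  Phi =1 vval (fun v => Phi (vproj K v)).
Proof.
move=> hPhi P; have [I [s [b bb]]] := fgproj_basis P.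
by rewrite (vhom_basis hPhi bb) (vvalE (vhom_compatible hPhi) bb).
Qed.

End Lpa.

(** Morphisms from V(L) and compatible labellings determine each other through the values at the
    modules [L v], and [vval_regular] matches the class of the ring with the sum over all
    vertices. *)
Lemma vsol_transfer (K : fieldType) (E F : graph)
    (theta : (fgproj (lpa K F) -> A) -> fgproj (lpa K E) -> A) :
  vhom_transfer theta ->
  exists T : (vertex F -> A) -> vertex E -> A,
    (forall c phi, vsol c phi -> vsol c (T phi)) /\
    (forall c phi psi, vsol c phi -> vsol c psi -> T phi =1 T psi -> phi =1 psi).
Proof.
move=> [thom treg tinj]; exists (fun phi v => theta (vval phi) (vproj K v)).
split=> [c phi [cphi phic]|c phi psi [cphi _] [cpsi _] TE].
  have hphi := thom _ (vval_vhom K cphi); split; first exact: vhom_compatible.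
  rewrite -(vval_regular K (vhom_compatible hphi)) -(vhom_vval hphi) treg.
    by rewrite vval_regular.
  exact: vval_vhom.
move=> v; rewrite -(vval_vproj K v cphi) -(vval_vproj K v cpsi).
apply: tinj; [exact: vval_vhom|exact: vval_vhom|move=> P].
rewrite (vhom_vval (thom _ (vval_vhom K cphi))) (vhom_vval (thom _ (vval_vhom K cpsi))).
by congr (vval _ P); apply: funext.
Qed.

End MonoidHoms.

(* Restriction of scalars along f. *)
Definition twist (R S : pzRingType) (f : {rmorphism S -> R}) (M : lmodType R) : Type := M.

Section Twist.
Variables (R S : pzRingType) (f : {rmorphism S -> R}).

Section TwistModule.
Variable M : lmodType R.
Local Notation twist := (twist f).
HB.instance Definition _ := GRing.Zmodule.copy (twist M) M.
Definition twist_scale (a : S) (x : twist M) : twist M := f a *: (x : M).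
Fact twist_scaleA a b x : twist_scale a (twist_scale b x) = twist_scale (a * b) x.
Proof. by rewrite /twist_scale scalerA rmorphM. Qed.
Fact twist_scale1 : left_id 1 twist_scale.
Proof. by move=> x; rewrite /twist_scale rmorph1 scale1r. Qed.
Fact twist_scaleDr : right_distributive twist_scale +%R.
Proof. by move=> a x y; rewrite /twist_scale scalerDr. Qed.
Fact twist_scaleDl x : {morph twist_scale^~ x : a b / a + b}.
Proof. by move=> a b; rewrite /twist_scale rmorphD scalerDl. Qed.
HB.instance Definition _ := GRing.Zmodule_isLmodule.Build S (twist M)
  twist_scaleA twist_scale1 twist_scaleDr twist_scaleDl.
End TwistModule.

Lemma twistZ (M : lmodType R) a (x : M) : a *: (x : twist f M) = f a *: x.
Proof. by []. Qed.

End Twist.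

Section TwistProjective.
Variables (R S : pzRingType) (f : {rmorphism S -> R}) (g : {rmorphism R -> S}).
Hypotheses (fK : cancel f g) (gK : cancel g f).

Lemma twist_fg (P : lmodType R) : finitely_generated P -> finitely_generated (twist f P).
Proof.
move=> [n [b bP]]; exists n, b => x; have [c cE] := bP x.
exists (g \o c); rewrite [LHS]cE; apply: eq_bigr => i _.
by rewrite twistZ /= gK.
Qed.

(** A lifting problem for the twisted module is carried back along [g] to one for [P], and the
    solution is twisted again. *)
Lemma twist_proj (P : lmodType R) : projective P -> projective (twist f P).
Proof.
move=> pP M N p q psurj.
have [p' p'E] : exists p' : {linear twist g M -> twist g N}, p' =1 p.
  by apply: linear_exists => a x y; rewrite linearD; congr (_ + _); exact: (linearZ_LR p (g a) x).
have [q' q'E] : exists q' : {linear P -> twist g N}, q' =1 q.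
  apply: linear_exists => a x y; rewrite linearD; congr (_ + _).
  by rewrite twistZ -linearZ; congr (q _); rewrite twistZ gK.
have [|h hE] := pP (twist g M) (twist g N) p' q'.
  by move=> y; have [x <-] := psurj y; exists x; rewrite p'E.
have [h' h'E] : exists h' : {linear twist f P -> M}, h' =1 h.
  apply: linear_exists => a x y; rewrite linearD; congr (_ + _).
  by rewrite twistZ linearZ /= twistZ fK.
by exists h' => x; rewrite h'E -p'E hE q'E.
Qed.

Definition twist_fgproj (P : fgproj R) : fgproj S :=
  FGProj (twist_fg (fgproj_fg P)) (twist_proj (fgproj_proj (f := P))).

End TwistProjective.

Lemma ring_isomorphicP (R S : pzRingType) : ring_isomorphic R S ->
  exists (f : {rmorphism S -> R}) (g : {rmorphism R -> S}), cancel f g /\ cancel g f.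
Proof.
move=> [g [f gK fK]].
have [||f' f'E] := @rmorph_exists _ _ f.
- by move=> x y; apply: (can_inj gK); rewrite rmorphB !fK.
- by split=> [|x y]; apply: (can_inj gK); rewrite ?rmorph1 ?rmorphM !fK.
by exists f', g; split=> x; rewrite f'E.
Qed.

Lemma ring_iso_sym (R S : pzRingType) : ring_isomorphic R S -> ring_isomorphic S R.
Proof. by move=> /ring_isomorphicP[f [g [fK gK]]]; exists f; exists g. Qed.

Lemma ring_iso_refl (R : pzRingType) : ring_isomorphic R R.
Proof. by exists idfun; exists id. Qed.

Lemma ring_iso_trans (R S T : pzRingType) :
  ring_isomorphic R S -> ring_isomorphic S T -> ring_isomorphic R T.
Proof. by move=> [f fb] [g gb]; exists (g \o f); exact: bij_comp. Qed.

Section TwistTransfer.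
Variables (R S : pzRingType) (f : {rmorphism S -> R}) (g : {rmorphism R -> S}).
Hypotheses (fK : cancel f g) (gK : cancel g f).
Local Notation tw := (twist_fgproj fK gK).
Local Notation tw' := (twist_fgproj gK fK).

Lemma twist_iso (P Q : fgproj R) :
  module_isomorphic P Q -> module_isomorphic (tw P) (tw Q).
Proof.
move=> [h hb]; apply: (@linear_bij _ _ _ (h : tw P -> tw Q)) => // a x y.
by rewrite linearD; congr (_ + _); exact: (linearZ_LR h (f a) x).
Qed.

Lemma twist_dsum (P Q : fgproj R) :
  module_isomorphic (tw (dsum P Q)) (dsum (tw P) (tw Q)).
Proof.
apply: (@linear_bij _ _ _ (fun x : tw (dsum P Q) => x : dsum (tw P) (tw Q))) => //.
by exists id.
Qed.

Lemma twist_zero : module_isomorphic (tw (zero_fgproj R)) (zero_fgproj S).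
Proof.
apply: (@linear_bij _ _ _ (fun _ : tw (zero_fgproj R) => 0 : zero_fgproj S)).
  by move=> a x y; rewrite scaler0 addr0.
by exists (fun=> 0 : 'rV[R]_0) => x; apply/rowP => -[].
Qed.

Lemma twist_regular : module_isomorphic (tw (regular_fgproj R)) (regular_fgproj S).
Proof.
apply: (@linear_bij _ _ _ (fun x : tw (regular_fgproj R) => g (x : R) : regular_fgproj S)).
  move=> a x y; rewrite rmorphD; congr (_ + _).
  by rewrite -[a *: x]/(f a * (x : R)) rmorphM fK.
by exists (fun x => f (x : S)) => x; [exact: gK|exact: fK].
Qed.

Lemma twistK (Q : fgproj S) : module_isomorphic (tw (tw' Q)) Q.
Proof.
apply: (@linear_bij _ _ _ (fun x : tw (tw' Q) => x : Q)); last by exists id.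
by move=> a x y; congr (_ + _); rewrite twistZ twistZ fK.
Qed.

Lemma twist_transfer (A : Type) (idx : A) (op : Monoid.com_law idx) :
  vhom_transfer op (fun (Phi : fgproj S -> A) P => Phi (tw P)).
Proof.
split=> [Phi hPhi|Phi hPhi|Phi Psi hPhi hPsi PP Q].
- split=> [P Q PQ|P Q|].
  + exact/(vhom_iso hPhi)/twist_iso.
  + by rewrite (vhom_iso hPhi (twist_dsum P Q)) (vhom_dsum hPhi).
  + by rewrite (vhom_iso hPhi twist_zero) (vhom_zero hPhi).
- exact/(vhom_iso hPhi)/twist_regular.
- by rewrite -(vhom_iso hPhi (twistK Q)) -(vhom_iso hPsi (twistK Q)).
Qed.

Definition V_twist (a : V_monoid R) : V_monoid S := V_class (tw (class_repr a)).

Lemma V_twistE P : V_twist (V_class P) = V_class (tw P).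
Proof. by apply/V_classP/twist_iso/V_classP; exact: class_reprK. Qed.

Lemma V_twistD : {morph V_twist : a b / V_add a b}.
Proof.
elim/V_ind=> P; elim/V_ind=> Q; rewrite -V_classD !V_twistE -V_classD.
exact/V_classP/twist_dsum.
Qed.

Definition K0_twist (x : K0 R) : K0 S :=
  K0_diff (V_twist (class_repr x).1) (V_twist (class_repr x).2).

Lemma K0_twistE a b : K0_twist (K0_diff a b) = K0_diff (V_twist a) (V_twist b).
Proof.
have /K0_diffP[t e] : K0_diff (class_repr (K0_diff a b)).1
    (class_repr (K0_diff a b)).2 = K0_diff a b.
  by rewrite -[RHS]class_reprK /K0_diff -surjective_pairing.
by apply/K0_diffP; exists (V_twist t); rewrite -!V_twistD e.
Qed.

Lemma K0_twistD : {morph K0_twist : x y / K0_add x y}.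
Proof.
elim/K0_ind=> a b; elim/K0_ind=> c d.
by rewrite K0_diffD !K0_twistE K0_diffD !V_twistD.
Qed.

End TwistTransfer.

Lemma iso_pointed_K0 (R S : pzRingType) : ring_isomorphic R S -> pointed_K0_isomorphic R S.
Proof.
move=> /ring_isomorphicP[f [g [fK gK]]]; exists (K0_twist fK gK); split.
- have tK (R' S' : pzRingType) (f' : {rmorphism S' -> R'}) (g' : {rmorphism R' -> S'})
      (fK' : cancel f' g') (gK' : cancel g' f') :
      cancel (K0_twist gK' fK') (K0_twist fK' gK').
    elim/K0_ind; elim/V_ind=> P; elim/V_ind=> Q; rewrite !K0_twistE !V_twistE.
    by congr K0_diff; apply/V_classP; apply: twistK.
  by exists (K0_twist gK fK); exact: tK.
- exact: K0_twistD.
rewrite /K0_one /K0_class K0_twistE !V_twistE.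
by congr K0_diff; apply/V_classP; [exact: twist_regular|exact: twist_zero].
Qed.

Lemma iso_transfer (R S : pzRingType) (A : Type) (idx : A) (op : Monoid.com_law idx) :
  ring_isomorphic R S -> exists theta, @vhom_transfer A idx op R S theta.
Proof. by move=> /ring_isomorphicP[f [g [fK gK]]]; eexists; exact: (twist_transfer fK gK). Qed.

(** * Morphisms into groups and K_0 *)

Section K0Transfer.
Variables (A : Type) (idx : A) (op : Monoid.com_law idx) (inv : A -> A).
Hypothesis opV : forall a, op a (inv a) = idx.

Let opAC a b c : op (op a b) c = op (op a c) b.
Proof. exact: Monoid.mulmAC. Qed.

Let opACA a b c d : op (op a b) (op c d) = op (op a c) (op b d).
Proof. exact: Monoid.mulmACA. Qed.

Lemma opK x c : op (op x c) (inv c) = x.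
Proof.
rewrite -Monoid.mulmA; apply: etrans (congr1 (op x) (opV c)) _.
by rewrite Monoid.mulm1.
Qed.

Lemma op_cancel a b c : op a c = op b c -> a = b.
Proof. by move=> /(congr1 (op^~ (inv c))); rewrite !opK. Qed.

Section OneRing.
Variables (R : pzRingType) (Phi : fgproj R -> A).
Hypothesis hPhi : vhom op Phi.

Definition V_val (a : V_monoid R) : A := Phi (class_repr a).
Definition K0_val (x : K0 R) : A :=
  op (V_val (class_repr x).1) (inv (V_val (class_repr x).2)).

Lemma V_valE P : V_val (V_class P) = Phi P.
Proof. by apply: (vhom_iso hPhi); apply/V_classP; exact: class_reprK. Qed.

Lemma V_valD a b : V_val (V_add a b) = op (V_val a) (V_val b).
Proof.
move: a b; elim/V_ind=> P; elim/V_ind=> Q.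
by rewrite -V_classD !V_valE (vhom_dsum hPhi).
Qed.

Lemma K0_valE a b : op (K0_val (K0_diff a b)) (V_val b) = V_val a.
Proof.
have /K0_diffP[t e] : K0_diff (class_repr (K0_diff a b)).1
    (class_repr (K0_diff a b)).2 = K0_diff a b.
  by rewrite -[RHS]class_reprK /K0_diff -surjective_pairing.
have {e} := congr1 V_val e; rewrite !V_valD => /op_cancel e.
by rewrite /K0_val opAC e opK.
Qed.

Lemma K0_valD : {morph K0_val : x y / K0_add x y >-> op x y}.
Proof.
elim/K0_ind=> a b; elim/K0_ind=> c d; rewrite K0_diffD.
apply: (@op_cancel _ _ (V_val (V_add b d))); rewrite K0_valE !V_valD.
by rewrite opACA !K0_valE.
Qed.

Lemma K0_val_class P : K0_val (K0_class P) = Phi P.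
Proof.
have := K0_valE (V_class P) (V_class (zero_fgproj R)).
by rewrite !V_valE (vhom_zero hPhi) Monoid.mulm1.
Qed.

End OneRing.

(** A morphism into a group factors through K_0 and can be composed with [f]. It can be recovered
    since [f] is onto: the class of Q is the image of some difference [P] - [P'], and the values at
    P and P' determine the value at Q. *)
Lemma K0_transfer (R S : pzRingType) : pointed_K0_isomorphic R S ->
  exists theta, @vhom_transfer A idx op R S theta.
Proof.
move=> [f [[f' fK f'K] fD f1]].
exists (fun Phi P => K0_val Phi (f (K0_class P))).
split=> [Phi hPhi|Phi hPhi|Phi Psi hPhi hPsi PP Q].
- split=> [P Q /V_classP PQ|P Q|]; first by rewrite /K0_class PQ.
    by rewrite K0_classD fD K0_valD.
  (* [f] is only given as additive: the value at the image of zero is idempotent, hence neutral in a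
     group. *)
  set x := K0_val _ _; apply: (@op_cancel _ _ x); rewrite Monoid.mul1m /x.
  by rewrite -K0_valD // -fD K0_add0.
- by rewrite -[K0_class _]/(K0_one R) f1 K0_val_class.
have xE (X : fgproj S -> A) x : vhom op X ->
    exists P P', forall X, vhom op X ->
      op (K0_val X (f x)) (K0_val X (f (K0_class P'))) = K0_val X (f (K0_class P)).
  move=> _; elim/K0_ind: x; elim/V_ind=> P; elim/V_ind=> P'; exists P, P' => Y hY.
  rewrite -K0_valD // -fD; congr (K0_val _ (f _)).
  rewrite /K0_class K0_diffD; apply/K0_diffP; exists (V_class (zero_fgproj R)).
  by congr V_add; rewrite V_addA.
have [P [P' h]] := xE _ (f' (K0_class Q)) hPhi.
have h1 := h _ hPhi; have h2 := h _ hPsi.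
rewrite f'K !K0_val_class // in h1 h2.
by apply: (@op_cancel _ _ (K0_val Psi (f (K0_class P')))); rewrite h2 -{1}PP h1 PP.
Qed.

End K0Transfer.

(** * Moves on graphs *)

Section RelationGraph.
Variables (K : fieldType) (V : finType) (r : rel V).
Implicit Types (i j k l : V).

Definition rel_graph : graph :=
  @Graph V {ij : V * V | r ij.1 ij.2} (fun e => (val e).1) (fun e => (val e).2).
Local Notation L := (lpa K rel_graph).

Definition rv i : L := lv K (i : vertex rel_graph).
(** A graph without parallel edges is a relation, so edges are indexed by pairs; with the value 0
    off [r], the source and range identities hold without side condition. *)
Definition re : V -> V -> L := locked (fun i j =>
  if insub (i, j) is Some e then le K (e : edge rel_graph) else 0).
Definition rg : V -> V -> L := locked (fun i j =>
  if insub (i, j) is Some e then lg K (e : edge rel_graph) else 0).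

Lemma reE (e : edge rel_graph) : le K e = re (val e).1 (val e).2.
Proof. by rewrite /re -lock -surjective_pairing valK. Qed.
Lemma rgE (e : edge rel_graph) : lg K e = rg (val e).1 (val e).2.
Proof. by rewrite /rg -lock -surjective_pairing valK. Qed.

Lemma sum_out (W : zmodType) i (F : V -> V -> W) :
  \sum_(e : edge rel_graph | src e == i) F (val e).1 (val e).2 = \sum_(j | r i j) F i j.
Proof.
pose G (x : V * V) := if x.1 == i then F x.1 x.2 else 0.
rewrite big_mkcond -/(\sum_(e : {ij : V * V | r ij.1 ij.2}) G (val e)).
rewrite -(@big_sub _ _ _ _ (fun ij : V * V => r ij.1 ij.2) G).
rewrite (eq_bigl (fun x : V * V => true && r x.1 x.2)) //.
rewrite (eq_bigr (fun x : V * V => G (x.1, x.2))); last by move=> [].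
rewrite -(pair_big_dep xpredT r (fun k l => G (k, l))) /= (bigD1 i) //=.
rewrite [X in _ + X]big1 ?addr0 => [|k /negPf ki]; last first.
  by apply: big1 => l _; rewrite /G /= ki.
by apply: eq_bigr => l _; rewrite /G /= eqxx.
Qed.

Lemma rv_sum : \sum_i rv i = 1.
Proof. exact: (lv_sum K rel_graph). Qed.

Lemma rv_mul i j : rv i * rv j = rv i *+ (i == j).
Proof. exact: (@lv_mul K rel_graph i j). Qed.

Lemma rvv i : rv i * rv i = rv i.
Proof. exact: (@lvv K rel_graph i). Qed.

Lemma rv_neq i j : i != j -> rv i * rv j = 0.
Proof. exact: (@lv_neq K rel_graph i j). Qed.

Lemma rv_re i j : rv i * re i j = re i j.
Proof.
rewrite /re -lock; case: insubP => [e _ eE|]; last by rewrite mulr0.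
by have := lv_le K (e : edge rel_graph); rewrite /= eE.
Qed.

Lemma re_rv i j : re i j * rv j = re i j.
Proof.
rewrite /re -lock; case: insubP => [e _ eE|]; last by rewrite mul0r.
by have := le_lv K (e : edge rel_graph); rewrite /= eE.
Qed.

Lemma rv_rg i j : rv j * rg i j = rg i j.
Proof.
rewrite /rg -lock; case: insubP => [e _ eE|]; last by rewrite mulr0.
by have := lv_lg K (e : edge rel_graph); rewrite /= eE.
Qed.

Lemma rg_rv i j : rg i j * rv i = rg i j.
Proof.
rewrite /rg -lock; case: insubP => [e _ eE|]; last by rewrite mul0r.
by have := lg_lv K (e : edge rel_graph); rewrite /= eE.
Qed.

Lemma rg_re i j k l : rg i j * re k l = rv j *+ (r i j && ((i, j) == (k, l))).
Proof.
rewrite /rg /re -!lock; case: insubP => [e re eE|/= /negPf ->]; last by rewrite mul0r.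
case: insubP => [f rf fE|nr]; last first.
  by rewrite mulr0; case: eqP => [[ik jl]|]; rewrite ?andbF //; move: nr; rewrite -ik -jl re.
rewrite lg_le -eE -fE -val_eqE /= re; case: eqP => [ef|] //=.
by rewrite eE.
Qed.

Lemma rg_reE i j : r i j -> rg i j * re i j = rv j.
Proof. by move=> rij; rewrite rg_re rij eqxx. Qed.

Lemma rg_reN i j k l : (i, j) != (k, l) -> rg i j * re k l = 0.
Proof. by move=> /negPf ne; rewrite rg_re ne andbF. Qed.

Lemma rel_sink i : (exists j, r i j) -> ~ sink (i : vertex rel_graph).
Proof. by move=> [j rij] /(_ (exist _ (i, j) rij : edge rel_graph)). Qed.

Lemma rv_CK2 i : (exists j, r i j) -> rv i = \sum_(j | r i j) re i j * rg i j.
Proof.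
move=> /rel_sink ni; rewrite /rv (lv_CK2 K ni).
rewrite -(sum_out i (fun i j => re i j * rg i j)).
by apply: eq_bigr => e _; rewrite reE rgE.
Qed.

Record rel_family (S : pzRingType) (fv : V -> S) (fe fg : V -> V -> S) : Prop := RelFamily {
  rf_unit : \sum_i fv i = 1;
  rf_vertex i j : fv i * fv j = fv i *+ (i == j);
  rf_src i j : r i j -> fv i * fe i j = fe i j;
  rf_rng i j : r i j -> fe i j * fv j = fe i j;
  rf_grng i j : r i j -> fv j * fg i j = fg i j;
  rf_gsrc i j : r i j -> fg i j * fv i = fg i j;
  rf_CK1 i j k l : r i j -> r k l -> fg i j * fe k l = fv j *+ ((i, j) == (k, l));
  rf_CK2 i : (exists j, r i j) -> fv i = \sum_(j | r i j) fe i j * fg i j }.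

Lemma rel_lift (S : pzRingType) (kap : {rmorphism K -> S}) fv fe fg :
  (forall c y, kap c * y = y * kap c) -> rel_family fv fe fg ->
  exists g : {rmorphism L -> S},
    [/\ forall i, g (rv i) = fv i, forall i j, r i j -> g (re i j) = fe i j,
        forall i j, r i j -> g (rg i j) = fg i j & forall c, g (lc _ c) = kap c].
Proof.
move=> kapC fam.
have [|g [gv ge gg gc]] := @lpa_lift K rel_graph S kap fv
    (fun e => fe (val e).1 (val e).2) (fun e => fg (val e).1 (val e).2) kapC.
  case: fam => f1 f2 f3 f4 f5 f6 f7 f8; split=> //=.
  - by move=> e; apply: f3; exact: (valP e).
  - by move=> e; apply: f4; exact: (valP e).
  - by move=> e; apply: f5; exact: (valP e).
  - by move=> e; apply: f6; exact: (valP e).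
  - move=> e f; rewrite f7; [|exact: (valP e)|exact: (valP f)].
    by rewrite -!surjective_pairing -val_eqE.
  - move=> i ni; rewrite f8.
      by rewrite -(sum_out i (fun i j => fe i j * fg i j)).
    apply: contrapT => no; apply: ni => e ei; apply: no.
    by exists (val e).2; have := valP e; rewrite -[(val e).1]/(src e) ei.
exists g; split=> [i|i j rij|i j rij|c]; last exact: gc.
- exact: (gv i).
- by rewrite /re -lock insubT /= ge.
- by rewrite /rg -lock insubT /= gg.
Qed.

Lemma rel_hom_ext (S : pzRingType) (g h : {rmorphism L -> S}) :
  (forall c, g (lc _ c) = h (lc _ c)) -> (forall i, g (rv i) = h (rv i)) ->
  (forall i j, r i j -> g (re i j) = h (re i j)) ->
  (forall i j, r i j -> g (rg i j) = h (rg i j)) -> g =1 h.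
Proof.
move=> gc gv ge gg; apply: lpa_hom_ext => // e.
  by rewrite reE; apply: ge; exact: (valP e).
by rewrite rgE; apply: gg; exact: (valP e).
Qed.

End RelationGraph.

Section RelationIso.
Variables (K : fieldType) (V W : finType) (r : rel V) (t : rel W).
Local Notation L := (lpa K (rel_graph r)).
Local Notation M := (lpa K (rel_graph t)).

(** [g] and [h] come from the two families by the universal property; it remains to see that each of
    them maps the family defining the other back to the generators. *)
Lemma rel_iso (fv : V -> M) (fe fg : V -> V -> M) (hv : W -> L) (he hg : W -> W -> L) :
  rel_family r fv fe fg -> rel_family t hv he hg ->
  (forall (g : {rmorphism L -> M}) (h : {rmorphism M -> L}),
    [/\ forall i, g (rv K r i) = fv i, forall i j, r i j -> g (re K r i j) = fe i j
      & forall i j, r i j -> g (rg K r i j) = fg i j] ->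
    [/\ forall i, h (rv K t i) = hv i, forall i j, t i j -> h (re K t i j) = he i j
      & forall i j, t i j -> h (rg K t i j) = hg i j] ->
    [/\ forall i, h (fv i) = rv K r i, forall i j, r i j -> h (fe i j) = re K r i j
      & forall i j, r i j -> h (fg i j) = rg K r i j] /\
    [/\ forall i, g (hv i) = rv K t i, forall i j, t i j -> g (he i j) = re K t i j
      & forall i j, t i j -> g (hg i j) = rg K t i j]) ->
  ring_isomorphic L M.
Proof.
move=> ff fh H.
have [g [gv ge gg gc]] := rel_lift (@lcC K _) ff.
have [h [kv ke kg kc]] := rel_lift (@lcC K _) fh.
have [[a1 a2 a3] [b1 b2 b3]] := H g h (And3 gv ge gg) (And3 kv ke kg).
exists g; exists h.
  have := @rel_hom_ext K V r _ (h \o g) idfun; apply=> [c|i|i j rij|i j rij] /=.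
  - by rewrite gc kc.
  - by rewrite gv a1.
  - by rewrite ge ?a2.
  - by rewrite gg ?a3.
have := @rel_hom_ext K W t _ (g \o h) idfun; apply=> [c|i|i j tij|i j tij] /=.
- by rewrite kc gc.
- by rewrite kv b1.
- by rewrite ke ?b2.
- by rewrite kg ?b3.
Qed.

End RelationIso.

Lemma graph_iso (K : fieldType) (E F : graph) (fv : vertex E -> vertex F)
    (fe : edge E -> edge F) : bijective fv -> bijective fe ->
  (forall e, src (fe e) = fv (src e)) -> (forall e, rng (fe e) = fv (rng e)) ->
  ring_isomorphic (lpa K E) (lpa K F).
Proof.
move=> [fv' fvK fvK'] [fe' feK feK'] fs fr.
have fs' e : src (fe' e) = fv' (src e) by rewrite -{2}[e]feK' fs fvK.
have fr' e : rng (fe' e) = fv' (rng e) by rewrite -{2}[e]feK' fr fvK.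
have fam (E' F' : graph) (gv : vertex E' -> vertex F') (ge : edge E' -> edge F') gv' ge' :
    cancel gv gv' -> cancel gv' gv -> cancel ge ge' -> cancel ge' ge ->
    (forall e, src (ge e) = gv (src e)) -> (forall e, rng (ge e) = gv (rng e)) ->
    lpa_family (fun v => lv K (gv v)) (fun e => le K (ge e)) (fun e => lg K (ge e)).
  move=> vK vK' eK eK' gs gr; split.
  - rewrite -(lv_sum K F') [RHS](reindex gv) //; exists gv' => x _; [exact: vK|exact: vK'].
  - by move=> v w; rewrite lv_mul (can_eq vK).
  - by move=> e; rewrite -gs lv_le.
  - by move=> e; rewrite -gr le_lv.
  - by move=> e; rewrite -gr lv_lg.
  - by move=> e; rewrite -gs lg_lv.
  - by move=> e f; rewrite lg_le (can_eq eK) gr.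
  - move=> v nv; rewrite lv_CK2 => [|sv].
      rewrite (reindex ge) /=; last by exists ge' => x _; [exact: eK|exact: eK'].
      by apply: eq_bigl => e; rewrite gs (can_eq vK).
    by apply: nv => e ev; apply: (sv (ge e)); rewrite gs ev.
have [g [gv ge gg gc]] := lpa_lift (@lcC K F) (fam _ _ _ _ _ _ fvK fvK' feK feK' fs fr).
have [h [hv he hg hc]] := lpa_lift (@lcC K E) (fam _ _ _ _ _ _ fvK' fvK feK' feK fs' fr').
apply: (lpa_iso_of_homs (g := g) (h := h)) => // x.
- by rewrite gv hv fvK.
- by rewrite ge he feK.
- by rewrite gg hg feK.
- by rewrite hv gv fvK'.
- by rewrite he ge feK'.
- by rewrite hg gg feK'.
Qed.

Section ShiftMove.
Variables (K : fieldType) (V : finType) (r : rel V) (v w : V).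
Hypotheses (vw : v != w) (wout : exists j, r w j) (rwv : forall j, r w j -> r v j).
Hypothesis sing : r v w -> r w w.

(* The edges from v parallel to those from w are replaced by one edge from v to w. *)
Definition shift_rel : rel V := fun i j =>
  if i == v then (r v j && ~~ r w j) || (j == w) else r i j.
Local Notation t := shift_rel.

Let wv : (w == v) = false. Proof. by rewrite eq_sym (negPf vw). Qed.
Let tw j : t w j = r w j. Proof. by rewrite /t wv. Qed.
Let tvw : t v w. Proof. by rewrite /t !eqxx orbT. Qed.

(** An old edge from [v] to an out-neighbour [j] of [w] becomes the path v, w, j. Conversely the new
    edge from [v] to [w] is a sum of products [re v k * rg w k], a partial isometry between the
    vertex [w] and the part of [v] carried by the removed edges. *)
Let fe i j := if (i == v) && r w j then re K t v w * re K t w j else re K t i j.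
Let fg i j := if (i == v) && r w j then rg K t w j * rg K t v w else rg K t i j.
Let he i j := if (i == v) && (j == w)
  then \sum_(k | r w k) re K r v k * rg K r w k else re K r i j.
Let hg i j := if (i == v) && (j == w)
  then \sum_(k | r w k) re K r w k * rg K r v k else rg K r i j.

(** By [sing] an edge from [v] to [w] is among the removed ones, so that the new edge has no
    parallel one. *)
Let not_vw i j : r i j -> (i == v) && r w j = false -> (i, j) != (v, w).
Proof.
move=> rij; apply: contraFneq => -[iv jw]; subst i j.
by rewrite eqxx sing.
Qed.

Let keep i j : r i j -> (i == v) && r w j = false -> t i j.
Proof. by move=> rij; rewrite /t; case: eqP => [iv /= ->|//]; rewrite -iv rij. Qed.

Let kept i j : t i j -> (i == v) && (j == w) = false ->
  r i j /\ ((i == v) && r w j = false).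
Proof.
rewrite /t; case: eqP => [->|//] /= + jw; rewrite jw orbF => /andP[-> /negPf ->].
by [].
Qed.

Lemma shift_fam : rel_family r (rv K t) fe fg.
Proof.
split=> [|i j|i j rij|i j rij|i j rij|i j rij|i j k l rij rkl|i [j0 rij0]].
- exact: rv_sum.
- exact: rv_mul.
- by rewrite /fe; case: ifP => [/andP[/eqP -> _]|_]; rewrite ?mulrA rv_re.
- by rewrite /fe; case: ifP => _; rewrite -?mulrA re_rv.
- by rewrite /fg; case: ifP => _; rewrite ?mulrA rv_rg.
- by rewrite /fg; case: ifP => [/andP[/eqP -> _]|_]; rewrite -?mulrA rg_rv.
- rewrite /fg /fe; case: ifP => A; case: ifP => B.
  + move: A B => /andP[/eqP -> rwj] /andP[/eqP -> rwl].
    rewrite !mulrA -(mulrA (rg K t w j)) rg_reE // rg_rv rg_re tw rwj /=.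
    by rewrite !xpair_eqE !eqxx.
  + rewrite -mulrA rg_reN ?mulr0; last by rewrite eq_sym; exact: not_vw.
    case: eqP => // -[ik jl]; subst k l; by rewrite A in B.
  + rewrite mulrA rg_reN ?mul0r; last exact: not_vw.
    case: eqP => // -[ik jl]; subst k l; by rewrite A in B.
  + by rewrite rg_re keep.
have [->|iv] := eqVneq i v; last first.
  rewrite rv_CK2; last by exists j0; rewrite /t (negPf iv).
  rewrite (eq_bigl (r i)) => [|j]; last by rewrite /t (negPf iv).
  by apply: eq_bigr => j _; rewrite /fe /fg (negPf iv).
rewrite rv_CK2; last by exists w.
rewrite (bigD1 w) //= [RHS](bigID (r w)) /=; congr (_ + _).
  rewrite [RHS](eq_bigl (r w)) => [|j]; last first.
    by case: (boolP (r w j)) => [/rwv ->|]; rewrite ?andbF.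
  rewrite [RHS](eq_bigr (fun j => re K t v w * (re K t w j * rg K t w j) * rg K t v w)).
    rewrite -mulr_suml -mulr_sumr -(eq_bigl _ _ tw) -rv_CK2 ?re_rv //.
    by case: wout => j rwj; exists j; rewrite tw.
  by move=> j rwj; rewrite /fe /fg eqxx rwj !mulrA.
rewrite (eq_bigl (fun j => r v j && ~~ r w j)) => [|j].
  by apply: eq_bigr => j /andP[_ /negPf rwj]; rewrite /fe /fg rwj andbF.
rewrite /t eqxx; case: (eqVneq j w) => [->|_]; last by rewrite orbF andbT.
by rewrite andbF; case: (boolP (r v w)) => // /sing ->.
Qed.

Let sum_eg :
  (\sum_(k | r w k) re K r w k * rg K r v k) * (\sum_(k | r w k) re K r v k * rg K r w k)
  = rv K r w.
Proof.
rewrite rv_CK2 // mulr_suml; apply: eq_bigr => k rwk.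
rewrite mulr_sumr (bigD1 k) //= big1 ?addr0 => [|l /andP[_ lk]].
  by rewrite !mulrA -(mulrA (re K r w k)) rg_reE ?rwv // re_rv.
rewrite !mulrA -(mulrA (re K r w k)) rg_reN ?mulr0 ?mul0r //.
by apply: contra lk => /eqP[->].
Qed.

Let sum_ge :
  (\sum_(k | r w k) re K r v k * rg K r w k) * (\sum_(k | r w k) re K r w k * rg K r v k)
  = \sum_(k | r w k) re K r v k * rg K r v k.
Proof.
rewrite mulr_suml; apply: eq_bigr => k rwk.
rewrite mulr_sumr (bigD1 k) //= big1 ?addr0 => [|l /andP[_ lk]].
  by rewrite !mulrA -(mulrA (re K r v k)) rg_reE // re_rv.
rewrite !mulrA -(mulrA (re K r v k)) rg_reN ?mulr0 ?mul0r //.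
by apply: contra lk => /eqP[->].
Qed.

Lemma shift_fam' : rel_family t (rv K r) he hg.
Proof.
split=> [|i j|i j tij|i j tij|i j tij|i j tij|i j k l tij tkl|i [j0 tij0]].
- exact: rv_sum.
- exact: rv_mul.
- rewrite /he; case: ifP => [/andP[/eqP -> _]|_]; rewrite ?rv_re //.
  by rewrite mulr_sumr; apply: eq_bigr => k _; rewrite mulrA rv_re.
- rewrite /he; case: ifP => [/andP[_ /eqP ->]|_]; rewrite ?re_rv //.
  by rewrite mulr_suml; apply: eq_bigr => k _; rewrite -mulrA rg_rv.
- rewrite /hg; case: ifP => [/andP[_ /eqP ->]|_]; rewrite ?rv_rg //.
  by rewrite mulr_sumr; apply: eq_bigr => k _; rewrite mulrA rv_re.
- rewrite /hg; case: ifP => [/andP[/eqP -> _]|_]; rewrite ?rg_rv //.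
  by rewrite mulr_suml; apply: eq_bigr => k _; rewrite -mulrA rg_rv.
- rewrite /hg /he; case: ifP => A; case: ifP => B.
  + move: A B => /andP[/eqP -> /eqP ->] /andP[/eqP -> /eqP ->].
    by rewrite eqxx sum_eg.
  + have [rkl nkl] := kept tkl B.
    rewrite mulr_suml big1 => [|m rwm].
      case: eqP => // -[ik jl]; subst k l; by rewrite A in B.
    rewrite -mulrA rg_reN ?mulr0 //; apply: contraFneq nkl => -[<- <-].
    by rewrite eqxx.
  + have [rij nij] := kept tij A.
    rewrite mulr_sumr big1 => [|m rwm].
      case: eqP => // -[ik jl]; subst k l; by rewrite A in B.
    rewrite mulrA rg_reN ?mul0r //; apply: contraFneq nij => -[-> ->].
    by rewrite eqxx.
  + by have [rij _] := kept tij A; rewrite rg_re rij.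
have [iv|iv] := eqVneq i v; last first.
  have rij0 : r i j0 by move: tij0; rewrite /t (negPf iv).
  rewrite rv_CK2; last by exists j0.
  rewrite [RHS](eq_bigl (r i)) => [|j]; last by rewrite /t (negPf iv).
  by apply: eq_bigr => j _; rewrite /he /hg (negPf iv).
rewrite iv rv_CK2; last by case: wout => j /rwv; exists j.
rewrite [RHS](bigD1 w) //= (bigID (r w)) /=; congr (_ + _).
  rewrite /he /hg !eqxx /= sum_ge; apply: eq_bigl => j.
  by case: (boolP (r w j)) => [/rwv ->|]; rewrite ?andbF.
rewrite [RHS](eq_bigl (fun j => r v j && ~~ r w j)) => [|j]; last first.
  rewrite /t eqxx; case: (eqVneq j w) => [->|_]; last by rewrite orbF andbT.
  by rewrite andbF; case: (boolP (r v w)) => // /sing ->.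
apply: eq_bigr => j /andP[rvj nwj]; rewrite /he /hg eqxx /=.
by case: eqP => // jw; subst j; rewrite sing in nwj.
Qed.

Lemma shift_iso : ring_isomorphic (lpa K (rel_graph r)) (lpa K (rel_graph t)).
Proof.
apply: (rel_iso shift_fam shift_fam') => g h [gv ge gg] [kv ke kg].
have hf : h (re K t v w) = \sum_(k | r w k) re K r v k * rg K r w k.
  by rewrite ke // /he !eqxx.
have hfg : h (rg K t v w) = \sum_(k | r w k) re K r w k * rg K r v k.
  by rewrite kg // /hg !eqxx.
have hw j : r w j -> h (re K t w j) = re K r w j.
  by move=> rwj; rewrite ke ?tw // /he wv.
have hwg j : r w j -> h (rg K t w j) = rg K r w j.
  by move=> rwj; rewrite kg ?tw // /hg wv.
have gvj j : r w j -> g (re K r v j) = re K t v w * re K t w j.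
  by move=> rwj; rewrite ge ?rwv // /fe eqxx rwj.
have gvjg j : r w j -> g (rg K r v j) = rg K t w j * rg K t v w.
  by move=> rwj; rewrite gg ?rwv // /fg eqxx rwj.
have gw j : r w j -> g (re K r w j) = re K t w j.
  by move=> rwj; rewrite ge // /fe wv.
have gwg j : r w j -> g (rg K r w j) = rg K t w j.
  by move=> rwj; rewrite gg // /fg wv.
have tw_out : exists j, t w j by case: wout => j rwj; exists j; rewrite tw.
have sumw : \sum_(k | r w k) re K t w k * rg K t w k = rv K t w.
  by rewrite (rv_CK2 _ tw_out); apply: eq_bigl => j; rewrite tw.
split; split=> [i|i j rij|i j rij].
- by rewrite kv.
- rewrite /fe; case: ifP => [/andP[/eqP -> rwj]|nA].
    rewrite rmorphM hf hw // mulr_suml (bigD1 j) //= big1 ?addr0 => [|k /andP[_ kj]].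
      by rewrite -mulrA rg_reE // re_rv.
    by rewrite -mulrA rg_reN ?mulr0 //; apply: contra kj => /eqP[->].
  rewrite ke ?keep // /he; case: ifP => // /andP[/eqP iv /eqP jw].
  by have := not_vw rij nA; rewrite iv jw eqxx.
- rewrite /fg; case: ifP => [/andP[/eqP -> rwj]|nA].
    rewrite rmorphM hfg hwg // mulr_sumr (bigD1 j) //= big1 ?addr0 => [|k /andP[_ kj]].
      by rewrite mulrA rg_reE // rv_rg.
    by rewrite mulrA rg_reN ?mul0r //; apply: contra kj => /eqP[->].
  rewrite kg ?keep // /hg; case: ifP => // /andP[/eqP iv /eqP jw].
  by have := not_vw rij nA; rewrite iv jw eqxx.
- by rewrite gv.
- rewrite /he; case: ifP => [/andP[/eqP -> /eqP ->]|nA].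
    rewrite rmorph_sum (eq_bigr (fun k => re K t v w * (re K t w k * rg K t w k))).
      by rewrite -mulr_sumr sumw re_rv.
    by move=> k rwk; rewrite rmorphM gvj // gwg // mulrA.
  by have [rij' nij] := kept rij nA; rewrite ge // /fe nij.
- rewrite /hg; case: ifP => [/andP[/eqP -> /eqP ->]|nA].
    rewrite rmorph_sum (eq_bigr (fun k => (re K t w k * rg K t w k) * rg K t v w)).
      by rewrite -mulr_suml sumw rv_rg.
    by move=> k rwk; rewrite rmorphM gvjg // gw // mulrA.
  by have [rij' nij] := kept rij nA; rewrite gg // /fg nij.
Qed.

End ShiftMove.

Section OutSplit.
Variables (K : fieldType) (V : finType) (r : rel V) (v : V) (p : pred V).
Hypotheses (hP : exists j, r v j && p j) (hN : exists j, r v j && ~~ p j).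
Implicit Types (x y : option V) (i j : V).

(* The vertex v is split into Some v, which keeps the edges ending in p, and None,
   which keeps the others. *)
Definition split_rel : rel (option V) := fun x y =>
  if x is Some i then r i (odflt v y) && ((i != v) || p (odflt v y))
  else r v (odflt v y) && ~~ p (odflt v y).
Local Notation t := split_rel.
Local Notation base := (odflt v).

Let base_rel x y : t x y -> r (base x) (base y).
Proof. by case: x => [i|] /= /andP[]. Qed.

Let base_inj x y x' y' : t x y -> t x' y' -> base x = base x' -> base y = base y' -> x = x'.
Proof.
case: x x' => [i|] [i'|] //= + + + yy'; rewrite -yy'.
- by move=> _ _ ->.
- by move=> /andP[_ +] /andP[_ npy] iv; rewrite iv eqxx (negPf npy).
- by move=> /andP[_ npy] /andP[_ +] iv; rewrite -iv eqxx (negPf npy).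
Qed.

Let side x : pred V := fun j => if x is Some i then (i != v) || p j else ~~ p j.

Let tE x y : t x y = r (base x) (base y) && side x (base y).
Proof. by case: x. Qed.

(** The idempotent of [v] is cut into the sums of e e^* over the two classes of edges; these are the
    images of the two copies of [v]. *)
Let part (b : bool) : lpa K (rel_graph r) :=
  \sum_(j | r v j && (p j == b)) re K r v j * rg K r v j.

Let fv x := if x is Some i then if i == v then part true else rv K r i else part false.
Let fe x y := re K r (base x) (base y) * fv y.
Let fg x y := fv y * rg K r (base x) (base y).

Let vout : exists j, r v j. Proof. by case: hP => j /andP[]; exists j. Qed.

Let part_sum : part true + part false = rv K r v.
Proof.
rewrite (rv_CK2 K vout) (bigID p) /=; congr (_ + _); apply: eq_bigl => j;
by case: (p j); rewrite ?andbT ?andbF.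
Qed.

Let rv_part b : rv K r v * part b = part b.
Proof. by rewrite mulr_sumr; apply: eq_bigr => j _; rewrite mulrA rv_re. Qed.

Let part_rv b : part b * rv K r v = part b.
Proof. by rewrite mulr_suml; apply: eq_bigr => j _; rewrite -mulrA rg_rv. Qed.

Let part_re b j : r v j -> part b * re K r v j = re K r v j *+ (p j == b).
Proof.
move=> rvj; rewrite mulr_suml; case: eqP => [pj|npj].
  rewrite (bigD1 j) /=; last by rewrite rvj pj eqxx.
  rewrite big1 ?addr0 => [|k /andP[_ kj]]; first by rewrite -mulrA rg_reE // re_rv.
  by rewrite -mulrA rg_reN ?mulr0 //; apply: contra kj => /eqP[->].
rewrite big1 // => k /andP[_ /eqP pk].
rewrite -mulrA rg_reN ?mulr0 //; apply/eqP => -[kj].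
by apply: npj; rewrite -kj.
Qed.

Let rg_part b j : r v j -> rg K r v j * part b = rg K r v j *+ (p j == b).
Proof.
move=> rvj; rewrite mulr_sumr; case: eqP => [pj|npj].
  rewrite (bigD1 j) /=; last by rewrite rvj pj eqxx.
  rewrite big1 ?addr0 => [|k /andP[_ kj]]; first by rewrite mulrA rg_reE // rv_rg.
  by rewrite mulrA rg_reN ?mul0r // eq_sym; apply: contra kj => /eqP[->].
rewrite big1 // => k /andP[_ /eqP pk].
rewrite mulrA rg_reN ?mul0r //; apply/eqP => -[jk].
by apply: npj; rewrite jk.
Qed.

Let part_part b c : part b * part c = part b *+ (b == c).
Proof.
rewrite {1}/part mulr_suml; case: eqP => [<-|bc].
  apply: eq_bigr => j /andP[rvj pj]; by rewrite -mulrA rg_part // pj.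
rewrite big1 // => j /andP[rvj /eqP pj]; rewrite -mulrA rg_part // pj.
by case: eqP => // _; rewrite mulr0.
Qed.

Let rv_fv x : rv K r (base x) * fv x = fv x.
Proof.
case: x => [i|] /=; last exact: rv_part.
by case: eqP => [->|_]; [exact: rv_part|exact: rvv].
Qed.

Let fv_rv x : fv x * rv K r (base x) = fv x.
Proof.
case: x => [i|] /=; last exact: part_rv.
by case: eqP => [->|_]; [exact: part_rv|exact: rvv].
Qed.

Let fv_re x y : t x y -> fv x * re K r (base x) (base y) = re K r (base x) (base y).
Proof.
case: x => [i|] /=; last by case/andP=> rvy /negPf py; rewrite part_re // py.
case: eqP => [->|_] /andP[rvy] /=; last by rewrite rv_re.
by move=> py; rewrite part_re // py.
Qed.

Let rg_fv x y : t x y -> rg K r (base x) (base y) * fv x = rg K r (base x) (base y).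
Proof.
case: x => [i|] /=; last by case/andP=> rvy /negPf py; rewrite rg_part // py.
case: eqP => [->|_] /andP[rvy] /=; last by rewrite rg_rv.
by move=> py; rewrite rg_part // py.
Qed.

Let fv_fv x y : fv x * fv y = fv x *+ (x == y).
Proof.
have [bxy|bxy] := eqVneq (base x) (base y); last first.
  rewrite -fv_rv -(rv_fv y) mulrA -(mulrA (fv x)) rv_neq // mulr0 mul0r.
  by case: (x =P y) bxy => // ->; rewrite eqxx.
case: x y bxy => [i|] [j|] /= => [->|->|<-|_].
- by rewrite eqxx; case: eqP => _; rewrite ?part_part ?rvv.
- by rewrite eqxx part_part.
- by rewrite eqxx part_part.
- by rewrite part_part.
Qed.

Let fvv x : fv x * fv x = fv x. Proof. by rewrite fv_fv eqxx. Qed.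

Let sum_base (W : zmodType) (F : option V -> W) i :
  \sum_(x | base x == i) F x = F (Some i) + (if i == v then F None else 0).
Proof.
rewrite (bigD1 (Some i)) //=; congr (_ + _); case: eqP => [->|iv].
  by rewrite (big_pred1 None) // => -[j|] //=; [case: eqP => //= ->; rewrite eqxx|rewrite eqxx].
rewrite big_pred0 // => -[j|] /=; first by case: eqP => //= ->; rewrite eqxx.
by apply/negbTE; rewrite andbT; apply/eqP => vi; apply: iv.
Qed.

Let sum_fv j : \sum_(y | base y == j) fv y = rv K r j.
Proof.
rewrite sum_base /=; case: eqP => [->|_]; last by rewrite addr0.
exact: part_sum.
Qed.

Lemma split_fam : rel_family t fv fe fg.
Proof.
split=> [|x y|x y txy|x y txy|x y txy|x y txy|x y x' y' txy txy'|x [y0 txy0]].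
- rewrite (partition_big base xpredT) //= -(rv_sum K r).
  by apply: eq_bigr => j _; exact: sum_fv.
- exact: fv_fv.
- by rewrite /fe mulrA fv_re.
- by rewrite /fe -mulrA fvv.
- by rewrite /fg mulrA fvv.
- by rewrite /fg -mulrA rg_fv.
- rewrite /fg /fe mulrA -(mulrA (fv y)) rg_re (base_rel txy) /=.
  case: eqP => [[bx bye]|ne].
    have xx' := base_inj txy txy' bx bye.
    rewrite mulr1n fv_rv fv_fv; congr (_ *+ _); rewrite xpair_eqE xx' eqxx.
    by [].
  rewrite mulr0 mul0r; case: eqP => // -[xx' yy']; by case: ne; rewrite xx' yy'.
transitivity (\sum_(j | r (base x) j && side x j) re K r (base x) j * rg K r (base x) j).
  case: x txy0 => [i|] /= txy0; last by apply: eq_bigl => j; case: (p j).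
  case: eqP txy0 => [->|iv] txy0.
    by apply: eq_bigl => j; case: (p j).
  rewrite rv_CK2; last by exists (base y0); case/andP: txy0.
  by apply: eq_bigl => j; rewrite andbT.
rewrite [RHS](partition_big base (fun j => r (base x) j && side x j)) /=; last first.
  by move=> y; rewrite tE.
apply: eq_bigr => j /andP[rj sj].
rewrite (eq_bigr (fun y => re K r (base x) j * fv y * rg K r (base x) j)); last first.
  by move=> y /andP[_ /eqP <-]; rewrite /fe /fg mulrA -(mulrA _ (fv y) (fv y)) fvv.
rewrite -mulr_suml -mulr_sumr (eq_bigl (fun y => base y == j)); last first.
  by move=> y; rewrite tE; case: eqP => [->|]; rewrite ?andbF // rj sj.
by rewrite sum_fv re_rv.
Qed.

(** The copy of [i] that emits the edges towards [j]. It emits one to every copy of [j], whence the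
    sums in [he] and [hg]. *)
Let top i j : option V := if (i == v) && ~~ p j then None else Some i.
Let hv i := \sum_(x | base x == i) rv K t x.
Let he i j := \sum_(y | base y == j) re K t (top i j) y.
Let hg i j := \sum_(y | base y == j) rg K t (top i j) y.

Let base_top i j : base (top i j) = i.
Proof. by rewrite /top; case: ifP => // /andP[/eqP ->]. Qed.

Let t_top i j y : r i j -> base y = j -> t (top i j) y.
Proof.
move=> rij yj; rewrite tE base_top yj rij /top /side.
case: (eqVneq i v) => [->|iv] /=; last by rewrite iv.
by case: (boolP (p j)) => pj //=; rewrite orbT.
Qed.

Let topE x y : t x y -> top (base x) (base y) = x.
Proof.
move=> txy; have h := t_top (base_rel txy) (erefl (base y)).
by apply: (base_inj h txy) => //; exact: base_top.
Qed.

Let hv_rv x : hv (base x) * rv K t x = rv K t x.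
Proof.
rewrite mulr_suml (bigD1 x) //= rvv big1 ?addr0 // => y /andP[_ yx].
by rewrite rv_neq.
Qed.

Let rv_hv x : rv K t x * hv (base x) = rv K t x.
Proof.
rewrite mulr_sumr (bigD1 x) //= rvv big1 ?addr0 // => y /andP[_ yx].
by rewrite rv_neq // eq_sym.
Qed.

Let hv_top i j : hv i * rv K t (top i j) = rv K t (top i j).
Proof. by have := hv_rv (top i j); rewrite base_top. Qed.

Let top_hv i j : rv K t (top i j) * hv i = rv K t (top i j).
Proof. by have := rv_hv (top i j); rewrite base_top. Qed.

Lemma split_fam' : rel_family r hv he hg.
Proof.
split=> [|i j|i j rij|i j rij|i j rij|i j rij|i j k l rij rkl|i [j0 rij0]].
- by rewrite -(rv_sum K t) [RHS](partition_big base xpredT).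
- rewrite {1}/hv mulr_suml; case: (eqVneq i j) => [->|ij].
    by rewrite mulr1n; apply: eq_bigr => x /eqP <-; rewrite rv_hv.
  rewrite big1 // => x /eqP xi; rewrite mulr_sumr big1 // => y /eqP yj.
  by rewrite rv_neq //; apply: contra ij => /eqP xy; rewrite -xi -yj xy.
- rewrite mulr_sumr; apply: eq_bigr => y _.
  by rewrite -rv_re mulrA hv_top.
- rewrite mulr_suml; apply: eq_bigr => y /eqP <-.
  by rewrite -re_rv -mulrA rv_hv.
- rewrite mulr_sumr; apply: eq_bigr => y /eqP <-.
  by rewrite -rv_rg mulrA hv_rv.
- rewrite mulr_suml; apply: eq_bigr => y _.
  by rewrite -rg_rv -mulrA top_hv.
- rewrite mulr_suml; case: eqP => [[ik jl]|ne].
    subst k l; rewrite mulr1n; apply: eq_bigr => y yj; rewrite mulr_sumr (bigD1 y) //=.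
    rewrite rg_reE; last by apply: t_top => //; apply/eqP.
    rewrite big1 ?addr0 // => y' /andP[_ ne].
    by rewrite rg_reN //; apply: contra ne => /eqP[->].
  rewrite big1 // => y /eqP yj; rewrite mulr_sumr big1 // => y' /eqP yl.
  rewrite rg_reN //; apply/eqP => -[te ye]; apply: ne.
  by rewrite -[i](base_top i j) -[k](base_top k l) te -yj -yl ye.
transitivity (\sum_(x | base x == i) \sum_(y | t x y) re K t x y * rg K t x y).
  apply: eq_bigr => x /eqP xi; apply: rv_CK2; case: x xi => [i'|] /= xi; last first.
    by case: hN => j /= hj; exists (Some j).
  rewrite xi; have [iv|iv] := eqVneq i v.
    by case: hP => j hj; exists (Some j); rewrite /= iv.
  by exists (Some j0); rewrite /= rij0.
rewrite (eq_bigr (fun j => \sum_(y | base y == j) re K t (top i j) y * rg K t (top i j) y)).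
  rewrite [LHS](exchange_big_dep (fun y => r i (base y))) /=; last first.
    by move=> x y /eqP <- /base_rel.
  rewrite [RHS](exchange_big_dep (fun y => r i (base y))) /=; last first.
    by move=> j y rij /eqP ->.
  apply: eq_bigr => y riy; rewrite [LHS](big_pred1 (top i (base y))) => [|x].
    rewrite [RHS](big_pred1 (base y)) // => j /=; rewrite [base y == j]eq_sym.
    by case: (j =P base y) => [->|_]; rewrite ?riy ?andbF.
  apply/andP/eqP => [[/eqP <- txy]|->]; first by rewrite topE.
  by rewrite base_top eqxx t_top.
move=> j rij; rewrite mulr_suml; apply: eq_bigr => y yj.
rewrite mulr_sumr (bigD1 y) //= big1 ?addr0 // => y' /andP[_ ne].
rewrite -re_rv -rv_rg mulrA -(mulrA _ (rv K t y)) rv_neq ?mulr0 ?mul0r //.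
by rewrite eq_sym.
Qed.

Lemma split_iso : ring_isomorphic (lpa K (rel_graph t)) (lpa K (rel_graph r)).
Proof.
apply: (rel_iso split_fam split_fam') => g h [gv ge gg] [kv ke kg].
have hrv i : h (rv K r i) = hv i by rewrite kv.
have hpart b : h (part b) = rv K t (if b then Some v else None).
  rewrite rmorph_sum rv_CK2; last first.
    case: b; first by case: hP => j hj; exists (Some j); rewrite /= eqxx.
    by case: hN => j hj; exists (Some j).
  have tb y : t (if b then Some v else None) y = r v (base y) && (p (base y) == b).
    by case: b => /=; rewrite ?eqxx; case: (p _).
  rewrite [RHS](eq_bigl _ _ tb) [RHS](partition_big base (fun j => r v j && (p j == b))) //=.
  apply: eq_bigr => j /andP[rvj pj]; rewrite rmorphM ke // kg //.
  have topj : top v j = if b then Some v else None.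
    by rewrite /top eqxx (eqP pj); case: (b).
  rewrite /he /hg topj mulr_suml [RHS](eq_bigl (fun y => base y == j)); last first.
    by move=> y; case: (base y =P j) => [->|]; rewrite ?andbF // rvj pj.
  apply: eq_bigr => y yj; rewrite mulr_sumr (bigD1 y) //= big1 ?addr0 // => y' /andP[_ ne].
  rewrite -re_rv -rv_rg mulrA -(mulrA _ (rv K t y)) rv_neq ?mulr0 ?mul0r //.
  by rewrite eq_sym.
have hfv x : h (fv x) = rv K t x.
  case: x => [i|] /=; last exact: (hpart false).
  case: eqP => [->|/eqP iv]; first exact: (hpart true).
  by rewrite hrv /hv sum_base (negPf iv) addr0.
have ghv i : g (hv i) = rv K r i.
  rewrite rmorph_sum -sum_fv; apply: eq_bigr => x _; exact: gv.
split; split=> [x|x y txy|x y txy].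
- exact: hfv.
- rewrite rmorphM hfv ke ?base_rel // /he mulr_suml (bigD1 y) //= (topE txy) re_rv.
  rewrite big1 ?addr0 // => y' /andP[_ ne].
  by rewrite -re_rv -mulrA rv_neq ?mulr0.
- rewrite rmorphM hfv kg ?base_rel // /hg mulr_sumr (bigD1 y) //= (topE txy) rv_rg.
  rewrite big1 ?addr0 // => y' /andP[_ ne].
  by rewrite -rv_rg mulrA rv_neq ?mul0r // eq_sym.
- exact: ghv.
- rewrite rmorph_sum (eq_bigr (fun z => re K r x y * fv z)).
    by rewrite -mulr_sumr sum_fv re_rv.
  by move=> z /eqP zy; rewrite ge ?t_top // /fe base_top zy.
- rewrite rmorph_sum (eq_bigr (fun z => fv z * rg K r x y)).
    by rewrite -mulr_suml sum_fv rv_rg.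
  by move=> z /eqP zy; rewrite gg ?t_top // /fg base_top zy.
Qed.

End OutSplit.

(** * Ideals generated by vertices *)

Section QuotientGraph.
Variables (K : fieldType) (E : graph).
Implicit Types (v w : vertex E) (e f : edge E) (H : {set vertex E}).
Local Notation L := (lpa K E).
Local Notation lv := (lv K).
Local Notation le := (le K).
Local Notation lg := (lg K).

Lemma hereditaryP H : reflect (forall e, src e \in H -> rng e \in H) (hereditary H).
Proof.
apply: (iffP forall_inP) => [h e se|h v vH].
  have /forallP/(_ (rng e))/implyP := h _ se; apply.
  by apply: connect1; apply/existsP; exists e; rewrite !eqxx.
apply/forallP => w; apply/implyP => /connectP[p vp ->].
elim: p v vH vp => //= u p IH v vH /andP[/existsP[e /andP[/eqP se /eqP re]] up].
by apply: IH up; rewrite -re; apply: h; rewrite se.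
Qed.

Lemma saturatedP H : reflect (forall v, ~ sink v ->
  (forall e, src e = v -> rng e \in H) -> v \in H) (saturated H).
Proof.
apply: (iffP forallP) => h v; last first.
  apply/implyP => /andP[/existsP[e /eqP se] /forallP hr]; apply: h.
    by move/(_ e).
  by move=> f fv; have /implyP := hr f; apply; rewrite fv.
move=> nsv hr; have /implyP := h v; apply; apply/andP; split.
  apply: contrapT => no; apply: nsv => e se; apply: no.
  by apply/existsP; exists e; rewrite se.
by apply/forallP => f; apply/implyP => /eqP /hr.
Qed.

Definition hideal H : ideal L := gen_ideal (fun x => exists2 v, v \in H & x = lv v).

Lemma hideal_lv H v : v \in H -> hideal H (lv v).
Proof. by move=> vH; apply: mem_gen_ideal; exists v. Qed.

Section Quotient.
Variable H : {set vertex E}.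
Hypotheses (hH : hereditary H) (sH : saturated H).

Fact qsrc_subproof (e : {e | rng e \notin H}) : src (val e) \notin H.
Proof. by apply: contra (valP e) => /(hereditaryP _ hH). Qed.

Definition quotient_graph : graph :=
  @Graph {v | v \notin H} {e | rng e \notin H}
    (fun e : {e | rng e \notin H} => exist _ (src (val e)) (qsrc_subproof e))
    (fun e : {e | rng e \notin H} => exist _ (rng (val e)) (valP e)).
Local Notation F := quotient_graph.
Local Notation M := (lpa K F).

Let fv v : M := if insub v is Some u then lv (u : vertex F) else 0.
Let fe e : M := if insub e is Some u then le (u : edge F) else 0.
Let fg e : M := if insub e is Some u then lg (u : edge F) else 0.

Let fvE (u : vertex F) : fv (val u) = lv u. Proof. by rewrite /fv valK. Qed.
Let feE (u : edge F) : fe (val u) = le u. Proof. by rewrite /fe valK. Qed.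
Let fgE (u : edge F) : fg (val u) = lg u. Proof. by rewrite /fg valK. Qed.
Let fv0 v : v \in H -> fv v = 0. Proof. by move=> vH; rewrite /fv insubN ?vH. Qed.
Let fe0 e : rng e \in H -> fe e = 0. Proof. by move=> vH; rewrite /fe insubN ?vH. Qed.
Let fg0 e : rng e \in H -> fg e = 0. Proof. by move=> vH; rewrite /fg insubN ?vH. Qed.

Let edgeP e : rng e \in H \/ exists u : edge F, val u = e.
Proof.
by have [|h] := boolP (rng e \in H); [left|right; exists (exist _ e h)].
Qed.
Let vertexP v : v \in H \/ exists u : vertex F, val u = v.
Proof.
by have [|h] := boolP (v \in H); [left|right; exists (exist _ v h)].
Qed.

Let fam : lpa_family fv fe fg.
Proof.
split.
- rewrite -(lv_sum K F) (bigID (mem H)) /= big1 ?add0r => [|v]; last exact: fv0.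
  rewrite (big_sub (fun v => v \notin H)) /=.
  by apply: eq_bigr => u _; exact: fvE.
- move=> v w; have [vH|[v' <-]] := vertexP v.
    by rewrite fv0 // mul0r mul0rn.
  have [wH|[w' <-]] := vertexP w.
    rewrite (fv0 wH) mulr0; case: eqP => [vw|_]; rewrite ?mulr0n //.
    by case/negP: (valP v'); rewrite vw.
  by rewrite !fvE lv_mul.
- move=> e; have [eH|[u <-]] := edgeP e; first by rewrite fe0 ?mulr0.
  by rewrite feE -[src _]/(val (src u)) fvE lv_le.
- move=> e; have [eH|[u <-]] := edgeP e; first by rewrite fe0 ?mul0r.
  by rewrite feE -[rng _]/(val (rng u)) fvE le_lv.
- move=> e; have [eH|[u <-]] := edgeP e; first by rewrite fg0 ?mulr0.
  by rewrite fgE -[rng _]/(val (rng u)) fvE lv_lg.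
- move=> e; have [eH|[u <-]] := edgeP e; first by rewrite fg0 ?mul0r.
  by rewrite fgE -[src _]/(val (src u)) fvE lg_lv.
- move=> e f; have [eH|[u <-]] := edgeP e.
    by rewrite fg0 // mul0r; case: eqP => _; rewrite ?mulr0n // fv0.
  have [fH|[u' <-]] := edgeP f.
    rewrite fe0 // mulr0; case: eqP => [uf|_]; rewrite ?mulr0n //.
    by case/negP: (valP u); rewrite uf.
  by rewrite fgE feE lg_le -[rng (val u)]/(val (rng u)) fvE.
- move=> v nsv; have [vH|[u uv]] := vertexP v.
    rewrite fv0 // big1 // => e /eqP ev; rewrite fe0 ?mul0r //.
    by apply: (hereditaryP _ hH); rewrite ev.
  rewrite -uv fvE lv_CK2.
    rewrite [RHS](bigID (fun e => rng e \notin H)) /= [X in _ = _ + X]big1 ?addr0; last first.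
      by move=> e /andP[_ /negPn eH]; rewrite fe0 ?mul0r.
    pose G e := if src e == val u then fe e * fg e else 0.
    rewrite big_mkcond [RHS](eq_bigl (fun e => (rng e \notin H) && (src e == val u))).
      rewrite [RHS]big_mkcondr /= (big_sub (fun e => rng e \notin H)) /=.
      by apply: eq_bigr => e _; rewrite -val_eqE /= feE fgE.
    by move=> e; rewrite andbC.
  (* A vertex that becomes a sink in the quotient graph has all its edges ending in H; saturation
     puts it in H. *)
  move=> su; have /negP[] := valP u; apply: (saturatedP _ sH); first by rewrite uv.
  move=> e se; apply: contrapT => /negP re.
  by apply: (su (exist _ e re : edge F)); apply: val_inj.
Qed.

Local Notation proj := (quot_proj (hideal H)).

Let fam' : lpa_family (fun u : vertex F => proj (lv (val u)))
  (fun u : edge F => proj (le (val u))) (fun u : edge F => proj (lg (val u))).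
Proof.
have p0 v : v \in H -> proj (lv v) = 0 by move=> /hideal_lv/quot_proj_eq0.
split.
- rewrite -(rmorph1 proj) -(lv_sum K E) rmorph_sum [RHS](bigID (mem H)) /=.
  rewrite [X in _ = X + _]big1 ?add0r //.
  by rewrite (big_sub (fun v => v \notin H)).
- by move=> u w; rewrite -rmorphM lv_mul -val_eqE rmorphMn.
- by move=> e; rewrite -rmorphM lv_le.
- by move=> e; rewrite -rmorphM le_lv.
- by move=> e; rewrite -rmorphM lv_lg.
- by move=> e; rewrite -rmorphM lg_lv.
- by move=> e f; rewrite -rmorphM lg_le rmorphMn -val_eqE.
- move=> u nsu; have nsv : ~ sink (val u).
    by move=> su; apply: nsu => e /(congr1 val); exact: su.
  rewrite (lv_CK2 K nsv). rewrite rmorph_sum [LHS](bigID (fun e => rng e \notin H)) /=.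
  rewrite [X in _ + X]big1 ?addr0; last first.
    move=> e /andP[_ /negPn eH]; apply/quot_proj_eq0/idealMr.
    by rewrite -le_lv; exact/idealMl/hideal_lv.
  rewrite [LHS](eq_bigl (fun e => (rng e \notin H) && (src e == val u))); last first.
    by move=> e; rewrite andbC.
  rewrite [LHS]big_mkcondr /= (big_sub (fun e => rng e \notin H)) /= [RHS]big_mkcond.
  by apply: eq_bigr => e _; rewrite -val_eqE rmorphM.
Qed.

Let homs : exists (g : {rmorphism L -> M}) (g' : {rmorphism quot_ring (hideal H) -> M})
    (h : {rmorphism M -> quot_ring (hideal H)}),
  [/\ forall v, g (lv v) = fv v, forall x, g' (proj x) = g x, cancel g' h & cancel h g'].
Proof.
have [g [gv ge gg gc]] := lpa_lift (@lcC K F) fam.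
have [|g' g'E] := @quot_lift _ _ (hideal H) g.
  pose Z : set L := fun x => g x = 0.
  have ZI : two_sided_ideal Z.
    split; first split; first exact: rmorph0.
    - by move=> x y Zx Zy; rewrite /Z rmorphD Zx Zy addr0.
    - by move=> a x Zx; rewrite /Z rmorphM Zx mulr0.
    - by move=> a x Zx; rewrite /Z rmorphM Zx mul0r.
  apply: (@gen_ideal_sub _ _ (Ideal ZI)) => _ [v vH ->].
  by rewrite /= /Z gv fv0.
have kapC c (y : quot_ring (hideal H)) :
    (proj \o lc E) c * y = y * (proj \o lc E) c.
  by have [x <-] := quot_proj_surj y; rewrite /= -!rmorphM lcC.
have [h [hv he hg hc]] := @lpa_lift K F _ (proj \o lc E) _ _ _ kapC fam'.
have gh : cancel h g'.
  move=> x; have := @lpa_hom_ext K F _ (g' \o h) idfun; apply=> [c|u|u|u] /=.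
  - by rewrite hc /= g'E gc.
  - by rewrite hv g'E gv fvE.
  - by rewrite he g'E ge feE.
  - by rewrite hg g'E gg fgE.
exists g, g', h; split=> // y; have [x <-] := quot_proj_surj y.
have := @lpa_hom_ext K E _ (h \o g) proj; rewrite g'E; apply=> [c|v|e|e] /=.
- by rewrite gc hc.
- rewrite gv; have [vH|[u <-]] := vertexP v; last by rewrite fvE hv.
  by rewrite fv0 // rmorph0; apply/esym/quot_proj_eq0/hideal_lv.
- rewrite ge; have [eH|[u <-]] := edgeP e; last by rewrite feE he.
  rewrite fe0 // rmorph0; apply/esym/quot_proj_eq0; rewrite -le_lv.
  exact/idealMl/hideal_lv.
- rewrite gg; have [eH|[u <-]] := edgeP e; last by rewrite fgE hg.
  rewrite fg0 // rmorph0; apply/esym/quot_proj_eq0; rewrite -lv_lg.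
  exact/idealMr/hideal_lv.
Qed.

Lemma quotient_iso : ring_isomorphic (quot_ring (hideal H)) M.
Proof. by have [_ [g [h [_ _ gh hg]]]] := homs; exists g; exists h. Qed.

(** A vertex outside H survives as a vertex of the quotient graph, and vertices are nonzero. *)
Lemma hideal_lvP v : hideal H (lv v) <-> v \in H.
Proof.
split=> [|]; last exact: hideal_lv.
have [g [g' [h [gv g'E _ _]]]] := homs.
move=> /quot_proj_eq0 pv; have [//|[u uv]] := vertexP v.
have := g'E (lv v); rewrite pv rmorph0 gv -uv fvE => /esym/eqP.
by rewrite (negPf (lv_neq0 K _)).
Qed.

End Quotient.

Definition ideal_vertices (J : ideal L) : {set vertex E} := [set v | `[< J (lv v) >]].

Lemma ideal_verticesP (J : ideal L) v : v \in ideal_vertices J <-> J (lv v).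
Proof. by rewrite inE; split=> /asboolP. Qed.

Lemma ideal_vertices_hereditary J : hereditary (ideal_vertices J).
Proof.
apply/hereditaryP => e /ideal_verticesP Js; apply/ideal_verticesP.
by rewrite -lge -lv_le; apply/idealMl/idealMr.
Qed.

Lemma ideal_vertices_saturated J : saturated (ideal_vertices J).
Proof.
apply/saturatedP => v nsv hr; apply/ideal_verticesP; rewrite lv_CK2 //.
apply: ideal_sum => e /eqP /hr /ideal_verticesP Jr; apply: idealMr.
by rewrite -le_lv; exact: idealMl.
Qed.

Lemma hideal_sub H (J : ideal L) : H \subset ideal_vertices J -> forall x, hideal H x -> J x.
Proof.
move=> /fintype.subsetP HJ; apply: gen_ideal_sub => _ [v vH ->].
exact/ideal_verticesP/HJ.
Qed.

End QuotientGraph.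

Lemma iter_periodic (T : finType) (f : T -> T) x :
  exists i k, iter k.+1 f (iter i f x) = iter i f x.
Proof.
have : ~ injective (fun i : 'I_#|T|.+1 => iter i f x).
  by move=> /leq_card; rewrite card_ord ltnn.
move=> ninj; apply: contrapT => no; apply: ninj => a b ab; apply: ord_inj.
case: (ltngtP a b) => // lt; case: no.
- by exists a, (b - a).-1; rewrite prednK ?subn_gt0 // -iterD subnK ?(ltnW lt).
- by exists b, (a - b).-1; rewrite prednK ?subn_gt0 // -iterD subnK ?(ltnW lt).
Qed.

(** * The socle is generated by the sinks *)

Section Socle.
Variables (K : fieldType) (E : graph).
Implicit Types (v w u s : vertex E) (e f : edge E).
Local Notation L := (lpa K E).
Local Notation lv := (lv K).
Local Notation le := (le K).
Local Notation lg := (lg K).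
Local Notation lc := (lc E).

Lemma socle_minimal (M : set L) x : minimal_left_ideal M -> M x -> socle L x.
Proof.
move=> hM Mx; exists [:: x]; last by rewrite big_seq1.
by move=> y; rewrite inE => /eqP ->; exists M.
Qed.

Lemma sink_word s r v : sink s -> gok s r v -> r = [::].
Proof.
move=> ss; elim: r v => // e r IH v /= /andP[_ ok].
by have r0 := IH _ ok; move: ok; rewrite r0 => /eqP /esym /ss.
Qed.

(** Only the empty ghost word starts at a sink, so every leaf of [y] is a scalar multiple of [lv s].
    Some sequence of expansions keeps [y] nonzero down to a leaf, where the scalar is inverted. *)
Lemma sink_simple s (y : L) : sink s -> y * lv s = y -> y != 0 -> exists z, z * y = lv s.
Proof.
move=> ss; have leaf n v (x : L) : x * lv s = x -> x != 0 -> ghost_leaf false n v x ->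
    exists z, z * x = lv s.
  move=> xs x0 /(_ s)[l [a [ul ok]]]; rewrite xs => xE.
  have [c cE] : exists c, x = lc c * lv s.
    case: l ul ok xE => [|r l] ul ok xE.
      by rewrite xE big_nil eqxx in x0.
    have r0 q : q \in r :: l -> q = [::] by move=> /ok/andP[/(sink_word ss)].
    case: l ul xE r0 {ok} => [|q l] ul xE r0; last first.
      move: ul; rewrite (r0 r (mem_head _ _)) (r0 q) ?inE ?eqxx ?orbT //.
    exists (a r); rewrite xE big_seq1; congr (_ * _).
    by rewrite (r0 r (mem_head _ _)).
  have c0 : c != 0 by apply: contraNneq x0 => c0; rewrite cE c0 rmorph0 mul0r.
  by exists (lc c^-1); rewrite cE mulrA -rmorphM mulVf // rmorph1 mul1r.
have main N : forall n v (x : L), x * lv s = x -> lv v * x != 0 -> ghostly false N n v x ->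
    exists z, z * x = lv s.
  elim: N => [|N IH] n v x xs x0 hx.
    have [|z zE] := leaf n v (lv v * x) _ x0 hx; first by rewrite -mulrA xs.
    by exists (z * lv v); rewrite -mulrA.
  move: hx; rewrite /=; case: asboolP => [sv hx|nsv hx].
    have [|z zE] := leaf n v (lv v * x) _ x0 hx; first by rewrite -mulrA xs.
    by exists (z * lv v); rewrite -mulrA.
  have [e sev e0] : exists2 e, src e = v & lg e * x != 0.
    apply: contrapT => no; case/eqP: x0; rewrite (lv_CK2 K nsv) mulr_suml big1 // => e /eqP sev.
    rewrite -mulrA; have [->|e0] := eqVneq (lg e * x) 0; first by rewrite mulr0.
    by case: no; exists e.
  have [|||z zE] := IH (n - 1) (rng e) (lg e * x).
  - by rewrite -mulrA xs.
  - by rewrite mulrA lv_lg.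
  - exact: hx.
  - by exists (z * lg e); rewrite -mulrA.
move=> ys y0; have [N hN] := ghostly_ex y.
have [v v0] : exists v, lv v * y != 0.
  apply: contrapT => no; case/eqP: y0; rewrite -[y]mul1r -lv_sum mulr_suml big1 // => v _.
  by apply: contrapT => /eqP v0; apply: no; exists v.
exact: main (hN v).
Qed.

Lemma sink_socle s : sink s -> socle L (lv s).
Proof.
move=> ss; apply: (@socle_minimal (fun x => x * lv s = x)); last by rewrite lvv.
split.
- split; first by rewrite mul0r.
  + by move=> x y xs ys; rewrite mulrDl xs ys.
  + by move=> a x xs; rewrite -mulrA xs.
- by exists (lv s); rewrite ?lvv // lv_neq0.
move=> N [_ _ NM] Ns [y Ny y0] x xs; have [z zE] := sink_simple ss (Ns _ Ny) y0.
by rewrite -xs -zE mulrA; exact: NM.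
Qed.

(* L w is a simple module. *)
Definition simple_vertex w : Prop :=
  forall y : L, y * lv w = y -> y != 0 -> exists z, z * y = lv w.

(** A minimal left ideal is generated by one element, hence has a basis by [span_vbasis]. Any basis
    vector also generates it and identifies it with the module [L w] of its type. *)
Lemma minimal_simple (M : set L) : minimal_left_ideal M ->
  exists w b, [/\ simple_vertex w, lv w * b = b & forall x, M x -> exists z, x = z * b].
Proof.
move=> [[M0 MD MM] [x Mx x0] Mmin].
have [I [s [b [tb ib sb]]]] := span_vbasis (vertices_basis K E) (fun _ : unit => x : L^o).
have bM i : M (b i).
  have [c ->] : spans (fun _ : unit => x : L^o) (b i) by apply/sb/spans_mem.
  rewrite (big_pred1 tt) => [|[]//]; exact: MM.
have [i _] : exists i : I, true.
  apply: contrapT => no; have [c xE] : spans b (x : L^o).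
    by apply/sb; exact: (spans_mem (fun _ : unit => x : L^o) tt).
  by case/eqP: x0; rewrite xE big1 // => i _; case: no; exists i.
have span y : y != 0 -> M y -> forall x, M x -> exists z, x = z * y.
  move=> y0 My; apply: (Mmin (fun x => exists z, x = z * y)).
  - split; first by exists 0; rewrite mul0r.
    + by move=> _ _ [z ->] [z' ->]; exists (z + z'); rewrite mulrDl.
    + by move=> a _ [z ->]; exists (a * z); rewrite mulrA.
  - by move=> _ [z ->]; exact: MM.
  - by exists y => //; exists 1; rewrite mul1r.
have cancel y : y * (b i : L) = 0 -> y * lv (s i) = 0.
  move=> yb; have := ib (fun k => if k == i then y else 0) _ i; rewrite eqxx; apply.
  rewrite (bigD1 i) //= eqxx [X in X + _]yb add0r big1 // => k /negPf ->.
  by rewrite scale0r.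
exists (s i), (b i : L); split; last 1 first.
- by apply: span; [exact: (indep_neq0 i ib)|exact: bM].
- move=> y ys y0; have yb0 : y * (b i : L) != 0.
    by apply: contraNneq y0 => /cancel; rewrite ys => ->.
  have [|z zE] := span _ yb0 _ _ (bM i); first exact: MM.
  exists z; apply/eqP; rewrite -subr_eq0.
  have := cancel (z * y - lv (s i)); rewrite mulrBl mulrBl -(mulrA z y (lv _)) ys lvv.
  move=> -> //; rewrite -mulrA -zE [X in _ - X](tb i); exact: subrr.
exact: (tb i).
Qed.

Section Line.
Variable C : {set vertex E}.
Hypotheses (hC : hereditary C) (sC : saturated C) (sinkC : forall s, sink s -> s \in C).

Let bad w := simple_vertex w /\ w \notin C.

(** If f were a second edge at [w], simplicity would give z e e^* = w, and multiplying by f on the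
    right would yield 0 = f. Hence w = e e^*, simplicity passes to the range of [e], and saturation
    of [C] keeps that range outside [C]. *)
Lemma bad_step w : bad w ->
  exists e, [/\ src e = w, forall f, src f = w -> f = e & bad (rng e)].
Proof.
move=> [Pw wC]; have nsw : ~ sink w by move=> /sinkC; exact/negP.
have [e ew] : exists e, src e = w.
  by apply: contrapT => no; apply: nsw => e ew; apply: no; exists e.
have ue f : src f = w -> f = e.
  move=> fw; apply/eqP; apply/negPn/negP => fe.
  have [||z zE] := Pw (le e * lg e).
  - by rewrite -mulrA -ew lg_lv.
  - by apply: contraNneq (le_neq0 K e) => ee; rewrite -le_lv -lge mulrA ee mul0r.
  have := congr1 (fun x => x * le f) zE; rewrite -{1}fw lv_le -!mulrA lg_le.
  by rewrite eq_sym (negPf fe) mulr0n !mulr0 => /esym/eqP; rewrite (negPf (le_neq0 K f)).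
have wE : lv w = le e * lg e.
  rewrite (lv_CK2 K nsw) (big_pred1 e) // => f; apply/eqP/eqP => [/ue|->] //.
exists e; split=> //; split.
  move=> y ye y0; have yg0 : y * lg e != 0.
    by apply: contraNneq y0 => y0; rewrite -ye -lge mulrA y0 mul0r.
  have [|z zE] := Pw _ _ yg0; first by rewrite -mulrA -ew lg_lv.
  exists (lg e * z); rewrite -ye -lge !mulrA -(mulrA (lg e) z y) -(mulrA (lg e)) -(mulrA z y).
  by rewrite zE -ew lg_lv.
apply: contra wC => eC; apply: (saturatedP _ sC) => // f /ue ->.
exact: eC.
Qed.

Let nxt w := if [pick e | src e == w] is Some e then rng e else w.

Lemma bad_nxt w : bad w ->
  exists e, [/\ src e = w, outdeg (src e) = 1%N, nxt w = rng e & bad (rng e)].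
Proof.
move=> /bad_step[e [ew ue be]]; exists e; split=> //.
  rewrite /outdeg /outs -cardE -(card1 e); apply: eq_card => f.
  by rewrite !inE ew; apply/eqP/eqP => [/ue|->].
rewrite /nxt; case: pickP => [f /eqP /ue -> //|/(_ e)].
by rewrite ew eqxx.
Qed.

(** Following the only edges leads into a cycle c without exit at some u. Then u - c is nonzero,
    since the representation with t = 1 sees the degree, but it generates a proper submodule of
    [L u]: with t = 0 it acts as zero, whereas u does not. *)
Lemma no_bad w : ~ bad w.
Proof.
move=> bw; have bk k : bad (iter k nxt w).
  by elim: k => //= k /bad_nxt[e [_ _ -> ]].
have [i [k0 per]] := iter_periodic nxt w; pose u := iter i nxt w; pose d := k0.+1.
have ud : iter d nxt u = u by [].
have bu k : bad (iter k nxt u) by rewrite /u -iterD.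
have [c [cu uc cE]] : exists c : L, [/\ c * lv u = c, lv u * c = c & forall t : int,
    exists rho : {rmorphism L -> endo K (vertex E * nat * int)},
    [/\ forall v g x, rho (lv v) g x = if x.1.1 == v then g x else 0
      & forall g m n, rho c g (u, m, n) = g (u, m, n - t * d%:Z)]].
  (* The path of length k along the only edges. All out-degrees on it are 1, so its action leaves
     the middle component of a point unchanged. *)
  have path k : exists c : L, [/\ c * lv (iter k nxt u) = c, lv u * c = c & forall t : int,
      exists rho : {rmorphism L -> endo K (vertex E * nat * int)},
      [/\ forall v g x, rho (lv v) g x = if x.1.1 == v then g x else 0,
        forall e g x, rho (le e) g x =
          if (x.1.1 == src e) && (x.1.2 %% outdeg (src e) == rank e)%N
          then g (rng e, (x.1.2 %/ outdeg (src e))%N, x.2 - t) else 0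
        & forall g m n, rho c g (u, m, n) = g (iter k nxt u, m, n - t * k%:Z)]].
    elim: k => [|k [c [ck uc cE]]].
      exists (lv u); split=> [||t]; rewrite ?lvv //.
      have [rho [rv re _ _]] := lpa_rep K E t; exists rho; split=> // g m n.
      by rewrite rv /= eqxx mulr0 subr0.
    have [e [ek e1 nk _]] := bad_nxt (bu k).
    exists (c * le e); split=> [||t]; [by rewrite /= nk -mulrA le_lv|by rewrite mulrA uc|].
    have [rho [rv re rc]] := cE t; exists rho; split=> // g m n.
    rewrite rmorphM [LHS]rc re /= -ek eqxx e1 modn1 divn1 /=.
    have -> : rank e = 0%N by apply/eqP; rewrite -leqn0 -ltnS -e1 ltn_rank.
    rewrite eqxx ek nk; congr (g (_, _, _)).
    by rewrite intS mulrDr mulr1 (addrC t) opprD addrA.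
  have [c [cu uc cE]] := path d; exists c; split=> //; first by rewrite -{1}ud.
  by move=> t; have [rho [rv _ rc]] := cE t; exists rho; split=> // g m n; rewrite rc ud.
have [Pu _] := bu 0%N.
have [||z zE] := Pu (lv u - c); rewrite /=.
- by rewrite mulrBl lvv cu.
- apply/eqP => uc0; have [rho [rv rc]] := cE 1.
  pose g (x : vertex E * nat * int) : K := (x == (u, 0%N, 0))%:R.
  have := congr1 (fun x => rho x g (u, 0%N, 0)) uc0.
  rewrite rmorphB rmorph0 => /eqP; rewrite subr_eq0 [X in X == _]rv rc /= eqxx /g eqxx.
  by rewrite mul1r sub0r !xpair_eqE !eqxx /= oner_eq0.
have [rho [rv rc]] := cE 0.
have y0 g : rho (lv u - c) g = fun=> 0.
  apply: funext => -[[v m] n]; have -> : lv u - c = lv u * (lv u - c).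
    by rewrite mulrBr lvv uc.
  rewrite rmorphM [LHS]rv /=; case: eqP => // ->.
  rewrite rmorphB -[LHS]/(rho (lv u) g (u, m, n) - rho c g (u, m, n)).
  by rewrite rv rc /= eqxx mul0r subr0 subrr.
pose g (x : vertex E * nat * int) : K := 1.
have z0 x : rho z (fun=> 0) x = 0.
  rewrite -[RHS](mul0r (rho z g x)) -endoZ; congr (endo_fun (rho z) _ x).
  by apply: funext => y; rewrite mul0r.
have h : rho (z * (lv u - c)) g (u, 0%N, 0) = 0.
  by rewrite rmorphM -[LHS]/(rho z (rho (lv u - c) g) (u, 0%N, 0)) y0 z0.
have /eqP : rho (lv u) g (u, 0%N, 0) = 0 by rewrite -zE.
by rewrite rv eqxx oner_eq0.
Qed.

Lemma simple_vertex_line w : simple_vertex w -> w \in C.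
Proof. by move=> Pw; apply/negPn/negP => wC; exact: (@no_bad w). Qed.

End Line.

(** Minimal left ideals lie in the ideal because simple vertices lie in [C]. Conversely the vertices
    in the socle form a hereditary saturated set containing the sinks, to which minimality of [C]
    applies. *)
Lemma socle_hideal (C : {set vertex E}) : hereditary C -> saturated C ->
  (forall s, sink s -> s \in C) ->
  (forall D : {set vertex E}, hereditary D -> saturated D ->
     (forall s, sink s -> s \in D) -> C \subset D) ->
  forall x, socle L x <-> hideal K C x.
Proof.
move=> hC sC sinkC minC x; split=> [[l lP ->]|].
  rewrite big_seq; apply: ideal_sum => y yl; have [M hM My] := lP y yl.
  have [w [b [Pw wb Mb]]] := minimal_simple hM; have [z ->] := Mb _ My.
  rewrite -wb mulrA; apply: idealMr; apply: idealMl; apply: hideal_lv.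
  exact: simple_vertex_line Pw.
apply: hideal_sub; apply: minC.
- exact: ideal_vertices_hereditary.
- exact: ideal_vertices_saturated.
- by move=> s /sink_socle/ideal_verticesP.
Qed.

Lemma socle_eq0 : (forall x, socle L x -> x = 0) <-> (forall v, ~ sink v).
Proof.
split=> [soc0 v /sink_socle/soc0/eqP|nos]; first by rewrite (negPf (lv_neq0 K v)).
have soc : forall x, socle L x <-> hideal K (finset.set0 : {set vertex E}) x.
  apply: socle_hideal.
  - by apply/hereditaryP => e; rewrite inE.
  - apply/saturatedP => v nsv h; apply: contrapT => _; apply: nsv => e /h.
    by rewrite inE.
  - by move=> s /nos.
  - by move=> D _ _ _; exact: finset.sub0set.
move=> x /soc/gen_idealE[l lP ->].
by rewrite big_seq big1 // => t /lP[v]; rewrite inE.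
Qed.

(** The vertex is isolated, so edges and ghost edges annihilate it on both sides and only scalars
    remain. *)
Lemma lpa_mul_sink s : (forall e, rng e <> s) -> sink s ->
  forall a, exists c, a * lv s = lc c * lv s /\ lv s * a = lc c * lv s.
Proof.
move=> nos ss; elim/lpa_ind => [|x y [c [xc cx]] [d [yd dy]]|d x [c [xc cx]]
  |v x [c [xc cx]]|e x [c [xc cx]]|e x [c [xc cx]]].
- by exists 1; rewrite rmorph1 mulr1 !mul1r.
- by exists (c + d); rewrite mulrDl mulrDr rmorphD mulrDl xc cx yd dy.
- exists (d * c); rewrite rmorphM -!mulrA xc; split=> //.
  by rewrite mulrA -lcC -mulrA cx.
- exists (if v == s then c else 0); rewrite -mulrA xc mulrA; case: eqP => [->|/eqP vs].
    by rewrite mulrA lvv cx -lcC -mulrA lvv.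
  have sv : s != v by rewrite eq_sym.
  by rewrite -lcC -mulrA lv_neq // mulrA lv_neq // rmorph0 mulr0 !mul0r.
- exists 0; rewrite rmorph0 mul0r -mulrA xc mulrA -lcC -mulrA le_lvN; last by apply/eqP => re; exact: (nos e).
  by rewrite mulr0 mulrA lv_leN ?mul0r //; apply/eqP => se; exact: (ss e).
- exists 0; rewrite rmorph0 mul0r -mulrA xc mulrA -lcC -mulrA lg_lvN; last first.
    by apply/eqP => se; exact: (ss e).
  by rewrite mulr0 mulrA lv_lgN ?mul0r //; apply/eqP => se; exact: (nos e).
Qed.

(** An edge e ending in a sink r lies in the socle together with r, and e r = e while r e = 0. If
    there is no such edge, the sinks are isolated and the socle is a product of copies of [K]. *)
Lemma socle_comm : (forall x y, socle L x -> socle L y -> x * y = y * x) <->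
  (forall e, ~ sink (rng e)).
Proof.
split=> [comm e sr|nosr].
  have Sr := sink_socle sr.
  have Se : socle L (le e) by rewrite -le_lv; exact: idealMl.
  have := comm _ _ Sr Se; rewrite le_lv lv_leN => [/esym/eqP|].
    by rewrite (negPf (le_neq0 K e)).
  by apply/eqP => re; exact: (sr e).
pose C : {set vertex E} := [set v | `[< sink v >]].
have CP v : v \in C <-> sink v by rewrite inE; split=> /asboolP.
have soc : forall x, socle L x <-> hideal K C x.
  apply: socle_hideal.
  - by apply/hereditaryP => e /CP /(_ e erefl).
  - apply/saturatedP => v nsv h; apply: contrapT => _; apply: nsv => e /h /CP.
    exact: nosr.
  - by move=> s /CP.
  - by move=> D _ _ h; apply/fintype.subsetP => v /CP /h.
have form x : hideal K C x -> exists c : vertex E -> K, x = \sum_(v in C) lc (c v) * lv v.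
  move=> /gen_idealE[l lP ->]; elim: l lP => [|t l IH] lP.
    by exists (fun=> 0); rewrite big_nil big1 // => v _; rewrite rmorph0 mul0r.
  have [|c cE] := IH; first by move=> u ul; apply: lP; rewrite inE ul orbT.
  have [s sC ts] := lP t (mem_head _ _); have /CP ss := sC.
  have nos e : rng e <> s by move=> re; apply: (nosr e); rewrite re.
  have [a [aE _]] := lpa_mul_sink nos ss t.1.1; have [b [_ bE]] := lpa_mul_sink nos ss t.2.
  exists (fun v => c v + (if v == s then a * b else 0)); rewrite big_cons cE ts aE.
  rewrite -mulrA bE mulrA -rmorphM addrC; under [RHS]eq_bigr do rewrite rmorphD mulrDl.
  rewrite big_split /=; congr (_ + _); rewrite (bigD1 s) //= eqxx big1 ?addr0 //.
  by move=> v /andP[_ /negPf ->]; rewrite rmorph0 mul0r.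
move=> x y /soc/form[c ->] /soc/form[d ->]; rewrite !mulr_suml.
have diag (a b : vertex E -> K) v : v \in C ->
    lc (a v) * lv v * (\sum_(u in C) lc (b u) * lv u) = lc (a v * b v) * lv v.
  move=> vC; rewrite mulr_sumr (bigD1 v) //= big1 ?addr0.
    by rewrite -mulrA (mulrA (lv v)) -lcC -mulrA lvv mulrA -rmorphM.
  move=> u /andP[_ uv]; rewrite -mulrA (mulrA (lv v)) -lcC -mulrA lv_neq 1?eq_sym //.
  by rewrite !mulr0.
by apply: eq_bigr => v vC; rewrite !diag // mulrC.
Qed.

End Socle.

Lemma minimal_left_ideal_image (R S : pzRingType) (g : {rmorphism R -> S}) (h : {rmorphism S -> R}) :
  cancel g h -> cancel h g -> forall M, minimal_left_ideal M ->
  minimal_left_ideal (fun y => M (h y)).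
Proof.
move=> gh hg M [[M0 MD MM] [x Mx x0] Mmin]; split.
- split; first by rewrite rmorph0.
  + by move=> y z My Mz; rewrite rmorphD; exact: MD.
  + by move=> a y My; rewrite rmorphM; exact: MM.
- exists (g x); first by rewrite gh.
  by apply: contraNneq x0 => gx; rewrite -(gh x) gx rmorph0.
move=> N [N0 ND NM] NMh [y Ny y0] z /(Mmin (fun x => N (g x))).
rewrite hg; apply.
- split; first by rewrite rmorph0.
  + by move=> u v Nu Nv; rewrite rmorphD; exact: ND.
  + by move=> a u Nu; rewrite rmorphM; exact: NM.
- by move=> u /NMh; rewrite gh.
- exists (h y); first by rewrite hg.
  by apply: contraNneq y0 => hy; rewrite -(hg y) hy rmorph0.
Qed.

Lemma socle_image (R S : pzRingType) (g : {rmorphism R -> S}) (h : {rmorphism S -> R}) :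
  cancel g h -> cancel h g -> forall x, socle R x -> socle S (g x).
Proof.
move=> gh hg x [l lP ->]; exists [seq g y | y <- l]; last by rewrite big_map rmorph_sum.
move=> _ /mapP[y /lP[M hM My] ->]; exists (fun z => M (h z)); last by rewrite gh.
exact: minimal_left_ideal_image hM.
Qed.

Section SocleTransfer.
Variables (R S : pzRingType).

Lemma quot_ring_iso (g : {rmorphism R -> S}) (h : {rmorphism S -> R}) (I : ideal R) (J : ideal S) :
  cancel g h -> cancel h g -> (forall x, I x -> J (g x)) -> (forall y, J y -> I (h y)) ->
  ring_isomorphic (quot_ring I) (quot_ring J).
Proof.
move=> gh hg IJ JI.
have [x /IJ/quot_proj_eq0//|a aE] := @quot_lift _ _ I (quot_proj J \o g).
have [y /JI/quot_proj_eq0//|b bE] := @quot_lift _ _ J (quot_proj I \o h).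
exists a; exists b => x; have [y <-] := quot_proj_surj x.
  by rewrite aE bE /= gh.
by rewrite bE aE /= hg.
Qed.

Lemma socle_iso : ring_isomorphic R S ->
  ideal_ring_isomorphic (socle R) (socle S) /\
  ring_isomorphic (quot_ring (socle R)) (quot_ring (socle S)).
Proof.
move=> [g [h gh hg]].
have [||h' h'E] := @rmorph_exists _ _ h.
- by move=> x y; rewrite -{1}(hg x) -{1}(hg y) -rmorphB gh.
- by split=> [|x y]; rewrite -?(rmorph1 g) ?gh // -{1}(hg x) -{1}(hg y) -rmorphM gh.
have gh' : cancel g h' by move=> x; rewrite h'E gh.
have h'g : cancel h' g by move=> x; rewrite h'E hg.
split; last first.
  apply: (quot_ring_iso gh' h'g) => x; first exact: (socle_image gh' h'g).
  exact: (socle_image h'g gh').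
exists g => [|x y _ _]; last by rewrite rmorphD rmorphM.
split.
- by move=> x; exact: (socle_image gh' h'g).
- by move=> x y _ _ /(can_inj gh').
- by move=> y Sy; exists (h' y); rewrite ?h'g //; exact: (socle_image h'g gh').
Qed.

Variables (I : ideal R) (J : ideal S).
Hypothesis IJ : ideal_ring_isomorphic I J.

Lemma ideal_iso_eq0 : (forall x, I x -> x = 0) <-> (forall y, J y -> y = 0).
Proof.
have [f [fIJ finj fsurj] fM] := IJ.
have f0 : f 0 = 0.
  by have [/eqP] := fM _ _ (ideal0 I) (ideal0 I); rewrite addr0 -subr_eq0 opprD addNKr oppr_eq0 => /eqP.
split=> [I0 y /fsurj[x Ix <-]|J0 x Ix]; first by rewrite (I0 x).
apply: finj; rewrite ?inE //; first exact: ideal0.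
by rewrite f0; apply: J0; exact: fIJ.
Qed.

Lemma ideal_iso_comm : (forall x y, I x -> I y -> x * y = y * x) <->
  (forall x y, J x -> J y -> x * y = y * x).
Proof.
have [f [fIJ finj fsurj] fM] := IJ; split=> comm.
  move=> _ _ /fsurj[x Ix <-] /fsurj[y Iy <-].
  by rewrite -(fM _ _ Ix Iy).2 -(fM _ _ Iy Ix).2 comm.
move=> x y Ix Iy; apply: finj; rewrite ?inE; [exact: idealMl|exact: idealMl|].
by rewrite (fM _ _ Ix Iy).2 (fM _ _ Iy Ix).2; apply: comm; exact: fIJ.
Qed.

End SocleTransfer.

(** * Graded ideals are generated by vertices *)

Section GradedIdeals.
Variables (K : fieldType) (E : graph).
Implicit Types (v w u : vertex E) (e f : edge E) (n m : int) (x y : lpa K E).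
Implicit Types (p q : vertex E * seq (edge E)) (r : seq (edge E)).
Local Notation L := (lpa K E).
Local Notation lv := (lv K).
Local Notation le := (le K).
Local Notation lg := (lg K).
Local Notation lc := (lc E).
Local Notation gw := (gw K).
Local Notation proj := (quot_proj (lpa_ideal K E)).

Definition pw v r : L := lv v * \prod_(e <- r) le e.

Lemma pw_path p : is_path p -> proj (edge_path K p) = pw p.1 p.2.
Proof.
case: p => v [|e r]; rewrite /is_path /edge_path /pw /=; first by rewrite big_nil mulr1 lvE.
case/andP=> /eqP <- _; rewrite rmorph_prod !big_cons mulrA lv_le leE.
by congr (_ * _); apply: eq_bigr => f _; rewrite leE.
Qed.

Lemma gok_path q : is_path q -> gok q.1 (rev q.2) (gend q.1 (rev q.2)).
Proof.
case: q => v r; elim/last_ind: r => [|r e IH] /=; first by rewrite eqxx.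
rewrite rev_rcons /= eqxx /=; case: r IH => [|f r] IH; rewrite /is_path /=.
  by case/andP=> /eqP <- _; rewrite eqxx.
rewrite rcons_path => /andP[/eqP fv /andP[pr /eqP le_e]].
have -> : src e = gend v (rev (f :: r)).
  by rewrite -le_e; case/lastP: (r) => [|r' g] //; rewrite last_rcons rev_cons rev_rcons.
by apply: IH; rewrite /is_path /= fv eqxx pr.
Qed.

Lemma gw_path q : is_path q -> proj (ghost_path K q) = gw q.1 (rev q.2).
Proof.
have prod v r : gw v r = \prod_(e <- r) lg e * lv v.
  elim: r => [|e r IH] /=; first by rewrite big_nil mul1r.
  by rewrite IH big_cons mulrA.
case: q => v r; case/lastP: r => [|r e] pq; rewrite /ghost_path /=.
  by rewrite lvE.
have -> : (if rcons r e is [::] then vtx K v else \prod_(f <- rev (rcons r e)) ghost K f) =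
    \prod_(f <- rev (rcons r e)) ghost K f by case: (r).
rewrite rmorph_prod prod.
case: r pq => [|f r] pq; rewrite ?rcons_cons ?rev_cons /=.
  move: pq; rewrite /is_path /= => /andP[/eqP <- _].
  by rewrite !big_seq1 lg_lv lgE.
have /andP[/eqP fv _] : (src f == v) && path (@follows E) f (rcons r e) by exact: pq.
rewrite -!cats1 !big_cat big_seq1 /= -fv -mulrA big_seq1 lg_lv.
by congr (_ * _); [apply: eq_bigr => g _|]; rewrite lgE.
Qed.

Definition monomial n y : Prop := y = 0 \/ exists c p q,
  [/\ is_path p, is_path q, (size p.2)%:Z - (size q.2)%:Z = n
    & y = lc c * (pw p.1 p.2 * gw q.1 (rev q.2))].

Lemma proj_term c p q : is_path p -> is_path q ->
  proj (c *: (edge_path K p * ghost_path K q)) = lc c * (pw p.1 p.2 * gw q.1 (rev q.2)).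
Proof.
by move=> pp pq; rewrite lcE -pw_path // -gw_path // -2!rmorphM mul_malgC.
Qed.

Lemma homogeneousP n x : homogeneous n x <-> exists s : seq L,
  (forall y, y \in s -> monomial n y) /\ x = \sum_(y <- s) y.
Proof.
split=> [[s [sP ->]]|[s [sP ->]]].
  exists [seq lc t.1.1 * (pw t.1.2.1 t.1.2.2 * gw t.2.1 (rev t.2.2)) | t <- s]; split.
    move=> _ /mapP[[[c p] q] /sP[pp pq pn] ->]; right.
    by exists c, p, q.
  rewrite big_map big_seq [RHS]big_seq; apply: eq_bigr => -[[c p] q] /sP[pp pq _].
  exact: proj_term.
elim: s sP => [|y s IH] sP; first by exists [::]; split => //; rewrite !big_nil.
have [z zs|t [tP tE]] := IH; first by apply: sP; rewrite inE zs orbT.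
rewrite big_cons tE; have [->|[c [p [q [pp pq pn ->]]]]] := sP y (mem_head _ _).
  by rewrite add0r; exists t.
exists ((c, p, q) :: t); split; last first.
  rewrite big_cons; exact: (congr1 (fun z => z + _) (esym (proj_term c pp pq))).
move=> c' p' q'; rewrite inE => /orP[/eqP[_ -> ->]|]; [by split|exact: tP].
Qed.

Lemma monomial_lv n v y : monomial n y -> monomial n (lv v * y).
Proof.
case=> [->|[c [p [q [pp pq pn ->]]]]]; first by left; rewrite mulr0.
rewrite mulrA -lcC -mulrA /pw (mulrA (lv v)) (mulrA (lv v)).
have [->|vp] := eqVneq v p.1; last by left; rewrite lv_neq // !mul0r mulr0.
by rewrite lvv; right; exists c, p, q.
Qed.

Lemma monomial_lc n c y : monomial n y -> monomial n (lc c * y).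
Proof.
case=> [->|[d [p [q [pp pq pn ->]]]]]; first by left; rewrite mulr0.
by right; exists (c * d), p, q; split=> //; rewrite rmorphM mulrA.
Qed.

Lemma monomial_le n e y : monomial n y -> monomial (n + 1) (le e * y).
Proof.
case=> [->|[c [p [q [pp pq pn ->]]]]]; first by left; rewrite mulr0.
rewrite mulrA -lcC -mulrA; have [ep|ep] := eqVneq (rng e) p.1; last first.
  by left; rewrite /pw -(le_lv K e) -!mulrA (mulrA (lv (rng e))) lv_neq // mul0r !mulr0.
right; exists c, (src e, e :: p.2), q; split=> //.
- case: (p) pp ep => v [|f r] /=; rewrite /is_path /= eqxx // /follows.
  by move=> /andP[/eqP -> ->] ->; rewrite eqxx.
- by rewrite -pn [size _]/= intS -addrA [RHS]addrC.
by rewrite /pw big_cons -ep -!mulrA (mulrA (le e)) le_lv (mulrA (lv (src e))) lv_le.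
Qed.

(** Against a nonempty real path (CK1) applies; against a trivial one the ghost edge prolongs the
    ghost path. *)
Lemma monomial_lg n e y : monomial n y -> monomial (n - 1) (lg e * y).
Proof.
case=> [->|[c [[v [|f r]] [q [pp pq pn ->]]]]]; first by left; rewrite mulr0.
  rewrite mulrA -lcC -mulrA /pw big_nil mulr1 /=.
  have [ev|ev] := eqVneq (src e) v; last first.
    by left; rewrite -(lg_lv K e) -!mulrA (mulrA (lv (src e))) lv_neq // mul0r !mulr0.
  have ok := gok_path pq.
  have [vq|vq] := eqVneq v (gend q.1 (rev q.2)); last first.
    by left; rewrite (lv_gwN K ok vq) !mulr0.
  right; exists c, (rng e, [::]), (q.1, rcons q.2 e); split=> //.
  - move: ev; rewrite {}vq; case: (q) pq => u [|f r] /=; rewrite /is_path /= => pq.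
      by move=> ->; rewrite eqxx.
    case/andP: pq => -> pr; rewrite rcons_path pr /= /follows => ->.
    by case/lastP: (r) => [|r' g]; rewrite ?last_rcons ?rev_cons ?rev_rcons /= ?eqxx.
  - by rewrite -pn /= size_rcons intS opprD addrA addrAC.
  have gwE : lv (rng e) * gw q.1 (e :: rev q.2) = lg e * gw q.1 (rev q.2).
    by rewrite mulrA lv_lg.
  by rewrite /pw big_nil mulr1 rev_rcons gwE vq (lv_gw K ok).
rewrite mulrA -lcC -mulrA /pw big_cons /=.
have {}pp : (src f == v) && path (@follows E) f r := pp.
case/andP: pp => /eqP <- pr; rewrite (mulrA (lv _)) lv_le !mulrA -(mulrA _ (lg e)) lg_le.
have [ef|_] := eqVneq e f; last by left; rewrite mulr0n mulr0 !mul0r.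
move: pr pn; rewrite -{}ef => pr pn.
right; exists c, (rng e, r), q; split=> //; last by rewrite /pw /= !mulrA.
- case: (r) pr => [|g r'] //=; rewrite /is_path /= /follows => /andP[/eqP -> ->].
  by rewrite eqxx.
- by rewrite -pn [size (_ :: _)]/= intS (addrAC (1 + _)) (addrC 1) addrK.
Qed.

Lemma homogeneous_map (a : L) n m x : (forall y, monomial n y -> monomial m (a * y)) ->
  homogeneous n x -> homogeneous m (a * x).
Proof.
move=> h /homogeneousP[s [sP ->]]; apply/homogeneousP.
exists [seq a * y | y <- s]; split; last by rewrite big_map mulr_sumr.
by move=> _ /mapP[y /sP/h + ->].
Qed.

(** A monomial needs as many expansions as its real path has edges; the ghost words that remain have
    the length dictated by the degree. *)
Lemma homogeneous_ghostly n x : homogeneous n x -> exists N, ghostly_all true N n x.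
Proof.
move=> /homogeneousP[s [sP ->]]; elim: s sP => [|y s IH] sP.
  by exists 0%N => v; apply: ghostly0; rewrite big_nil mulr0.
have [z zs|N hN] := IH; first by apply: sP; rewrite inE zs orbT.
have [M hM] : exists M, ghostly_all true M n y.
  have [->|[c [p [q [pp pq pn ->]]]]] := sP y (mem_head _ _).
    by exists 0%N => v; apply: ghostly0; rewrite mulr0.
  exists (size p.2) => v; apply: ghostlyZ; move: v; rewrite /pw -mulrA; apply: ghostly_lv.
  have h : forall r, ghostly_all true (size r) ((size r)%:Z - (size q.2)%:Z)
      (\prod_(e <- r) le e * gw q.1 (rev q.2)).
    elim=> [|e r IHr]; first by rewrite big_nil mul1r; apply: ghostly_gw; rewrite size_rev sub0r opprK /=.
    by rewrite big_cons -mulrA /= intS [1 + _]addrC addrAC; exact: ghostly_le.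
  rewrite -pn; exact: h.
exists (M + N)%N => v; rewrite big_cons; apply: ghostlyD.
  by apply: ghostly_leq (hM v); rewrite leq_addr.
by apply: ghostly_leq (hN v); rewrite leq_addl.
Qed.

(* The real path dual to the ghost path gw w r. *)
Fixpoint rw w r : L := if r is e :: r' then rw w r' * le e else lv w.

Lemma gw_rw w r (q : seq (edge E)) v u : gok w r v -> gok w q u -> size r = size q ->
  gw w r * rw w q = lv v *+ (r == q).
Proof.
elim: r q v u => [|e r IH] [|f q] v u //=.
  by move=> /eqP <- _ _; rewrite lvv.
move=> /andP[/eqP <- okr] /andP[_ okq] [sz].
rewrite -mulrA (mulrA (gw w r)) (IH _ _ _ okr okq sz) eqseq_cons andbC.
have [rq|] := eqVneq r q; last by rewrite mulr0n mul0r mulr0 mulr0n.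
by rewrite /= mulr1n mulrA lg_lv lg_le.
Qed.

(** The leaves of a homogeneous element are combinations of ghost words of a single length.
    Multiplying a leaf on the right by the real path dual to one word isolates a vertex times its
    coefficient. That vertex is therefore in [J], and the word is in the ideal that the vertex
    generates. *)
Lemma graded_hidealE (J : ideal L) : graded J ->
  forall x, J x <-> hideal K (ideal_vertices J) x.
Proof.
move=> gJ x; split; last by apply: hideal_sub; exact: fintype.subxx.
set H := ideal_vertices J; move=> /gJ[s [sP ->]]; rewrite big_seq; apply: ideal_sum.
move=> y /sP[Jy [n /homogeneous_ghostly[N hN]]].
suff main M m v z : ghostly true M m v z -> J (lv v * z) -> hideal K H (lv v * z).
  rewrite -[y]mul1r -lv_sum mulr_suml; apply: ideal_sum => v _.
  by apply: main (hN v) _; exact: idealMl.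
have leaf m' v' z' : ghost_leaf true m' v' z' -> J z' -> hideal K H z'.
  move=> hz Jz; rewrite -[z']mulr1 -lv_sum mulr_sumr; apply: ideal_sum => w _.
  have [l [a [ul ok zE]]] := hz w; rewrite zE big_seq; apply: ideal_sum => r rl.
  have [->|ar] := eqVneq (a r) 0; first by rewrite rmorph0 mul0r; exact: ideal0.
  have /andP[okr /= /eqP szr] := ok r rl.
  rewrite -(lv_gw K okr) mulrA; apply: (@idealMr _ (hideal K H)).
  apply: (@idealMl _ (hideal K H)); apply: hideal_lv.
  apply/ideal_verticesP.
  have -> : lv v' = lc (a r)^-1 * (z' * lv w * rw w r).
    rewrite zE mulr_suml (bigD1_seq r) //= big1_seq ?addr0.
      rewrite -mulrA (gw_rw okr okr) // eqxx mulr1n mulrA -rmorphM mulVf //.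
      by rewrite rmorph1 mul1r.
    move=> q /andP[qr ql]; have /andP[okq /= /eqP szq] := ok q ql.
    rewrite -mulrA (gw_rw okq okr); first by rewrite (negPf qr) mulr0n mulr0.
    by apply/eqP; rewrite -eqz_nat szr szq.
  by apply: idealMl; apply: idealMr; exact: idealMr.
elim: M m v z => [|M IH] m v z /=; first exact: leaf.
case: asboolP => [_|nsv hz Jz]; first exact: leaf.
rewrite (lv_CK2 K nsv) mulr_suml; apply: (@ideal_sum _ (hideal K H)) => e /eqP ev.
rewrite -mulrA -le_lv -mulrA; apply: (@idealMl _ (hideal K H)); apply: IH; first exact: hz.
by rewrite mulrA lv_lg -lg_lv ev -mulrA; exact: idealMl.
Qed.

(** Elements are sums of products a v b. Homogeneous pieces are followed through left
    multiplications only, so b is first decomposed in the ideal [T] of all elements; multiplying by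
    v brings its pieces into the ideal. *)
Lemma hideal_graded (H : {set vertex E}) : graded (hideal K H).
Proof.
pose G (J : ideal L) x := exists s : seq L,
  (forall y, y \in s -> J y /\ exists n, homogeneous n y) /\ x = \sum_(y <- s) y.
have Gmap (J J' : ideal L) a x : (forall y, J y -> J' (a * y)) ->
    (forall n y, homogeneous n y -> exists m, homogeneous m (a * y)) -> G J x -> G J' (a * x).
  move=> Ja ha [s [sP ->]]; exists [seq a * y | y <- s]; split; last by rewrite big_map mulr_sumr.
  by move=> _ /mapP[y /sP[Jy [n /ha hn]] ->]; split; [exact: Ja|].
have Gadd (J : ideal L) x y : G J x -> G J y -> G J (x + y).
  move=> [s [sP ->]] [t [tP ->]]; exists (s ++ t); split; last by rewrite big_cat.
  by move=> z; rewrite mem_cat => /orP[/sP|/tP].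
have Gmul (J : ideal L) b : G J b -> forall a, G J (a * b).
  move=> Gb; elim/lpa_ind => [|x y Gx Gy|c x Gx|v x Gx|e x Gx|e x Gx].
  - by rewrite mul1r.
  - by rewrite mulrDl; exact: Gadd.
  - rewrite -mulrA; apply: Gmap Gx => [y|n y hy]; first exact: idealMl.
    by exists n; apply: homogeneous_map hy => z; exact: monomial_lc.
  - rewrite -mulrA; apply: Gmap Gx => [y|n y hy]; first exact: idealMl.
    by exists n; apply: homogeneous_map hy => z; exact: monomial_lv.
  - rewrite -mulrA; apply: Gmap Gx => [y|n y hy]; first exact: idealMl.
    by exists (n + 1); apply: homogeneous_map hy => z; exact: monomial_le.
  - rewrite -mulrA; apply: Gmap Gx => [y|n y hy]; first exact: idealMl.
    by exists (n - 1); apply: homogeneous_map hy => z; exact: monomial_lg.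
pose T : ideal L := gen_ideal [set: L].
have TT x : T x by apply: mem_gen_ideal.
have GT x : G T x.
  rewrite -[x]mulr1; apply: Gmul; rewrite -lv_sum; elim/big_ind: _ => [||v _].
  - by exists [::]; split; rewrite ?big_nil.
  - exact: Gadd.
  - exists [:: lv v]; split; last by rewrite big_seq1.
    move=> y; rewrite inE => /eqP ->; split=> //; exists 0; apply/homogeneousP.
    exists [:: lv v]; split; last by rewrite big_seq1.
    move=> z; rewrite inE => /eqP ->; right; exists 1, (v, [::]), (v, [::]); split=> //.
    by rewrite /pw big_nil mulr1 rmorph1 mul1r /= lvv.
move=> x /gen_idealE[l lP ->]; elim: l lP => [|t l IH] lP.
  by exists [::]; split; rewrite ?big_nil.
rewrite big_cons; apply: Gadd; last by apply: IH => u ul; apply: lP; rewrite inE ul orbT.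
have [v vH ->] := lP t (mem_head _ _); rewrite -mulrA; apply: Gmul.
apply: Gmap (GT t.2) => [y _|n y hy]; first by apply: idealMr; exact: hideal_lv.
by exists n; apply: homogeneous_map hy => z; exact: monomial_lv.
Qed.

Definition only_hs (H : {set vertex E}) : Prop :=
  [/\ hereditary H, saturated H, H != finset.set0, H != finset.setT
    & forall D : {set vertex E}, hereditary D -> saturated D ->
        [\/ D = finset.set0, D = finset.setT | D = H]].

Lemma only_hs_graded H : only_hs H -> only_nontrivial_graded (hideal K H).
Proof.
move=> [hH sH H0 HT uniqH]; split.
  split; first exact: hideal_graded.
  - have /set0Pn[v vH] := H0; exists (lv v); first exact: hideal_lv.
    exact: lv_neq0.
  - apply: contrapT => no; case/eqP: HT; apply/setP => v; rewrite inE.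
    apply/(hideal_lvP K hH sH); apply: contrapT => nv; apply: no; by exists (lv v).
move=> J [gJ [x Jx x0] [y nJy]] z; rewrite (graded_hidealE gJ).
have JE := graded_hidealE gJ.
case: (uniqH _ (ideal_vertices_hereditary J) (ideal_vertices_saturated J)) => JH.
- case/eqP: x0; move/JE: Jx; rewrite JH => /gen_idealE[l lP ->].
  by rewrite big_seq big1 // => t /lP[v]; rewrite inE.
- case: nJy; apply/JE; rewrite JH -[y]mul1r -lv_sum mulr_suml; apply: ideal_sum => v _.
  by apply: idealMr; apply: hideal_lv; rewrite inE.
- by rewrite JH.
Qed.

End GradedIdeals.

(** By uniqueness, the graded ideals may be taken to be those generated by [G] and [H], whose
    quotients are the algebras of the quotient graphs. *)
Lemma LI_isomorphicP (K : fieldType) (E F : graph) (G : {set vertex E}) (H : {set vertex F})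
    (hG : hereditary G) (hH : hereditary H) : only_hs G -> only_hs H ->
  LI_isomorphic K E F <->
  ring_isomorphic (lpa K (quotient_graph hG)) (lpa K (quotient_graph hH)).
Proof.
move=> oG oH; have [_ sG _ _ _] := oG; have [_ sH _ _ _] := oH.
have [nG GE] := only_hs_graded K oG; have [nH HE] := only_hs_graded K oH.
have iG := quotient_iso K hG sG; have iH := quotient_iso K hH sH.
have pq (R : pzRingType) (I J : ideal R) : (forall x, I x <-> J x) ->
    ring_isomorphic (quot_ring I) (quot_ring J).
  move=> IJ; apply: (@quot_ring_iso _ _ idfun idfun) => // x; [exact: (IJ x).1|exact: (IJ x).2].
split=> [[I [J [[nI _] [nJ _] IJ]]]|GH].
  apply: ring_iso_trans (ring_iso_sym iG) _; apply: ring_iso_trans iH.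
  apply: ring_iso_trans (pq _ _ _ _) _; last first.
    apply: ring_iso_trans IJ _; apply: pq; exact: HE.
  by move=> x; rewrite -(GE _ nI).
exists (hideal K G), (hideal K H); split; [exact: only_hs_graded|exact: only_hs_graded|].
by apply: ring_iso_trans iG _; apply: ring_iso_trans GH _; exact: ring_iso_sym.
Qed.

(** * Adjacency matrices *)

Definition mx n (a : nat -> nat -> bool) : seq (seq bool) :=
  [seq [seq a i j | j <- iota 0 n] | i <- iota 0 n].

Definition ent (m : seq (seq bool)) i j : bool := nth false (nth [::] m i) j.

Definition submx (m : seq (seq bool)) (p : seq nat) :=
  [seq [seq ent m i j | j <- p] | i <- p].

Definition shiftm i j m := mx (size m) (fun k l =>
  if k == i then (ent m i l && ~~ ent m j l) || (l == j) else ent m k l).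

Definition shiftable m i j :=
  [&& i != j, has (ent m j) (iota 0 (size m)), all (fun l => ent m j l ==> ent m i l) (iota 0 (size m))
    & ent m i j ==> ent m j j].

(* The new vertex is numbered 0. *)
Definition splitm i (p : pred nat) m :=
  let base k := if k is k'.+1 then k' else i in
  mx (size m).+1 (fun k l => if k is k'.+1 then ent m k' (base l) && ((k' != i) || p (base l))
    else ent m i (base l) && ~~ p (base l)).

Definition splittable m i (p : pred nat) :=
  has (fun j => ent m i j && p j) (iota 0 (size m)) &&
  has (fun j => ent m i j && ~~ p j) (iota 0 (size m)).

Section Presentation.
Variable E : graph.
Implicit Types (v w : vertex E) (m : seq (seq bool)).

Definition adj v w := [exists e, (src e == v) && (rng e == w)].

Lemma adjP v w : reflect (exists2 e, src e = v & rng e = w) (adj v w).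
Proof.
apply: (iffP existsP) => [[e /andP[/eqP se /eqP re]]|[e se re]]; first by exists e.
by exists e; rewrite se re !eqxx.
Qed.

Lemma adj_edge (e : edge E) : adj (src e) (rng e).
Proof. by apply/adjP; exists e. Qed.

Definition listing (vs : seq (vertex E)) : Prop := uniq vs /\ forall v, v \in vs.

Definition presented vs m : Prop :=
  [/\ condition_Sing E, listing vs & m = [seq [seq adj v w | w <- vs] | v <- vs]].

Lemma listing_perm vs : listing vs -> perm_eq (index_enum (vertex E)) vs.
Proof.
move=> [u h]; apply: uniq_perm => //; first exact: index_enum_uniq.
by move=> v; rewrite h mem_index_enum.
Qed.

Lemma presented_size vs m : presented vs m -> size vs = size m.
Proof. by case=> _ _ ->; rewrite size_map. Qed.

Lemma size_listing vs : listing vs -> size vs = #|vertex E|.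
Proof. by move=> h; rewrite -(perm_size (listing_perm h)) cardT enumT. Qed.

Lemma presented_ent vs m v w : presented vs m -> ent m (index v vs) (index w vs) = adj v w.
Proof.
move=> [_ [u h] ->]; rewrite /ent (nth_map v) ?index_mem // (nth_map v) ?index_mem //.
by rewrite !nth_index.
Qed.

Lemma presented_nth vs m v0 i j : presented vs m -> (i < size m)%N -> (j < size m)%N ->
  ent m i j = adj (nth v0 vs i) (nth v0 vs j).
Proof.
move=> pm im jm; have [_ [u h] _] := pm; rewrite -(presented_ent _ _ pm).
by rewrite !index_uniq ?(presented_size pm).
Qed.

Lemma presented_submx vs m p : presented vs m -> perm_eq p (iota 0 (size m)) ->
  exists vs', presented vs' (submx m p).
Proof.
move=> pm pp; have [sing ls mE] := pm; have [u h] := ls.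
have pn i : i \in p -> (i < size m)%N by rewrite (perm_mem pp) mem_iota.
case: vs => [|v0 vs] in pm mE ls u h *.
  exists [::]; split=> //; move: pp; rewrite mE /=.
  by move=> /perm_nilP ->.
exists [seq nth v0 (v0 :: vs) i | i <- p]; split=> //.
  have e : perm_eq [seq nth v0 (v0 :: vs) i | i <- p] (v0 :: vs).
    rewrite (perm_trans (perm_map _ pp)) // -(presented_size pm).
    by rewrite -/(mkseq _ _) mkseq_nth.
  by split=> [|v]; [rewrite (perm_uniq e)|rewrite (perm_mem e)].
rewrite -map_comp; apply/eq_in_map => i /pn im /=.
rewrite -map_comp; apply/eq_in_map => j /pn jm /=.
exact: presented_nth pm im jm.
Qed.

End Presentation.

Lemma presented_rel (V : finType) (r : rel V) (vs : seq V) : uniq vs -> (forall v, v \in vs) ->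
  @presented (rel_graph r) vs [seq [seq r v w | w <- vs] | v <- vs].
Proof.
move=> u h; split=> //.
  by move=> [[a b] e] [[c d] f] /= ac bd; apply: val_inj; rewrite /= ac bd.
apply: eq_map => v; apply: eq_map => w; apply/idP/adjP => [vw|[[[a b] /= e] <- <-]] //.
by exists (exist _ (v, w) vw : edge (rel_graph r)).
Qed.

Lemma presented_ord n (a : nat -> nat -> bool) :
  @presented (rel_graph (fun i j : 'I_n => a i j)) (enum 'I_n) (mx n a).
Proof.
have := @presented_rel _ (fun i j : 'I_n => a i j) _ (enum_uniq 'I_n) (mem_enum 'I_n).
congr (presented _ _); rewrite /mx -val_enum_ord -map_comp; apply: eq_map => i /=.
by rewrite -map_comp.
Qed.

Definition mgraph (m : seq (seq bool)) : graph :=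
  rel_graph (fun i j : 'I_(size m) => ent m i j).

Definition square m := mx (size m) (ent m) == m.

Lemma presented_mgraph m : square m -> @presented (mgraph m) (enum 'I_(size m)) m.
Proof. by move=> /eqP sq; have := presented_ord (size m) (ent m); rewrite sq. Qed.

Lemma presented_iso (K : fieldType) (E F : graph) (vs : seq (vertex E)) (ws : seq (vertex F)) m :
  presented vs m -> presented ws m -> ring_isomorphic (lpa K E) (lpa K F).
Proof.
move=> pE pF; have [singE [uE hE] _] := pE; have [singF [uF hF] _] := pF.
have sz : size vs = size ws by rewrite (presented_size pE) (presented_size pF).
case: vs ws => [|v0 vs] [|w0 ws] in pE pF uE hE uF hF sz *; rewrite //= in sz.
- have noV (v : vertex E) : False by have := hE v.
  have noW (v : vertex F) : False by have := hF v.
  have noE (e : edge E) : False by exact: noV (src e).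
  have noF (e : edge F) : False by exact: noW (src e).
  apply: (@graph_iso K E F (fun v => match noV v with end) (fun e => match noE e with end)).
  + by exists (fun v => match noW v with end) => v; [case: (noV v)|case: (noW v)].
  + by exists (fun v => match noF v with end) => v; [case: (noE v)|case: (noF v)].
  + by move=> e; case: (noE e).
  + by move=> e; case: (noE e).
set vs1 := v0 :: vs in pE uE hE; set ws1 := w0 :: ws in pF uF hF.
have sz1 : size vs1 = size ws1 by rewrite /= sz.
pose fv (v : vertex E) := nth w0 ws1 (index v vs1).
pose gv (w : vertex F) := nth v0 vs1 (index w ws1).
have fgv : cancel fv gv.
  by move=> v; rewrite /gv /fv index_uniq ?nth_index // -sz1 index_mem.
have gfv : cancel gv fv.
  by move=> w; rewrite /gv /fv index_uniq ?nth_index // sz1 index_mem.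
have fadj v w : adj (fv v) (fv w) = adj v w.
  have lt u : (index u vs1 < size m)%N by rewrite -(presented_size pE) index_mem.
  by rewrite -(presented_ent _ _ pE) (presented_nth w0 pF).
have fe (e : edge E) : {f : edge F | src f = fv (src e) /\ rng f = fv (rng e)}.
  apply: cid; have : adj (fv (src e)) (fv (rng e)) by rewrite fadj adj_edge.
  by case/adjP => f sf rf; exists f.
have ge (f : edge F) : {e : edge E | fv (src e) = src f /\ fv (rng e) = rng f}.
  apply: cid; have : adj (gv (src f)) (gv (rng f)) by rewrite -fadj !gfv adj_edge.
  by case/adjP => e se re; exists e; rewrite se re !gfv.
apply: (@graph_iso K E F fv (fun e => sval (fe e))).
- by exists gv.
- exists (fun f => sval (ge f)) => [e|f].
    case: (fe e) => f [sf rf] /=; case: (ge f) => e' [se re] /=.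
    by apply: singE; apply: (can_inj fgv); rewrite ?se ?re.
  case: (ge f) => e [se re] /=; case: (fe e) => f' [sf rf] /=.
  by apply: singF; rewrite ?sf ?rf.
- by move=> e; case: (fe e) => f [].
- by move=> e; case: (fe e) => f [].
Qed.

Lemma presented_model (K : fieldType) (E : graph) (vs : seq (vertex E)) m :
  presented vs m -> square m -> ring_isomorphic (lpa K E) (lpa K (mgraph m)).
Proof. by move=> pE /presented_mgraph; exact: (presented_iso K pE). Qed.

Section Moves.
Variable K : fieldType.
Implicit Type m : seq (seq bool).

Lemma ent_mx n (a : nat -> nat -> bool) i j : (i < n)%N -> (j < n)%N -> ent (mx n a) i j = a i j.
Proof.
by move=> li lj; rewrite /ent (nth_map 0%N) ?size_iota // (nth_map 0%N) ?size_iota // !nth_iota.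
Qed.

Lemma eq_mx n (a b : nat -> nat -> bool) :
  (forall i j, (i < n)%N -> (j < n)%N -> a i j = b i j) -> mx n a = mx n b.
Proof.
move=> ab; apply/eq_in_map => i; rewrite mem_iota => /= li.
by apply/eq_in_map => j; rewrite mem_iota => /= lj; exact: ab.
Qed.

Lemma square_mx n (a : nat -> nat -> bool) : square (mx n a).
Proof.
rewrite /square {1}/mx !size_map size_iota -/(mx _ _); apply/eqP/eq_mx => i j li lj.
exact: ent_mx.
Qed.

Lemma submxE m p :
  submx m p = mx (size p) (fun i j => ent m (nth 0%N p i) (nth 0%N p j)).
Proof.
rewrite /submx -{1 2}(mkseq_nth 0%N p) /mkseq -map_comp; apply: eq_map => i /=.
by rewrite -map_comp.
Qed.

Lemma square_submx m p : square (submx m p).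
Proof. by rewrite submxE; exact: square_mx. Qed.

Lemma submx_iso m p : square m -> perm_eq p (iota 0 (size m)) ->
  ring_isomorphic (lpa K (mgraph m)) (lpa K (mgraph (submx m p))).
Proof.
move=> sq /(presented_submx (presented_mgraph sq))[vs pm].
exact: (presented_model K pm (square_submx m p)).
Qed.

Lemma shiftm_iso m i j : (i < size m)%N -> (j < size m)%N -> shiftable m i j ->
  ring_isomorphic (lpa K (mgraph m)) (lpa K (mgraph (shiftm i j m))).
Proof.
move=> li lj /and4P[ij /hasP[k0 ]]; rewrite mem_iota => /= lk jk /allP ji sing.
pose v := Ordinal li; pose w := Ordinal lj; pose r := fun i j : 'I_(size m) => ent m i j.
apply: ring_iso_trans (@shift_iso K _ r v w _ _ _ _) _.
- exact: ij.
- by exists (Ordinal lk).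
- by move=> l jl; have := ji l; rewrite mem_iota /= ltn_ord => /(_ isT)/implyP; exact.
- exact: implyP.
apply: presented_model; last exact: square_mx.
have := @presented_ord (size m) (fun k l =>
  if k == i then (ent m i l && ~~ ent m j l) || (l == j) else ent m k l).
by congr (@presented (rel_graph _) _ _); apply: funext => k; apply: funext => l.
Qed.

Lemma splitm_iso m i (p : pred nat) : square m -> (i < size m)%N -> splittable m i p ->
  ring_isomorphic (lpa K (mgraph (splitm i p m))) (lpa K (mgraph m)).
Proof.
move=> sq li /andP[/hasP[k + hk] /hasP[l + hl]]; rewrite !mem_iota => /= lk ll.
pose v := Ordinal li; pose r := fun i j : 'I_(size m) => ent m i j.
pose q (j : 'I_(size m)) := p j.
have := @split_iso K _ r v q; move=> split; apply: ring_iso_trans (split _ _); last 2 first.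
- by exists (Ordinal lk).
- by exists (Ordinal ll).
apply: ring_iso_sym.
pose vs : seq (option 'I_(size m)) := None :: map some (enum 'I_(size m)).
have uvs : uniq vs.
  rewrite /= map_inj_uniq ?enum_uniq ?andbT; last by move=> x y [].
  by apply/mapP => -[].
have hvs x : x \in vs.
  by case: x => [x|]; rewrite inE //= map_f // mem_enum.
pose code (x : option 'I_(size m)) : nat := if x is Some y then y.+1 else 0%N.
have codeE : map code vs = iota 0 (size m).+1.
  by rewrite /= (iotaDl 1 0) -val_enum_ord -!map_comp.
move: vs uvs hvs codeE => vs uvs hvs codeE.
apply: (@presented_model K (rel_graph (split_rel r v q)) vs); last exact: square_mx.
have := presented_rel (split_rel r v q) uvs hvs; congr (presented _ _).
rewrite /splitm /mx -codeE -[RHS]map_comp; apply: eq_map => x; rewrite -[RHS]map_comp.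
apply: eq_map => y /=.
by case: x => [x|]; case: y => [y|].
Qed.

End Moves.

(** * Evaluation of the graph notions on matrices *)

Fixpoint seqs (T : Type) n (l : seq T) : seq (seq T) :=
  if n is k.+1 then [seq x :: s | x <- l, s <- seqs k l] else [:: [::]].

Lemma mem_seqs (T : eqType) n (l s : seq T) :
  (s \in seqs n l) = (size s == n) && all (mem l) s.
Proof.
elim: n s => [|n IH] [|x s] //=.
  by apply/negP => /allpairsP[[y t] [_ _]].
apply/allpairsP/andP => [[[y t] /= [yl]]|[/eqP[sn] /andP[xl sl]]].
  by rewrite IH => /andP[/eqP <- tl] [-> ->]; rewrite yl.
by exists (x, s); rewrite IH sn eqxx.
Qed.

Lemma uniq_seqs (T : eqType) n (l : seq T) : uniq l -> uniq (seqs n l).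
Proof.
move=> ul; elim: n => [|n IH] //=.
by apply: allpairs_uniq => // -[x s] [y t] _ _ /= [-> ->].
Qed.

Definition idx (m : seq (seq bool)) := iota 0 (size m).

Definition subsets (m : seq (seq bool)) := seqs (size m) [:: false; true].

Definition sinkm m i := ~~ has (ent m i) (idx m).

Definition hereditarym m b := all (fun i => nth false b i ==>
  all (fun j => ent m i j ==> nth false b j) (idx m)) (idx m).

Definition saturatedm m b := all (fun i =>
  has (ent m i) (idx m) && all (fun j => ent m i j ==> nth false b j) (idx m) ==>
  nth false b i) (idx m).

Definition hsm m b := hereditarym m b && saturatedm m b.

Definition HSm m := (count (hsm m) (subsets m) - 2)%N.

Definition ILNm m := count (fun i => ent m i i &&
  all (fun j => (i == j) || ~~ ent m i j && ~~ ent m j i) (idx m)) (idx m).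

(** Reachability as membership in every hereditary set that contains the source, the reachable
    vertices forming the least such set; this avoids a search for paths. *)
Definition reachesm m i j :=
  all (fun b => hereditarym m b && nth false b i ==> nth false b j) (subsets m).

Definition MT3m m := all (fun i => all (fun j =>
  has (fun k => reachesm m i k && reachesm m j k) (idx m)) (idx m)) (idx m).

(* A set of vertices in which every vertex emits one edge, which stays in the set,
   contains a cycle without exit. *)
Definition Lm m := ~~ has (fun b => has id b && all (fun i => nth false b i ==>
  (count (ent m i) (idx m) == 1%N) &&
  all (fun j => ent m i j ==> nth false b j) (idx m)) (idx m)) (subsets m).

Section Combinatorics.
Variables (E : graph) (vs : seq (vertex E)) (m : seq (seq bool)).
Hypothesis pm : presented vs m.
Implicit Types (v w u : vertex E) (H : {set vertex E}) (b : seq bool).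

Let sing : condition_Sing E. Proof. by case: pm. Qed.
Let uvs : uniq vs. Proof. by case: pm => _ []. Qed.
Let hvs v : v \in vs. Proof. by case: pm => _ []. Qed.
Local Notation ix v := (index v vs).

Lemma idxE : idx m = [seq ix v | v <- vs].
Proof.
rewrite /idx -(presented_size pm); apply: (@eq_from_nth _ 0%N).
  by rewrite size_iota size_map.
move=> i; rewrite size_iota => li; rewrite nth_iota //.
by case: vs uvs li => // v0 vs' u li; rewrite (nth_map v0) //; exact/esym/index_uniq.
Qed.

Lemma allP_idx (P : pred nat) : reflect (forall v, P (ix v)) (all P (idx m)).
Proof.
rewrite idxE all_map; apply: (iffP allP) => h v; last by move=> _; exact: h.
exact/h/hvs.
Qed.

Lemma hasP_idx (P : pred nat) : reflect (exists v, P (ix v)) (has P (idx m)).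
Proof.
rewrite idxE has_map; apply: (iffP hasP) => [[v _ Pv]|[v Pv]]; first by exists v.
by exists v.
Qed.

Lemma card_idx (P : pred (vertex E)) (Q : pred nat) : (forall v, P v = Q (ix v)) ->
  #|[set v | P v]| = count Q (idx m).
Proof.
move=> PQ; rewrite idxE count_map -size_filter.
have u : uniq [seq v <- vs | preim (index^~ vs) Q v] by rewrite filter_uniq.
rewrite -(card_uniqP u); apply: eq_card => v.
by rewrite inE mem_filter hvs andbT PQ.
Qed.

Lemma entE v w : ent m (ix v) (ix w) = adj v w.
Proof. exact: presented_ent. Qed.

Definition bits H := [seq v \in H | v <- vs].
Definition setb b : {set vertex E} := [set v | nth false b (ix v)].

Lemma bitsE H v : nth false (bits H) (ix v) = (v \in H).
Proof. by rewrite (nth_map v) ?index_mem // nth_index. Qed.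

Lemma bitsK H : setb (bits H) = H.
Proof. by apply/setP => v; rewrite inE bitsE. Qed.

Lemma mem_bits H : bits H \in subsets m.
Proof.
rewrite mem_seqs size_map (presented_size pm) eqxx /=.
by apply/allP => -[]; rewrite !inE.
Qed.

Lemma setbK b : b \in subsets m -> bits (setb b) = b.
Proof.
rewrite mem_seqs => /andP[/eqP sb _].
apply: (@eq_from_nth _ false); first by rewrite size_map (presented_size pm).
move=> i; rewrite size_map => li.
have /mapP[v _ ->] : i \in [seq ix v | v <- vs].
  by rewrite -idxE mem_iota -(presented_size pm).
by rewrite bitsE inE.
Qed.

Lemma subsetsP (P : pred (seq bool)) :
  reflect (forall H, P (bits H)) (all P (subsets m)).
Proof.
apply: (iffP allP) => [h H|h b bm]; first exact/h/mem_bits.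
by rewrite -(setbK bm).
Qed.

Lemma sinkP v : reflect (sink v) (sinkm m (ix v)).
Proof.
apply: (iffP idP) => [/hasP_idx no e ev|sv].
  by apply: no; exists (rng e); rewrite entE -ev adj_edge.
by apply/hasP_idx => -[w]; rewrite entE => /adjP[e /sv].
Qed.

Lemma hereditarymE H : hereditary H = hereditarym m (bits H).
Proof.
apply/hereditaryP/allP_idx => h.
  move=> v; rewrite bitsE; apply/implyP => vH; apply/allP_idx => w; rewrite bitsE entE.
  by apply/implyP => /adjP[e se <-]; apply: h; rewrite se.
move=> e; have := h (src e); rewrite bitsE => /implyP he /he /allP_idx /(_ (rng e)).
by rewrite bitsE entE adj_edge.
Qed.

Lemma saturatedmE H : saturated H = saturatedm m (bits H).
Proof.
apply/saturatedP/allP_idx => h v.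
  rewrite bitsE; apply/implyP => /andP[nsv /allP_idx hr]; apply: h.
    by move/sinkP; rewrite /sinkm nsv.
  by move=> e ev; have := hr (rng e); rewrite bitsE entE -ev adj_edge.
move=> nsv hr; have := h v; rewrite bitsE => /implyP; apply; apply/andP; split.
  by apply/negPn/negP => /sinkP.
apply/allP_idx => w; rewrite entE bitsE; apply/implyP => /adjP[e ev <-].
exact: hr.
Qed.

Lemma HSmE : HS E = HSm m.
Proof.
congr (_ - _)%N; rewrite -size_filter -(size_map setb).
have u : uniq [seq setb b | b <- subsets m & hsm m b].
  rewrite map_inj_in_uniq ?filter_uniq ?uniq_seqs // => b c.
  by rewrite !mem_filter => /andP[_ /setbK {2}<-] /andP[_ /setbK {2}<-] ->.
rewrite -(card_uniqP u); apply: eq_card => H; rewrite inE hereditarymE saturatedmE.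
apply/idP/mapP => [hH|[b]]; last by rewrite mem_filter => /andP[hb bm] ->; rewrite setbK.
by exists (bits H); rewrite ?bitsK // mem_filter mem_bits andbT.
Qed.

Lemma ILNmE : ILN E = ILNm m.
Proof.
apply: card_idx => u; rewrite /isolated_loop entE; congr (_ && _).
  apply/eqP/adjP => [h|[e se re]].
    have /card_gt0P[e] : (0 < #|[set e | (src e == u) && (rng e == u)]|)%N by rewrite h.
    by rewrite inE => /andP[/eqP se /eqP re]; exists e.
  rewrite -(cards1 e); apply: eq_card => f; rewrite !inE; apply/andP/eqP => [[/eqP sf /eqP rf]|->].
    by apply: sing; rewrite ?se ?re.
  by rewrite se re eqxx.
apply/forallP/allP_idx => h w.
  have [->|uw] := eqVneq u w; first by rewrite eqxx.
  rewrite !entE; apply/orP; right; apply/andP; split; apply/adjP => -[e se re].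
    by have := h e; rewrite se re eqxx eq_sym (negPf uw).
  by have := h e; rewrite se re eqxx eq_sym (negPf uw).
apply/implyP => /orP[/eqP wu|/eqP wu]; rewrite wu eqxx ?andbT /=.
  have := h (rng w); rewrite !entE -wu adj_edge /= orbF => /eqP hi.
  by apply/eqP; rewrite -(nth_index (src w) (hvs (rng w))) -hi nth_index.
have := h (src w); rewrite !entE -wu adj_edge /= andbF orbF => /eqP hi.
by apply/eqP; rewrite -(nth_index (src w) (hvs (src w))) -hi nth_index.
Qed.

Lemma reachesmE v w : reaches v w = reachesm m (ix v) (ix w).
Proof.
apply/idP/subsetsP => [vw H|h].
  rewrite -hereditarymE !bitsE; apply/implyP => /andP[/forall_inP hH /hH /forallP/(_ w)].
  by rewrite vw.
have := h [set u | reaches v u]; rewrite -hereditarymE !bitsE !inE /reaches connect0 andbT.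
move=> /implyP; apply; apply/hereditaryP => e; rewrite !inE => ve.
by apply: (connect_trans ve); apply: connect1; exact: adj_edge.
Qed.

Lemma MT3mP : condition_MT3 E <-> MT3m m.
Proof.
split=> [h|/allP_idx h v w].
  apply/allP_idx => v; apply/allP_idx => w; have [u [vu wu]] := h v w.
  by apply/hasP_idx; exists u; rewrite -!reachesmE vu.
have /allP_idx/(_ w)/hasP_idx[u] := h v; rewrite -!reachesmE => /andP[vu wu].
by exists u.
Qed.

(** The only edge at each vertex defines a map of H into itself; a periodic orbit of it is a cycle,
    whose edges are alone at their sources. *)
Lemma no_exit_cycle H : H != finset.set0 ->
  (forall v, v \in H -> exists e, [/\ src e = v, rng e \in H & forall f, src f = v -> f = e]) ->
  ~ condition_L E.
Proof.
move=> /set0Pn[v0 v0H] h L.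
have [e0 _] : exists e0 : edge E, true by have [e _] := h _ v0H; exists e.
pose out v := odflt e0 [pick e | src e == v]; pose nx v := rng (out v).
have outP v : v \in H -> [/\ src (out v) = v, nx v \in H & forall f, src f = v -> f = out v].
  move=> /h[e [se re ue]]; have outE : out v = e.
    by rewrite /out; case: pickP => [f /eqP /ue //|/(_ e)]; rewrite se eqxx.
  by rewrite /nx outE.
have [i [k per]] := iter_periodic nx v0; set u := iter i nx v0 in per.
have iH j : iter j nx u \in H.
  rewrite /u -iterD; elim: (j + i)%N => //= a IH.
  by have [_ ->] := outP _ IH.
have oH v : v \in orbit nx u -> v \in H.
  by rewrite -fconnect_orbit => /iter_findex <-; exact: iH.
have cyc : fcycle nx (orbit nx u) by apply/(@orbitPcycle _ nx u 0 3); exists k.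
have [|e [f [/mapP[v /oH vH ->] se]]] := L [seq out v | v <- orbit nx u].
- rewrite /is_cycle -map_comp; apply/and3P; split.
  + by case: (orbit nx u) (in_orbit nx u).
  + rewrite cycle_map; apply: sub_in_cycle cyc => [v w|]; last first.
      by apply/allP => v; exact: oH.
    move=> vH wH /eqP vw; rewrite /= /follows -/(nx v) vw.
    by have [->] := outP _ wH.
  + rewrite (_ : map _ _ = orbit nx u) ?orbit_uniq // -[RHS]map_id.
    by apply/eq_in_map => v /oH /outP[].
- case; move: se; have [sv _ uv] := outP _ vH; rewrite sv => se.
  exact: uv.
Qed.

Lemma LmP : condition_L E <-> Lm m.
Proof.
split=> [L|/hasPn h es /and3P[es0 ces ues]].
  apply/negP => /hasP[b bm /andP[/hasP[[] // /(nthP false)[i ib bi] _] /allP_idx hb]].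
  have bE := setbK bm; apply: (@no_exit_cycle (setb b)) L.
    have li : (i < size vs)%N by move: ib; rewrite -{1}bE size_map.
    have v0 : vertex E by case: (vs) li.
    by apply/set0Pn; exists (nth v0 vs i); rewrite inE index_uniq // bi.
  move=> v; rewrite inE => vb; have /implyP/(_ vb)/andP[/eqP c1 /allP_idx hr] := hb v.
  have /hasP_idx[w] : has (ent m (ix v)) (idx m) by rewrite has_count c1.
  rewrite entE => /adjP[e ev re]; exists e; split=> //.
    have := hr (rng e); rewrite entE -ev adj_edge inE; exact.
  move=> f fv; apply: sing; first by rewrite fv ev.
  (* The row counts neighbours; by [sing] a single neighbour means a single edge. *)
  have c : #|[set w | adj v w]| = 1%N by rewrite -c1; apply: card_idx => u; rewrite entE.
  have /cards1P[x xE] : #|[set w | adj v w]| == 1%N by rewrite c.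
  have mx (g : edge E) : src g = v -> rng g = x.
    move=> gv; have : rng g \in [set w | adj v w] by rewrite inE -gv adj_edge.
    by rewrite xE inE => /eqP.
  by rewrite !mx.
(* The sources of the edges of a cycle without exit form a set of the kind that [Lm] excludes. *)
apply: contrapT => nox; pose H := [set src e | e in es].
have eH e f : e \in es -> src f = src e -> f = e.
  move=> ees fe; apply: contrapT => ne; apply: nox; exists f, e; split=> //.
have := h _ (mem_bits H); rewrite negb_and => /orP[/negP|/negP]; apply.
  case: es es0 {ces ues nox h eH} @H => // e es _ H; apply/hasP; exists true => //.
  apply/mapP; exists (src e) => //; apply/esym/imsetP; exists e => //.
  by rewrite inE eqxx.
apply/allP_idx => v; rewrite bitsE; apply/implyP => /imsetP[e ees ->]; apply/andP; split.
  rewrite -(card_idx (P := adj (src e))) => [|w]; last by rewrite entE.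
  rewrite -(cards1 (rng e)); apply/eqP/eq_card => w; rewrite !inE.
  apply/adjP/eqP => [[f /(eH _ _ ees) -> //]|->]; by exists e.
apply/allP_idx => w; rewrite entE bitsE; apply/implyP => /adjP[f /(eH _ _ ees) -> <-].
apply/imsetP; exists (next es e); first by rewrite mem_next.
by have /eqP := next_cycle ces ees.
Qed.

End Combinatorics.

(** * Matrices of the quotients by the socle and by the only graded ideal *)

Definition outside m b := [seq i <- idx m | ~~ nth false b i].

(** Membership in the intersection of the hereditary saturated sets containing the sinks. That this
    intersection is again such a set is not proved in general but evaluated on each matrix of
    [small]. *)
Definition in_socle m i := all (fun b =>
  hsm m b && all (fun j => sinkm m j ==> nth false b j) (idx m) ==> nth false b i)
  (subsets m).

Definition socbits m := [seq in_socle m i | i <- idx m].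

Definition socm m := submx m (outside m (socbits m)).

Definition middle m := [seq b <- subsets m | [&& hsm m b, has id b & has negb b]].

Definition lim m := submx m (outside m (head [::] (middle m))).

Section Quotients.
Variables (E : graph) (vs : seq (vertex E)) (m : seq (seq bool)).
Hypothesis pm : presented vs m.
Local Notation ix v := (index v vs).

Lemma presented_quotient (H : {set vertex E}) (hH : hereditary H) :
  exists ws : seq (vertex (quotient_graph hH)),
    presented ws (submx m (outside m (bits vs H))).
Proof.
have [sing [u h] _] := pm; pose vs' := [seq v <- vs | v \notin H].
have pE : outside m (bits vs H) = [seq ix v | v <- vs'].
  rewrite /outside (idxE pm) filter_map; congr map; apply: eq_filter => v /=.
  by rewrite (bitsE pm).
pose ws : seq (vertex (quotient_graph hH)) := pmap insub vs'.
have wsE : [seq val w | w <- ws] = vs'.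
  rewrite pmap_filter => [|v]; last exact: insubK.
  by apply/all_filterP/allP => v; rewrite mem_filter => /andP[vH _]; rewrite insubT.
exists ws; split.
- move=> e f /(congr1 val) /= se /(congr1 val) /= re; apply: val_inj; exact: sing.
- split=> [|w]; first by apply: pmap_sub_uniq; rewrite filter_uniq.
  by rewrite mem_pmap_sub mem_filter h andbT; exact: (valP w).
rewrite /submx pE -wsE -!map_comp; apply: eq_map => v /=.
rewrite -!map_comp; apply: eq_map => w /=; rewrite (entE pm).
apply/adjP/adjP => [[e se re]|[e <- <-]]; last by exists (val e).
have eH : rng e \notin H by rewrite re; exact: (valP w).
by exists (exist _ e eH : edge (quotient_graph hH)); apply: val_inj; [exact: se|exact: re].
Qed.

Lemma mem_socbits v : (v \in setb vs (socbits m)) = in_socle m (ix v).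
Proof.
have [_ [_ h] _] := pm.
by rewrite inE /socbits (idxE pm) -map_comp (nth_map v) ?index_mem //= nth_index.
Qed.

Lemma bits_socbits : bits vs (setb vs (socbits m)) = socbits m.
Proof.
rewrite /bits; under eq_map do rewrite mem_socbits.
by rewrite /socbits (idxE pm) -map_comp.
Qed.

Lemma socle_quotient (K : fieldType) : hsm m (socbits m) ->
  ring_isomorphic (quot_ring (socle (lpa K E))) (lpa K (mgraph (socm m))).
Proof.
rewrite /hsm -{1 2}bits_socbits -(hereditarymE pm) -(saturatedmE pm) => /andP[hC sC].
have sinks v : sink v -> v \in setb vs (socbits m).
  move=> /(sinkP pm) sv; rewrite mem_socbits; apply/allP => b _.
  by apply/implyP => /andP[_ /(allP_idx pm)/(_ v)/implyP]; apply.
have [ws pw] := presented_quotient hC; rewrite bits_socbits in pw.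
apply: ring_iso_trans (presented_model K pw (square_submx _ _)).
apply: ring_iso_trans (quotient_iso K hC sC).
suff soc x : socle (lpa K E) x <-> hideal K (setb vs (socbits m)) x.
  by apply: (@quot_ring_iso _ _ idfun idfun) => // x; exact: (soc x).1 || exact: (soc x).2.
move: x; apply: socle_hideal => // D hD sD sinkD; apply/fintype.subsetP => v.
rewrite mem_socbits => /(subsetsP pm)/(_ D).
rewrite /hsm -(hereditarymE pm) -(saturatedmE pm) hD sD (bitsE pm) => /implyP; apply.
by apply/(allP_idx pm) => w; rewrite (bitsE pm); apply/implyP => /(sinkP pm)/sinkD.
Qed.

Lemma socle_eq0m (K : fieldType) :
  (forall x, socle (lpa K E) x -> x = 0) <-> ~~ has (sinkm m) (idx m).
Proof.
rewrite socle_eq0; split=> [h|/(hasP_idx pm) no v sv].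
  by apply/(hasP_idx pm) => -[v /(sinkP pm)/h].
by apply: no; exists v; apply/(sinkP pm).
Qed.

Lemma socle_commm (K : fieldType) :
  (forall x y, socle (lpa K E) x -> socle (lpa K E) y -> x * y = y * x) <->
  all (fun j => sinkm m j ==> ~~ has (ent m ^~ j) (idx m)) (idx m).
Proof.
rewrite socle_comm; split=> [h|/(allP_idx pm) h e sr].
  apply/(allP_idx pm) => v; apply/implyP => /(sinkP pm) sv; apply/(hasP_idx pm) => -[w].
  by rewrite (entE pm) => /adjP[e _ re]; apply: (h e); rewrite re.
have /implyP/(_ (introT (sinkP pm _) sr))/(hasP_idx pm) := h (rng e); apply.
by exists (src e); rewrite (entE pm) adj_edge.
Qed.

Lemma middle_only_hs : size (middle m) == 1%N ->
  only_hs (setb vs (head [::] (middle m))).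
Proof.
case mE : (middle m) => [|b [|//]] // _; rewrite /=.
have : b \in middle m by rewrite mE mem_head.
rewrite mem_filter => /andP[/and3P[/andP[hb sb] b1 b0] bm].
have bE := setbK pm bm.
have bitH (H : {set vertex E}) (p : pred bool) : has p (bits vs H) -> exists v, p (v \in H).
  by rewrite has_map => /hasP[v _ pv]; exists v.
split.
- by rewrite (hereditarymE pm) bE.
- by rewrite (saturatedmE pm) bE.
- by move: b1; rewrite -bE => /bitH[v vb]; apply/set0Pn; exists v; rewrite bE in vb *.
- move: b0; rewrite -bE => /bitH[v vb]; apply: contraNneq vb => bT.
  by rewrite -{1}bE bT inE.
move=> D hD sD.
have [D0|nD0] := boolP (has id (bits vs D)); last first.
  constructor 1; apply/setP => v; rewrite inE; apply/negP => vD; case/hasP: nD0.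
  by exists true => //; apply/mapP; exists v; have [_ [_ h] _] := pm.
have [D1|nD1] := boolP (has negb (bits vs D)); last first.
  constructor 2; apply/setP => v; rewrite inE; apply/negPn/negP => vD; case/hasP: nD1.
  exists false => //; apply/mapP; exists v; first by have [_ [_ h] _] := pm.
  exact/esym/negbTE.
constructor 3; have : bits vs D \in middle m.
  by rewrite mem_filter /hsm -(hereditarymE pm) -(saturatedmE pm) hD sD D0 D1 (mem_bits pm).
by rewrite mE inE => /eqP <-; rewrite (bitsK pm).
Qed.

Lemma middle_quotient (K : fieldType) : size (middle m) == 1%N ->
  exists (H : {set vertex E}) (hH : hereditary H), only_hs H /\
    ring_isomorphic (lpa K (quotient_graph hH)) (lpa K (mgraph (lim m))).
Proof.
move=> m1; have oH := middle_only_hs m1; have [hH _ _ _ _] := oH.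
exists _, hH; split=> //; have [ws pw] := presented_quotient hH.
suff bE : bits vs (setb vs (head [::] (middle m))) = head [::] (middle m).
  by rewrite bE in pw; exact: (presented_model K pw (square_submx _ _)).
apply: (setbK pm); move: m1; case mE : (middle m) => [|b s] //= _.
have : b \in middle m by rewrite mE mem_head.
by rewrite mem_filter => /andP[].
Qed.

End Quotients.

(** * Counting morphisms by labellings *)

Section Counts.
Variables (A : eqType) (a0 : A) (op : Monoid.com_law a0) (vals : seq A).
Hypotheses (uvals : uniq vals) (hvals : forall a, a \in vals).

(* The homomorphisms from the monoid generated by the vertices to (A, op) that
   send the sum of the vertices to c, as lists of values. *)
Definition homs m c := [seq s <- seqs (size m) vals |
  all (fun i => sinkm m i ||
    (nth a0 s i == foldr (fun j x => if ent m i j then op (nth a0 s j) x else x) a0 (idx m)))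
    (idx m) && (foldr op a0 s == c)].

Lemma sum_out_edges (E : graph) (v : vertex E) (F : vertex E -> A) : condition_Sing E ->
  \big[op/a0]_(e | src e == v) F (rng e) = \big[op/a0]_(w | adj v w) F w.
Proof.
move=> sing; rewrite (partition_big (@rng E) (adj v)) /=; last first.
  by move=> e /eqP <-; exact: adj_edge.
apply: eq_bigr => w /adjP[e ev ew]; rewrite (big_pred1 e) ?ew // => f.
apply/andP/eqP => [[/eqP fv /eqP fw]|->]; last by rewrite ev ew !eqxx.
by apply: sing; rewrite ?fv ?fw.
Qed.

Section Presented.
Variables (E : graph) (vs : seq (vertex E)) (m : seq (seq bool)).
Hypothesis pm : presented vs m.

Lemma mem_homs c (phi : vertex E -> A) :
  vsol op c phi <-> [seq phi v | v <- vs] \in homs m c.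
Proof.
have [sing ls _] := pm; have [u h] := ls.
have nthE v : nth a0 [seq phi v | v <- vs] (index v vs) = phi v.
  by rewrite (nth_map v) ?index_mem // nth_index.
have sumE : \big[op/a0]_v phi v = foldr op a0 [seq phi v | v <- vs].
  rewrite (perm_big vs (listing_perm ls)) /=.
  by elim: (vs) => [|v s IH]; rewrite ?big_nil // big_cons IH.
have outE v : \big[op/a0]_(e | src e == v) phi (rng e) = foldr (fun j x =>
    if ent m (index v vs) j then op (nth a0 [seq phi v | v <- vs] j) x else x) a0 (idx m).
  rewrite (sum_out_edges _ _ sing) (perm_big vs (listing_perm ls)) /= (idxE pm) -big_filter.
  rewrite big_filter; elim: {1 5}vs => [|w s IH]; rewrite ?big_nil //= big_cons IH.
  by rewrite (entE pm) nthE.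
rewrite mem_filter mem_seqs size_map (presented_size pm) eqxx /=.
have -> : all (mem vals) [seq phi v | v <- vs] by apply/allP => a _; exact: hvals.
rewrite andbT; split=> [[comp <-]|/andP[/(allP_idx pm) comp /eqP sc]].
  apply/andP; split; last by rewrite sumE.
  apply/(allP_idx pm) => v; case: (sinkP pm v) => //= nsv; apply/eqP.
  by rewrite nthE (comp v nsv) outE.
split; last by rewrite sumE.
move=> v nsv; have := comp v; case: (sinkP pm v) => //= _ /eqP.
by rewrite nthE outE.
Qed.

Lemma homs_surj c s : s \in homs m c -> exists phi, s = [seq phi v | v <- vs].
Proof.
rewrite mem_filter mem_seqs => /andP[_ /andP[/eqP sz _]].
exists (fun v => nth a0 s (index v vs)).
apply: (@eq_from_nth _ a0) => [|i li]; first by rewrite sz size_map (presented_size pm).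
have : i \in idx m by rewrite mem_iota -sz.
rewrite (idxE pm) => /mapP[v _ ->]; have [_ [_ h] _] := pm.
by rewrite (nth_map v) ?index_mem // nth_index.
Qed.

End Presented.

(** A transfer is only an injection of solutions and gives an inequality; [eq_hcounts] combines one
    in each direction. *)
Lemma leq_homs (K : fieldType) (E F : graph) (vs : seq (vertex E)) (ws : seq (vertex F)) m m'
    (theta : (fgproj (lpa K F) -> A) -> fgproj (lpa K E) -> A) c :
  presented vs m -> presented ws m' -> vhom_transfer op theta ->
  (size (homs m' c) <= size (homs m c))%N.
Proof.
move=> pm pm' ht; have [T [Tsol Tinj]] := vsol_transfer ht.
pose f s := [seq T (fun w => nth a0 s (index w ws)) v | v <- vs].
have [_ [u h] _] := pm; have [_ [u' h'] _] := pm'.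
have nthE (phi : vertex F -> A) : (fun w => nth a0 [seq phi w | w <- ws] (index w ws)) = phi.
  by apply: funext => w; rewrite (nth_map w) ?index_mem // nth_index.
rewrite -(size_map f); apply: uniq_leq_size.
  rewrite map_inj_in_uniq ?filter_uniq ?uniq_seqs // => s t hs hs'.
  have [phi sE] := homs_surj pm' hs; have [psi tE] := homs_surj pm' hs'.
  move: hs hs'; rewrite sE tE => /(mem_homs pm') sp /(mem_homs pm') tp.
  rewrite /f !nthE => /eq_in_map e; apply: eq_map.
  by apply: (Tinj c) => // v; apply: e.
move=> _ /mapP[s hs ->]; have [phi sE] := homs_surj pm' hs; rewrite /f sE nthE.
by apply/(mem_homs pm); apply: Tsol; apply/(mem_homs pm'); rewrite -sE.
Qed.

Definition hcounts m := [seq size (homs m c) | c <- vals].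

Lemma eq_hcounts (K : fieldType) (E F : graph) (vs : seq (vertex E)) (ws : seq (vertex F)) m m' :
  presented vs m -> presented ws m' ->
  (exists theta, @vhom_transfer A a0 op (lpa K E) (lpa K F) theta) ->
  (exists theta, @vhom_transfer A a0 op (lpa K F) (lpa K E) theta) ->
  hcounts m = hcounts m'.
Proof.
move=> pm pm' [t1 h1] [t2 h2]; apply: eq_map => c; apply/eqP.
by rewrite eqn_leq (leq_homs c pm' pm h2) (leq_homs c pm pm' h1).
Qed.

Lemma iso_hcounts (K : fieldType) (E F : graph) (vs : seq (vertex E)) (ws : seq (vertex F)) m m' :
  presented vs m -> presented ws m' -> ring_isomorphic (lpa K E) (lpa K F) ->
  hcounts m = hcounts m'.
Proof.
move=> pm pm' EF; apply: (eq_hcounts pm pm' (iso_transfer op EF)).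
exact: iso_transfer (ring_iso_sym EF).
Qed.

End Counts.

Arguments iso_hcounts {A a0} op {vals} _ _ {K E F vs ws m m'}.
Arguments eq_hcounts {A a0} op {vals} _ _ {K E F vs ws m m'}.

Lemma pointed_K0_sym (R S : pzRingType) :
  pointed_K0_isomorphic R S -> pointed_K0_isomorphic S R.
Proof.
move=> [f [[g fK gK] fD f1]]; exists g; split; first by exists f.
- by move=> x y; rewrite -{1}(gK x) -{1}(gK y) -fD fK.
- by rewrite -f1 fK.
Qed.

(** * The classification *)

Definition matrices n := seqs n (seqs n [:: false; true]).

Fixpoint lex (s t : seq bool) : bool :=
  match s, t with
  | x :: s', y :: t' => if x == y then lex s' t' else y
  | _, _ => true
  end.

(* Least among its relabellings; 116 matrices of size 1, 2 or 3 are. *)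
Definition canonical m :=
  all (fun p => lex (flatten m) (flatten (submx m p))) (permutations (idx m)).

(** The default [m] lets [canon_iso] hold without knowing that a canonical relabelling exists. *)
Definition canon m :=
  let ms := [seq submx m p | p <- permutations (idx m)] in nth m ms (find canonical ms).

Definition small : seq (seq (seq bool)) :=
  flatten [seq filter canonical (matrices n) | n <- iota 1 3].

Definition shift_edges m :=
  [seq (m, canon (shiftm ij.1 ij.2 m)) | ij <- allpairs pair (idx m) (idx m)
     & shiftable m ij.1 ij.2].

(* The shift moves leave 60 classes; splittings of graphs with two vertices identify
   three more pairs. *)
Definition split_edges m :=
  [seq (m, canon (splitm i (pred1 0%N) m)) | i <- idx m
     & (size m == 2%N) && splittable m i (pred1 0%N)].

Definition graph_edges := flatten [seq shift_edges m ++ split_edges m | m <- small].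

(** A matrix that is not listed is its own label, so [label_iso] holds for every matrix. *)
Definition label (L : seq (seq (seq bool) * seq (seq bool))) m :=
  (nth (m, m) L (find (fun x => x.1 == m) L)).2.

(* Union-find: L maps every matrix to a representative of its class. *)
Definition merge (L : seq (seq (seq bool) * seq (seq bool)))
    (e : seq (seq bool) * seq (seq bool)) :=
  let a := label L e.1 in let b := label L e.2 in
  if a == b then L else [seq (x.1, if x.2 == b then a else x.2) | x <- L].

Definition labels := foldl merge [seq (m, m) | m <- small] graph_edges.

Definition residues n : seq 'Z_n := [seq inZp i | i <- iota 0 (Zp_trunc n).+2].

Definition add_law n : Monoid.com_law (0 : 'Z_n) := @GRing.add 'Z_n.
Definition mul_law n : Monoid.com_law (1 : 'Z_n) := @GRing.mul 'Z_n.

(* In the multiplicative monoid of Z/4 the element 2 satisfies 2 * 2 = 0, so that it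
   detects multiplicities 0, 1 and at least 2, which no group does. *)
Definition add3 := hcounts (add_law 3) (residues 3).
Definition add4 := hcounts (add_law 4) (residues 4).
Definition mul4 := hcounts (mul_law 4) (residues 4).

Lemma add_transfer n (R S : pzRingType) : pointed_K0_isomorphic R S ->
  exists theta, vhom_transfer (add_law n) (R := R) (S := S) theta.
Proof. by apply: (@K0_transfer _ _ (add_law n) -%R); exact: addrN. Qed.

Definition socle0 m := ~~ has (sinkm m) (idx m).
Definition soclec m := all (fun j => sinkm m j ==> ~~ has (ent m ^~ j) (idx m)) (idx m).

(* ring_inv depends only on the isomorphism class of the ring, data_inv only on the
   data of same_invariants; either one separates the classes.  Conversely graph_inv is
   what has to be constant on the classes for isomorphic algebras to have the same
   data. *)
Definition ring_inv m :=
  [:: add3 m; add4 m; mul4 m; add3 (socm m); add4 (socm m); mul4 (socm m);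
      [:: nat_of_bool (socle0 m); nat_of_bool (soclec m)]].

Definition data_inv m :=
  [:: add3 m; add4 m; [:: ILNm m; HSm m; nat_of_bool (MT3m m && Lm m);
      nat_of_bool (socle0 m); nat_of_bool (soclec m)]; mul4 (socm m);
      if HSm m == 1%N then mul4 (lim m) else [::]].

(** L/I enters through its label and not through counts: an isomorphism between the quotients has to
    be produced, and equal labels provide one. *)
Definition graph_inv L m := ([:: ILNm m; HSm m; nat_of_bool (MT3m m && Lm m)],
  if HSm m == 1%N then label L (canon (lim m)) else [::]).

Definition table L :=
  [seq (label L m, (ring_inv m, data_inv m, graph_inv L m)) | m <- small].

Definition check_rows (x y : seq (seq bool) *
    (seq (seq nat) * seq (seq nat) * (seq nat * seq (seq bool)))) :=
  if x.1 == y.1 then x.2.2 == y.2.2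
  else (x.2.1.1 != y.2.1.1) && (x.2.1.2 != y.2.1.2).

Definition check_table L := let t := table L in all (fun x => all (check_rows x) t) t.

Definition digit_matrix (d : nat * seq nat) :=
  mx d.1 (fun i j => 10 * i.+1 + j.+1 \in d.2)%N.

Definition check_small :=
  all (fun m => [&& square m, (0 < size m <= 3)%N, hsm m (socbits m)
    & (HSm m == 1%N) ==> (size (middle m) == 1%N)]) small &&
  all (fun n => all (fun m => has (fun p => canonical (submx m p)) (permutations (idx m)))
    (matrices n)) (iota 1 3).

Definition check_classes L :=
  let reps := undup (map snd L) in
  [&& size reps == 57%N, all (fun r => (r \in small) && (label L r == r)) reps,
    all (fun m => label L m \in reps) small
    & let ds := [seq label L (canon (digit_matrix d)) | d <- L3_list] in
      all (fun r => r \in ds) reps].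

Lemma check_smallT : check_small. Proof. by vm_compute. Qed.
Lemma check_classesT : check_classes labels. Proof. by vm_compute. Qed.
Lemma check_tableT : check_table labels. Proof. by vm_compute. Qed.

Section Classification.
Variable K : fieldType.
Local Notation model m := (lpa K (mgraph m)).
Implicit Type m : seq (seq bool).

Lemma small_square m : m \in small -> square m.
Proof. by have /andP[/allP h _] := check_smallT; move=> /h /andP[]. Qed.

Lemma canon_iso m : square m -> ring_isomorphic (model m) (model (canon m)).
Proof.
move=> sq; rewrite /canon; set ms := map _ _; set k := find _ _.
have [lk|lk] := ltnP k (size ms); last by rewrite nth_default //; exact: ring_iso_refl.
have /mapP[p + ->] := mem_nth m lk; rewrite mem_permutations.
exact: submx_iso.
Qed.

Lemma edges_iso e : e \in graph_edges -> ring_isomorphic (model e.1) (model e.2).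
Proof.
move=> /flattenP[es /mapP[m ms ->]]; have sq := small_square ms.
rewrite mem_cat => /orP[/mapP[[i j]]|/mapP[i]]; rewrite mem_filter.
  move=> /andP[sh /allpairsP[[k l] /= [ki lj [ik jl]]]] ->; rewrite /= in sh *.
  move: ki lj; rewrite -ik -jl !mem_iota => /= li lj.
  exact: ring_iso_trans (shiftm_iso K li lj sh) (canon_iso (square_mx _ _)).
move=> /andP[/andP[_ sp]]; rewrite mem_iota => /= li -> /=.
apply: ring_iso_trans (canon_iso (square_mx _ _)); apply: ring_iso_sym.
exact: splitm_iso.
Qed.

(** Merging preserves the property that every listed matrix and its representative have isomorphic
    algebras, because each edge is an isomorphism. Whether enough isomorphisms were found is a
    separate question, settled by [check_tableT]. *)
Lemma label_iso m : ring_isomorphic (model m) (model (label labels m)).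
Proof.
pose good (L : seq (seq (seq bool) * seq (seq bool))) :=
  forall x, x \in L -> ring_isomorphic (model x.1) (model x.2).
have lab L m' : good L -> ring_isomorphic (model m') (model (label L m')).
  move=> gL; rewrite /label; set k := find _ _.
  have [lk|lk] := ltnP k (size L); last by rewrite nth_default //; exact: ring_iso_refl.
  have hk : has (fun x => x.1 == m') L by rewrite has_find.
  have /eqP e := nth_find (m', m') hk.
  by have := gL _ (mem_nth (m', m') lk); rewrite e.
apply: (lab labels m); rewrite /labels.
have : good [seq (m, m) | m <- small] by move=> _ /mapP[m' _ ->]; exact: ring_iso_refl.
have := @edges_iso; elim: graph_edges [seq _ | _ <- _] => //= e es IH L he gL.
apply: IH => [f fes|]; first by apply: he; rewrite inE fes orbT.
rewrite /merge; case: eqP => // _ _ /mapP[x xL ->] /=; case: eqP => [xe|_]; last exact: gL.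
apply: ring_iso_trans (gL _ xL) _; rewrite xe.
apply: ring_iso_trans (ring_iso_sym (lab _ _ gL)) _.
apply: ring_iso_trans (lab _ _ gL); apply: ring_iso_sym; apply: he.
exact: mem_head.
Qed.

Lemma L3_presented E : in_L3 E -> exists (vs : seq (vertex E)) m,
  presented vs m /\ m \in small.
Proof.
move=> [sing szE]; pose vs := enum (vertex E).
pose m0 := [seq [seq adj v w | w <- vs] | v <- vs].
have pm : presented vs m0 by split=> //; split=> [|v]; rewrite ?enum_uniq ?mem_enum.
have sz0 : size m0 = #|vertex E| by rewrite size_map -cardE.
have inm vs' m : presented vs' m -> m \in matrices (size m).
  move=> [_ _ mE]; rewrite mem_seqs eqxx mE /=; apply/allP => _ /mapP[v _ ->].
  rewrite /= mem_seqs !size_map eqxx; apply/allP => -[]; by rewrite !inE.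
have /andP[_ /allP/(_ (size m0))] := check_smallT.
rewrite mem_iota sz0 ltnS => /(_ szE)/allP/(_ m0); rewrite -sz0 => /(_ (inm _ _ _ pm))/hasP[p].
rewrite mem_permutations => pp cp; have [vs' pm'] := presented_submx pm pp.
exists vs', (submx m0 p); split=> //; apply/flattenP.
exists (filter canonical (matrices (size m0))).
  by apply/mapP; exists (size m0); rewrite // mem_iota sz0 ltnS.
rewrite mem_filter cp /=; have := inm _ _ _ pm'.
by rewrite size_map (perm_size pp) size_iota.
Qed.

Lemma small_L3 m : m \in small -> in_L3 (mgraph m).
Proof.
move=> ms; have [sing ls _] := presented_mgraph (small_square ms); split=> //.
have /andP[/allP/(_ _ ms) + _] := check_smallT => /and4P[_ + _ _].
by rewrite -(size_listing ls) -cardE card_ord.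
Qed.

Lemma table_spec m m' : m \in small -> m' \in small ->
  (label labels m = label labels m' /\ graph_inv labels m = graph_inv labels m') \/
  (ring_inv m <> ring_inv m' /\ data_inv m <> data_inv m').
Proof.
move=> ms ms'; have := check_tableT; rewrite /check_table; set t := table _ => /allP h.
have inT n : n \in small -> (label labels n, (ring_inv n, data_inv n, graph_inv labels n)) \in t.
  by move=> ns; apply/mapP; exists n.
have spec a b r r' d d' g g' : check_rows (a, (r, d, g)) (b, (r', d', g')) ->
    (a = b /\ g = g') \/ (r <> r' /\ d <> d').
  rewrite /check_rows /=; case: (a =P b) => [ab /eqP|_ /andP[/eqP hr /eqP hd]]; [by left|by right].
have /allP hm := h _ (inT m ms).
exact (spec _ _ _ _ _ _ _ _ (hm _ (inT m' ms'))).
Qed.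

Section Pair.
Variables (E F : graph) (vs : seq (vertex E)) (ws : seq (vertex F)) (m m' : seq (seq bool)).
Hypotheses (pm : presented vs m) (pm' : presented ws m') (ms : m \in small) (ms' : m' \in small).
Local Notation L := (lpa K E).
Local Notation M := (lpa K F).

Let soc n : n \in small -> hsm n (socbits n).
Proof. by have /andP[/allP h _] := check_smallT; move=> /h /and4P[]. Qed.

Let socm_counts (A : eqType) a0 (op : Monoid.com_law a0) (vals : seq A) :
  uniq vals -> (forall a, a \in vals) ->
  ring_isomorphic (quot_ring (socle L)) (quot_ring (socle M)) ->
  hcounts op vals (socm m) = hcounts op vals (socm m').
Proof.
move=> uv hv LM; apply: (@iso_hcounts _ _ op _ uv hv K).
- exact: presented_mgraph (square_submx _ _).
- exact: presented_mgraph (square_submx _ _).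
apply: ring_iso_trans (ring_iso_sym (socle_quotient pm K (soc ms))) _.
exact: ring_iso_trans LM (socle_quotient pm' K (soc ms')).
Qed.

Lemma residuesP n : uniq (residues n) /\ forall a, a \in residues n.
Proof.
have mE : map val (residues n) = iota 0 (Zp_trunc n).+2.
  rewrite -map_comp -[RHS]map_id; apply/eq_in_map => i; rewrite mem_iota => /= li.
  by rewrite modn_small.
split; first by rewrite -(map_inj_uniq val_inj) mE iota_uniq.
by move=> a; rewrite -(mem_map val_inj) mE mem_iota /=.
Qed.

Let soc0E : ideal_ring_isomorphic (socle L) (socle M) -> socle0 m = socle0 m'.
Proof.
move=> /ideal_iso_eq0; rewrite (socle_eq0m pm) (socle_eq0m pm') => h.
by apply/idP/idP => /h.
Qed.

Let soccE : ideal_ring_isomorphic (socle L) (socle M) -> soclec m = soclec m'.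
Proof.
move=> /ideal_iso_comm; rewrite (socle_commm pm) (socle_commm pm') => h.
by apply/idP/idP => /h.
Qed.

Lemma iso_ring_inv : ring_isomorphic L M -> ring_inv m = ring_inv m'.
Proof.
move=> LM; have [socLM qLM] := socle_iso LM.
have [[u3 h3] [u4 h4]] := (residuesP 3, residuesP 4).
have a3 : add3 m = add3 m' by exact: (iso_hcounts (add_law 3) u3 h3 pm pm' LM).
have a4 : add4 m = add4 m' by exact: (iso_hcounts (add_law 4) u4 h4 pm pm' LM).
have b4 : mul4 m = mul4 m' by exact: (iso_hcounts (mul_law 4) u4 h4 pm pm' LM).
have s3 : add3 (socm m) = add3 (socm m') by exact: (socm_counts (add_law 3) u3 h3 qLM).
have s4 : add4 (socm m) = add4 (socm m') by exact: (socm_counts (add_law 4) u4 h4 qLM).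
have t4 : mul4 (socm m) = mul4 (socm m') by exact: (socm_counts (mul_law 4) u4 h4 qLM).
rewrite /ring_inv a3 a4 b4 s3 s4 t4 (soc0E socLM) (soccE socLM).
reflexivity.
Qed.

Lemma iso_label : ring_isomorphic L M -> label labels m = label labels m'.
Proof.
move=> LM; have [[lab _]|[h _]] := table_spec ms ms'; first exact lab.
by case: h; exact: iso_ring_inv.
Qed.

Lemma label_model : label labels m = label labels m' -> ring_isomorphic L M.
Proof.
move=> lab; have sq := small_square ms; have sq' := small_square ms'.
apply: ring_iso_trans (presented_model K pm sq) _.
apply: ring_iso_trans (ring_iso_sym (presented_model K pm' sq')).
apply: ring_iso_trans (label_iso m) _; rewrite lab.
exact/ring_iso_sym/label_iso.
Qed.

Let middle1 n : n \in small -> HSm n = 1%N -> size (middle n) == 1%N.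
Proof.
by have /andP[/allP h _] := check_smallT; move=> /h /and4P[_ _ _ /implyP +] e; rewrite e; apply.
Qed.

(** K_0 and the socle are transported along the isomorphism. The other data are read off the table:
    distinct labels would give distinct ring invariants, so the labels agree and with them
    [graph_inv]. *)
Lemma iso_same_invariants : ring_isomorphic L M -> same_invariants K E F.
Proof.
move=> LM; have [socLM qLM] := socle_iso LM.
have [[_]|[h _]] := table_spec ms ms'; last by case: h; exact: iso_ring_inv.
rewrite /graph_inv => -[iln hs ml lim_eq].
split; first exact: iso_pointed_K0.
split=> //; split=> //; split; first by rewrite (ILNmE pm) (ILNmE pm').
split; first by rewrite (HSmE pm) (HSmE pm').
split; last first.
  rewrite (MT3mP pm) (LmP pm) (MT3mP pm') (LmP pm').
  have e : MT3m m && Lm m = MT3m m' && Lm m'.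
    by move: ml; case: (_ && _); case: (_ && _).
  by split=> /andP h; apply/andP; [rewrite -e|rewrite e].
rewrite (HSmE pm) => h1; have h1' : HSm m' = 1%N by rewrite -hs.
have [H [hH [oH qH]]] := middle_quotient pm K (middle1 ms h1).
have [H' [hH' [oH' qH']]] := middle_quotient pm' K (middle1 ms' h1').
apply/(LI_isomorphicP K hH hH' oH oH').
apply: ring_iso_trans qH _; apply: ring_iso_trans (ring_iso_sym qH').
apply: ring_iso_trans (canon_iso (square_submx _ _)) _.
apply: ring_iso_trans (ring_iso_sym (canon_iso (square_submx _ _))).
apply: ring_iso_trans (label_iso _) _; apply: ring_iso_trans (ring_iso_sym (label_iso _)).
by move: lim_eq; rewrite h1 h1' eqxx => ->; exact: ring_iso_refl.
Qed.

(** K_0 yields the additive counts only; the multiplicative ones are taken on L/Soc and L/I, which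
    are given up to ring isomorphism. Together they determine [data_inv], hence the label, and a
    label determines the algebra. *)
Lemma same_invariants_iso : same_invariants K E F -> ring_isomorphic L M.
Proof.
move=> [k0 [socLM [qLM [iln [hs [li ml]]]]]]; apply: label_model.
have [[u3 h3] [u4 h4]] := (residuesP 3, residuesP 4).
have k0' := pointed_K0_sym k0.
have a3 : add3 m = add3 m'.
  exact: (eq_hcounts (add_law 3) u3 h3 pm pm' (add_transfer 3 k0) (add_transfer 3 k0')).
have a4 : add4 m = add4 m'.
  exact: (eq_hcounts (add_law 4) u4 h4 pm pm' (add_transfer 4 k0) (add_transfer 4 k0')).
have t4 : mul4 (socm m) = mul4 (socm m') by exact: (socm_counts (mul_law 4) u4 h4 qLM).
have iln_eq : ILNm m = ILNm m' by rewrite -(ILNmE pm) -(ILNmE pm').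
have hsm_eq : HSm m = HSm m' by rewrite -(HSmE pm) -(HSmE pm').
have ml_eq : MT3m m && Lm m = MT3m m' && Lm m'.
  by apply/andP/andP; rewrite -(MT3mP pm) -(LmP pm) -(MT3mP pm') -(LmP pm') => /ml.
suff lim_eq : (if HSm m == 1%N then mul4 (lim m) else [::]) =
    (if HSm m' == 1%N then mul4 (lim m') else [::]).
  have [[lab _]|[_ h]] := table_spec ms ms'; first exact lab.
  case: h; rewrite /data_inv lim_eq a3 a4 t4 iln_eq hsm_eq ml_eq (soc0E socLM) (soccE socLM).
  reflexivity.
rewrite -hsm_eq; case: eqP => [h1|_]; last reflexivity.
have h1' : HSm m' = 1%N by rewrite -hsm_eq.
have [H [hH [oH qH]]] := middle_quotient pm K (middle1 ms h1).
have [H' [hH' [oH' qH']]] := middle_quotient pm' K (middle1 ms' h1').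
apply: (@iso_hcounts _ _ (mul_law 4) _ u4 h4 K).
- exact: presented_mgraph (square_submx _ _).
- exact: presented_mgraph (square_submx _ _).
apply: ring_iso_trans (ring_iso_sym qH) _; apply: ring_iso_trans qH'.
by apply/(LI_isomorphicP K hH hH' oH oH')/li; rewrite (HSmE pm).
Qed.

End Pair.

Lemma presented_digit n s :
  @presented (digit_graph n s) (enum 'I_n) (digit_matrix (n, s)).
Proof. exact: (presented_ord n (fun i j => 10 * i.+1 + j.+1 \in s)%N). Qed.

End Classification.

Theorem theorem4p8 (K : fieldType) :
  (exists C : 'I_57 -> graph,
     [/\ forall i, in_L3 (C i),
         forall i j, ring_isomorphic (lpa K (C i)) (lpa K (C j)) -> i = j
       & forall E, in_L3 E -> exists i, ring_isomorphic (lpa K E) (lpa K (C i))]) /\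
  (forall d, d \in L3_list -> in_L3 (digit_graph d.1 d.2)) /\
  (forall E, in_L3 E ->
     exists2 d, d \in L3_list &
       ring_isomorphic (lpa K E) (lpa K (digit_graph d.1 d.2))) /\
  (forall E F, in_L3 E -> in_L3 F ->
     ring_isomorphic (lpa K E) (lpa K F) <-> same_invariants K E F).
Proof.
have /and4P[/eqP szr /allP rep /allP labr /allP listed] := check_classesT.
set reps := undup _ in szr rep labr listed.
have repP r : r \in reps -> r \in small /\ label labels r = r.
  by move=> /rep/andP[rs /eqP lr]; split; [exact rs|exact lr].
split; last split; last split.
- have lts (i : 'I_57) : (i < size reps)%N by rewrite szr ltn_ord.
  have lt (i : 'I_57) : nth [::] reps i \in reps := mem_nth _ (lts i).
  pose C (i : 'I_57) := mgraph (nth [::] reps i).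
  exists C; split=> [i|i j ij|E /L3_presented[vs [m [pm ms]]]].
  + by apply: small_L3; have [] := repP _ (lt i).
  + have [si li] := repP _ (lt i); have [sj lj] := repP _ (lt j).
    (* Representatives are fixed by the labelling, so equal labels make them equal. *)
    have lij := iso_label (presented_mgraph (small_square si))
      (presented_mgraph (small_square sj)) si sj ij.
    have /eqP := etrans (esym li) (etrans lij lj).
    by rewrite (nth_uniq [::] (lts i) (lts j) (undup_uniq _)) => /eqP/ord_inj.
  have lr := labr _ ms; have li : (index (label labels m) reps < 57)%N by rewrite -szr index_mem.
  exists (Ordinal li); have -> : C (Ordinal li) = mgraph (label labels m).
    exact (congr1 mgraph (nth_index [::] lr)).
  exact (ring_iso_trans (presented_model K pm (small_square ms)) (label_iso K m)).
- have szL : all (fun d : nat * seq nat => 0 < d.1 <= 3)%N L3_list by vm_compute.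
  move=> d dL; have [sing _ _] := presented_digit d.1 d.2; split; first exact sing.
  by rewrite card_ord; exact: (allP szL d dL).
- move=> E /L3_presented[vs [m [pm ms]]].
  have /mapP[d dL lE] := listed _ (labr _ ms); exists d; first exact dL.
  apply: ring_iso_trans (presented_model K pm (small_square ms)) _.
  apply: ring_iso_trans (label_iso K m) _; rewrite lE.
  apply: ring_iso_trans (ring_iso_sym (label_iso K _)) _.
  apply: ring_iso_trans (ring_iso_sym (canon_iso K (square_mx _ _))) _.
  exact/ring_iso_sym/(presented_model K (presented_digit d.1 d.2))/square_mx.
move=> E F /L3_presented[vs [m [pm ms]]] /L3_presented[ws [m' [pm' ms']]].
split; first exact: iso_same_invariants pm pm' ms ms'.
exact: same_invariants_iso pm pm' ms ms'.
Qed.
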